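(* Let $\mathcal H(\mathbb R^n)$ be the holonomic Schwartz class. Then $[\mathcal F\colon\mathcal H(\mathbb R^n)\to\mathcal H(\mathbb R^n)]$ is a regular twain subsinglet of $[\mathcal F\colon\mathcal S(\mathbb R^n)\to\mathcal S(\mathbb R^n)]$ with compatible Weyl action. That is, $\mathcal H(\mathbb R^n)$ is a linear subspace of $\mathcal S(\mathbb R^n)$ closed under convolution, pointwise multiplication, the Heisenberg actions and the Weyl algebra $A_n(\mathbb C)$, $\mathcal F$ restricts to a bijection of $\mathcal H(\mathbb R^n)$ onto itself, and the compatible Weyl action on $\mathcal S(\mathbb R^n)$ restricts to it.
   Context: $\tau=2\pi$. $\mathcal S(\mathbb R^n)$ is the space of complex-valued Schwartz functions, with convolution $\star$ and pointwise product $\cdot$, and $\mathcal F s(\xi)=\int_{\mathbb R^n}e^{i\tau x\cdot\xi}s(x)\,dx$. $A_n(\mathbb C)$ is the Weyl algebra of linear differential operators on $\mathbb R^n$ with complex polynomial coefficients, generated by $x_j$ and $\partial_k$, acting in the usual way; $D_k:=\frac1{i\tau}\partial_k$. A distribution $s\in\mathcal D'(\mathbb R^n)$ is holonomic if, with $I_s=\{T\in A_n(\mathbb C)\mid Ts=0\}$, the left module $A_n(\mathbb C)/I_s$ is holonomic. $\mathcal B'(\mathbb R^n)$ is the set of holonomic distributions, and $\mathcal H(\mathbb R^n):=\mathcal B'(\mathbb R^n)\cap\mathcal S(\mathbb R^n)$. The Heisenberg group of the duality $\langle\xi|x\rangle=e^{i\tau x\cdot\xi}$ on $\mathbb R^n\times\mathbb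 R^n$ acts on signals from the left by $(x\bullet s)(y)=s(y-x)$, $(\xi\bullet s)(y)=e^{i\tau\xi\cdot y}s(y)$, and on spectra from the right by $(\sigma\bullet\xi)(\eta)=\sigma(\eta-\xi)$, $(\sigma\bullet x)(\eta)=e^{i\tau\eta\cdot x}\sigma(\eta)$, unit complex numbers acting by scalar multiplication. A twain subsinglet of the Schwartz singlet is a subspace closed under both products, the Heisenberg actions and $\mathcal F$; it is regular if $\mathcal F$ restricts to a bijection of it. A compatible Weyl action is an action of $A_n(\mathbb C)$ such that: (a) $[D_k,e_j^\alpha]=\delta_{jk}\,\alpha\,e_j^\alpha$ and $[t_k^a,x_j]=-\delta_{jk}\,a\,t_k^a$, where $e_j^\alpha$ is multiplication by $e^{i\tau\alpha x_j}$ and $t_k^a$ is translation by $a$ along the $k$-th standard basis vector, while $e_j^\alpha$ commutes with all $x_k$ and $t_k^a$ with all $D_j$; (b) each $D_k$ is a derivation for $\cdot$ and a scalar for $\star$ (i.e. $D_k(s\star s')=(D_ks)\star s'$), each $x_j$ is a scalar for $\cdot$ and a derivation for $\star$; (c) $\mathcal F(T\cdot s)=\hat{\mathfrak f}(T)\cdot\mathcal F(s)$ and $\mathcal F^{-1}(T\cdot s)=\hat{\mathfrak f}^{-1}(T)\cdot\mathcal F^{-1}(s)$ for $T\in A_n(\mathbb C)$, where $\hat{\mathfrak f}$ is the automorphism of $A_n(\mathbb C)$ with $x_j\mapsto D_j$, $D_j\mapsto-x_j$. *)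

(* Defs.v *)
(* The notations of mpoly clash with those of MathComp-Analysis, hence the
   filtered import: mpoly n C is {mpoly C[n]}, mcoeff m p is p@_m, mpolyX C m is
   'X_[m], mnm1 i is U_(i), mderiv i p is p^`M(i). *)
From HB Require Import structures.
From mathcomp Require Import all_boot all_order all_algebra.
From mathcomp Require Import complex.
From mathcomp Require Import -(notations) ssrcomplements mpoly.
From mathcomp Require Import all_classical all_reals all_analysis.
Set Implicit Arguments.
Unset Strict Implicit.
Unset Printing Implicit Defensive.
Import Order.TTheory GRing.Theory Num.Theory.
Import numFieldNormedType.Exports.
Local Open Scope complex_scope.
Local Open Scope classical_set_scope.
Local Open Scope ring_scope.

(* The Weyl algebra A_n(C) on its basis x^a d^b: an element is the polynomial in
   n + n variables obtained by writing it with all x_j (variables lshift n j) on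
   the left of all d_j (variables rshift n j).  Its product is wmul below, not
   the commutative product of polynomials. *)
Definition weyl (C : comNzRingType) (n : nat) : Type := mpoly (n + n) C.

HB.instance Definition _ (C : comNzRingType) (n : nat) :=
  GRing.Lmodule.copy (weyl C n) (mpoly (n + n) C).

Section WeylAction.
Context {C : comNzRingType} {n : nat} {V : lmodType C}.
Implicit Types (X D f : 'I_n -> V -> V) (v : V) (T : weyl C n).

(* f_0^(e 0) ( f_1^(e 1) ( ... v)) *)
Definition iter_ops f (e : 'I_n -> nat) v : V :=
  foldr (fun j w => iter (e j) (f j) w) v (enum 'I_n).

Definition wmon X D (m : multinom (n + n)) v : V :=
  iter_ops X (fun j => m (lshift n j)) (iter_ops D (fun j => m (rshift n j)) v).

(* The action on V of T when x_j acts by X j and d_j by D j. *)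
Definition wact X D T v : V :=
  \sum_(m <- msupp T) mcoeff m T *: wmon X D m v.

Lemma wactE X D T v k : (msize T <= k)%N ->
  wact X D T v = \sum_(m : bmultinom (n + n) k) mcoeff m T *: wmon X D m v.
Proof.
move=> le_k; rewrite /wact (big_mksub (bmultinom (n + n) k)) ?msupp_uniq //=.
  rewrite big_rmcond //= => j /memN_msupp_eq0 ->.
  by rewrite scale0r.
by move=> x /msize_mdeg_lt /leq_trans; apply.
Qed.

Lemma wactP X D a T U v :
  wact X D (a *: T + U) v = a *: wact X D T v + wact X D U v.
Proof.
pose k := maxn (msize (a *: T + U : mpoly (n + n) C)) (maxn (msize T) (msize U)).
rewrite !(wactE X D v (k := k)) ?leq_max ?leqnn ?orbT//.
rewrite scaler_sumr -big_split /=; apply: eq_bigr => m _.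
by rewrite mcoeffD mcoeffZ scalerDl scalerA.
Qed.

Lemma wact1 X D v : wact X D (1 : mpoly (n + n) C) v = v.
Proof.
rewrite /wact msupp1 big_seq1 mcoeff1 eqxx scale1r /wmon /iter_ops.
elim: {2}(enum _) => [|i s /= ->]; last by rewrite mnm0E.
by elim: (enum _) => //= i s ->; rewrite mnm0E.
Qed.

Lemma wact0 X D v : wact X D 0 v = 0.
Proof. by rewrite /wact msupp0 big_nil. Qed.

Lemma wactZ X D a T v : wact X D (a *: T) v = a *: wact X D T v.
Proof. by have := wactP X D a T 0 v; rewrite wact0 !addr0. Qed.

Lemma wactD X D T U v : wact X D (T + U) v = wact X D T v + wact X D U v.
Proof. by have := wactP X D 1 T U v; rewrite !scale1r. Qed.

Lemma wactX X D m v : wact X D (mpolyX C m) v = wmon X D m v.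
Proof. by rewrite /wact msuppX big_seq1 mcoeffX eqxx scale1r. Qed.

Definition weyl_rep X D :=
  [/\ (forall j a u v, X j (a *: u + v) = a *: X j u + X j v),
      (forall j a u v, D j (a *: u + v) = a *: D j u + D j v),
      (forall i j v, X i (X j v) = X j (X i v)),
      (forall i j v, D i (D j v) = D j (D i v)) &
      (forall i j v, D i (X j v) = X j (D i v) + (i == j)%:R *: v)].

Lemma eq_iter_ops f e e' v : e =1 e' -> iter_ops f e v = iter_ops f e' v.
Proof. by rewrite /iter_ops => ee'; elim: (enum _) => //= i s ->; rewrite ee'. Qed.

Lemma iter_ops_S f e e' j v :
    (forall i k u, f i (f k u) = f k (f i u)) ->
    (forall i, e' i = e i + (j == i))%N ->
  iter_ops f e' v = f j (iter_ops f e v).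
Proof.
move=> fC e'E; rewrite /iter_ops.
suff H s : uniq s -> foldr (fun j w => iter (e' j) (f j) w) v s =
    if j \in s then f j (foldr (fun j w => iter (e j) (f j) w) v s)
    else foldr (fun j w => iter (e j) (f j) w) v s.
  by rewrite H ?enum_uniq// mem_enum.
elim: s => //= i s IH /andP[iNs us]; rewrite in_cons e'E (IH us).
have itC k u : iter k (f i) (f j u) = f j (iter k (f i) u).
  by elim: k => //= k ->; rewrite fC.
have [ji|_] := eqVneq j i; last by rewrite addn0; case: ifP.
by subst i; rewrite (negbTE iNs) addn1 /= -itC -iterSr.
Qed.

Lemma iter_ops_comm f g e v :
    (forall i u, g (f i u) = f i (g u)) ->
  g (iter_ops f e v) = iter_ops f e (g v).
Proof.
move=> gf; rewrite /iter_ops; elim: (enum _) => //= i s <-.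
by elim: (e i) => //= k <-; rewrite gf.
Qed.

Lemma wmon_mulX X D m j v : weyl_rep X D ->
  wmon X D (mnm_add m (mnm1 (lshift n j))) v = X j (wmon X D m v).
Proof.
move=> [_ _ XC _ _]; rewrite /wmon -(iter_ops_S (e' := fun i =>
  mnm_add m (mnm1 (lshift n j)) (lshift n i))) //.
  congr iter_ops; apply: eq_iter_ops => i.
  by rewrite mnmDE mnm1E eq_lrshift addn0.
by move=> i; rewrite mnmDE mnm1E (inj_eq (@lshift_inj _ _)).
Qed.

Lemma iter_ops_leibniz X D e e' j v : weyl_rep X D ->
    (forall i, e' i = e i - (j == i))%N ->
  D j (iter_ops X e v) =
    (e j)%:R *: iter_ops X e' v + iter_ops X e (D j v).
Proof.
move=> [Xl Dl XC DC DX] e'E; rewrite /iter_ops.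
have Xs i a u : X i (a *: u) = a *: X i u.
  have X0 : X i 0 = 0 by have := Xl i (-1) 0 0; rewrite scaler0 addr0 scaleN1r addNr.
  by have := Xl i a u 0; rewrite X0 !addr0.
have XD i u w : X i (u + w) = X i u + X i w.
  by have := Xl i 1 u w; rewrite !scale1r.
have itD i k u w : iter k (X i) (u + w) = iter k (X i) u + iter k (X i) w.
  by elim: k => //= k ->; rewrite XD.
have itZ i k a u : iter k (X i) (a *: u) = a *: iter k (X i) u.
  by elim: k => //= k ->; rewrite Xs.
have DXit i k u : D j (iter k (X i) u) =
    ((j == i) * k)%N%:R *: iter k.-1 (X i) u + iter k (X i) (D j u).
  elim: k => [|k IH] /=; first by rewrite muln0 scale0r add0r.
  rewrite DX IH XD Xs addrAC; congr (_ + _).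
  case: eqVneq => [_|_]; last by rewrite !mul0n !scale0r addr0.
  rewrite !mul1n; case: k {IH} => [|k] /=; first by rewrite scale0r add0r.
  by rewrite -scalerDl -natrD addn1.
suff H s : uniq s -> D j (foldr (fun i w => iter (e i) (X i) w) v s) =
    ((j \in s) * e j)%N%:R *: foldr (fun i w => iter (e' i) (X i) w) v s +
    foldr (fun i w => iter (e i) (X i) w) (D j v) s.
  by rewrite H ?enum_uniq// mem_enum mul1n.
elim: s => [_|i s IH /= /andP[iNs us]] /=; first by rewrite mul0n scale0r add0r.
rewrite in_cons DXit (IH us) itD itZ e'E addrA; congr (_ + _).
have [ji|_] := eqVneq j i; last by rewrite mul0n scale0r add0r subn0.
subst i; rewrite (negbTE iNs) mul0n scale0r addr0 subn1 mul1n; congr (_ *: _).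
congr iter; elim: s iNs {IH us} => //= i s IH; rewrite in_cons negb_or.
by move=> /andP[/negbTE ji /IH->]; rewrite e'E ji subn0.
Qed.

Lemma wmon_mulD X D m j v : weyl_rep X D ->
  D j (wmon X D m v) =
    (m (lshift n j))%:R *: wmon X D (mnm_sub m (mnm1 (lshift n j))) v +
    wmon X D (mnm_add m (mnm1 (rshift n j))) v.
Proof.
move=> XD; have [_ _ _ DC _] := XD; rewrite /wmon.
rewrite (iter_ops_leibniz (e' := fun i =>
    mnm_sub m (mnm1 (lshift n j)) (lshift n i))) //; last first.
  by move=> i; rewrite mnmBE mnm1E (inj_eq (@lshift_inj _ _)).
congr (_ *: iter_ops _ _ _ + _).
  by apply: eq_iter_ops => i; rewrite mnmBE mnm1E eq_lrshift subn0.
rewrite -(iter_ops_S (e' := fun i =>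
    mnm_add m (mnm1 (rshift n j)) (rshift n i))) //; last first.
  by move=> i; rewrite mnmDE mnm1E (inj_eq (@rshift_inj _ _)).
by apply: eq_iter_ops => i; rewrite mnmDE mnm1E eq_rlshift addn0.
Qed.

End WeylAction.

Section WeylRing.
Context {C : comNzRingType} {n : nat}.
Implicit Types (T U : weyl C n).

(* Left multiplication by x_j and by d_j on normally ordered operators:
   d_j x^a d^b = x^a d_j d^b + [d_j, x^a] d^b. *)
Definition wmulX (j : 'I_n) (U : mpoly (n + n) C) : mpoly (n + n) C :=
  mpolyX C (mnm1 (lshift n j)) * U.

Definition wmulD (j : 'I_n) (U : mpoly (n + n) C) : mpoly (n + n) C :=
  mderiv (lshift n j) U + mpolyX C (mnm1 (rshift n j)) * U.

Definition wmul T U : weyl C n := wact (wmulX : _ -> weyl C n -> weyl C n) wmulD T U.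

Lemma mderivXU (i k : 'I_(n + n)) :
  mderiv i (mpolyX C (mnm1 k)) = (i == k)%:R.
Proof.
rewrite mderivX mnm1E eq_sym; case: eqVneq => [->|]; last by rewrite scale0r.
rewrite scale1r -mpolyX0; congr mpolyX; apply/mnmP => j.
by rewrite mnmBE mnm0E subnn.
Qed.

Lemma weyl_repW : weyl_rep (wmulX : _ -> weyl C n -> weyl C n) wmulD.
Proof.
split => [j a u v|j a u v|i j v|i j v|i j v]; rewrite /wmulX /wmulD.
- by rewrite mulrDr -scalerAr.
- by rewrite linearP /= mulrDr -scalerAr scalerDr addrACA.
- by rewrite mulrCA.
- rewrite !linearD /= !mderivM !mderivXU !eq_lrshift !mul0r !add0r !mulrDr.
  by rewrite mderiv_comm -!addrA; congr (_ + _); rewrite addrCA [X in _ + (_ + X)]mulrCA.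
- rewrite mderivM mderivXU (inj_eq (@lshift_inj _ _)) mulrDr.
  rewrite scaler_nat mulr_natl addrC addrA addrAC.
  by congr (_ + _); rewrite addrC mulrCA.
Qed.

Lemma wact_wmulX (V : lmodType C) (X D : 'I_n -> V -> V) j T v :
  weyl_rep X D -> wact X D (wmulX j T) v = X j (wact X D T v).
Proof.
move=> XD; have [Xl _ _ _ _] := XD.
elim/mpolyind: T => [|c m T _ _ IH].
  have := Xl j (-1) 0 0; rewrite scaler0 addr0 scaleN1r addNr => X0.
  by rewrite /wmulX mulr0 wact0 X0.
rewrite /wmulX mulrDr -scalerAr -mpolyXD wactP (wactP X D c _ T) Xl -IH.
by rewrite !wactX addmC wmon_mulX.
Qed.

Lemma wact_wmulD (V : lmodType C) (X D : 'I_n -> V -> V) j T v :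
  weyl_rep X D -> wact X D (wmulD j T) v = D j (wact X D T v).
Proof.
move=> XD; have [_ Dl _ _ _] := XD; have [_ Wl _ _ _] := weyl_repW.
elim/mpolyind: T => [|c m T _ _ IH].
  have := Dl j (-1) 0 0; rewrite scaler0 addr0 scaleN1r addNr => D0.
  have := Wl j (-1) 0 0; rewrite scaler0 addr0 scaleN1r addNr => W0.
  by rewrite W0 wact0 D0.
rewrite Wl !wactP Dl -IH; congr (_ *: _ + _).
rewrite wactX wmon_mulD // /wmulD mderivX -mpolyXD addmC.
by rewrite wactP !wactX.
Qed.

Lemma wact_wmul (V : lmodType C) (X D : 'I_n -> V -> V) T U v :
  weyl_rep X D -> wact X D (wmul T U) v = wact X D T (wact X D U v).
Proof.
move=> XD; have [Xl Dl _ _ _] := XD.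
have itX j k W : wact X D (iter k (wmulX j) W) v = iter k (X j) (wact X D W v).
  by elim: k => //= k <-; rewrite wact_wmulX.
have itD j k W : wact X D (iter k (wmulD j) W) v = iter k (D j) (wact X D W v).
  by elim: k => //= k <-; rewrite wact_wmulD.
elim/mpolyind: T => [|c m T _ _ IH]; first by rewrite /wmul !wact0.
rewrite /wmul !wactP -IH; congr (_ *: _ + _).
rewrite !wactX /wmon /iter_ops; elim: {2 4}(enum _) => [|i s IHs] /=.
  by elim: (enum _) => //= i s IHs; rewrite itD IHs.
by rewrite itX IHs.
Qed.

Lemma wmon1 m : wmon (wmulX : _ -> weyl C n -> weyl C n) wmulD m 1 = mpolyX C m.
Proof.
pose Xl (i : 'I_n) := mpolyX C (mnm1 (lshift n i)).
pose Xr (i : 'I_n) := mpolyX C (mnm1 (rshift n i)).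
pose Pr s := \prod_(i <- s) Xr i ^+ m (rshift n i).
have dP j s : mderiv (lshift n j) (Pr s) = 0.
  rewrite /Pr; elim: s => [|i s IH]; first by rewrite big_nil -mpolyC1 mderivC.
  rewrite big_cons mderivM IH mulr0 addr0.
  suff -> : mderiv (lshift n j) (Xr i ^+ m (rshift n i)) = 0 by rewrite mul0r.
  elim: (m _) => [|k IHk]; first by rewrite expr0 -mpolyC1 mderivC.
  by rewrite exprS mderivM mderivXU eq_lrshift mul0r add0r IHk mulr0.
have HD s : foldr (fun j w => iter (m (rshift n j)) (wmulD j) w) 1 s = Pr s.
  elim: s => [|i s /= ->]; first by rewrite /Pr big_nil.
  rewrite {2}/Pr big_cons -/(Pr s).
  suff H k : iter k (wmulD i) (Pr s) = Xr i ^+ k * Pr s by [].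
  elim: k => [|k /= ->]; first by rewrite expr0 mul1r.
  rewrite /wmulD mderivM dP mulr0 addr0 exprS -mulrA -[RHS]add0r; congr (_ + _).
  suff -> : mderiv (lshift n i) (Xr i ^+ k) = 0 by rewrite mul0r.
  elim: k => [|k IHk]; first by rewrite expr0 -mpolyC1 mderivC.
  by rewrite exprS mderivM mderivXU eq_lrshift mul0r add0r IHk mulr0.
rewrite /wmon /iter_ops HD mpolyXE_id big_split_ord /= /Pr big_enum /=.
rewrite -[\prod_(i < n) _ ^+ m (lshift n i)]big_enum /=.
elim: (enum _) => [|i s /= ->]; first by rewrite big_nil mul1r.
rewrite big_cons -mulrA; elim: (m (lshift n i)) => [|k /= ->].
  by rewrite expr0 mul1r.
by rewrite /wmulX exprS -mulrA.
Qed.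

Lemma wmulA : associative (@wmul).
Proof. by move=> T U W; rewrite /wmul -wact_wmul //; exact: weyl_repW. Qed.

Lemma wmul1 : left_id (1 : mpoly (n + n) C) (@wmul).
Proof. by move=> T; rewrite /wmul wact1. Qed.

Lemma wmulr1 : right_id (1 : mpoly (n + n) C) (@wmul).
Proof.
move=> T; rewrite /wmul [RHS](mpolyE T) /wact.
by apply: eq_bigr => m _; rewrite wmon1.
Qed.

Lemma wmulDl : left_distributive (@wmul) +%R.
Proof. by move=> T U W; rewrite /wmul wactD. Qed.

Lemma wmulPr a T U W : wmul T (a *: U + W) = a *: wmul T U + wmul T W.
Proof.
rewrite /wmul; have [Xl Dl _ _ _] := weyl_repW.
have iP f e u v : (forall j a u v, f j (a *: u + v) = a *: f j u + f j v) ->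
    iter_ops f e (a *: u + v) = a *: iter_ops f e u + iter_ops f e v :> weyl C n.
  move=> fl; rewrite /iter_ops; elim: (enum _) => //= i s ->.
  by elim: (e i) => //= k ->; rewrite fl.
rewrite /wact scaler_sumr -big_split /=; apply: eq_bigr => m _.
by rewrite !scalerA mulrC -scalerA -scalerDr /wmon !iP.
Qed.

Lemma wmulDr : right_distributive (@wmul) +%R.
Proof. by move=> T U W; have := wmulPr 1 T U W; rewrite !scale1r. Qed.

Lemma woner_neq0 : (1 : mpoly (n + n) C) != 0 :> weyl C n.
Proof. exact: oner_neq0. Qed.

HB.instance Definition _ := GRing.Zmodule_isNzRing.Build (weyl C n)
  wmulA wmul1 wmulr1 wmulDl wmulDr woner_neq0.

Lemma wscalerAl (a : C) T U : a *: wmul T U = wmul (a *: T) U.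
Proof. by rewrite /wmul wactZ. Qed.

HB.instance Definition _ := GRing.Lmodule_isLalgebra.Build C (weyl C n) wscalerAl.

Lemma wscalerAr (a : C) T U : a *: wmul T U = wmul T (a *: U).
Proof.
have W0 : wmul T 0 = 0 by exact: (mulr0 (T : weyl C n)).
by have := wmulPr a T U 0; rewrite W0 !addr0 => /esym.
Qed.

HB.instance Definition _ := GRing.Lalgebra_isAlgebra.Build C (weyl C n) wscalerAr.

End WeylRing.

Definition wx {C : comNzRingType} {n : nat} (j : 'I_n) : weyl C n :=
  mpolyX C (mnm1 (lshift n j)).

Definition wd {C : comNzRingType} {n : nat} (j : 'I_n) : weyl C n :=
  mpolyX C (mnm1 (rshift n j)).

Lemma wactx (C : comNzRingType) n (V : lmodType C) (X D : 'I_n -> V -> V) j v :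
  weyl_rep X D -> wact X D (wx j) v = X j v.
Proof.
move=> XD; have := wact_wmulX j (1 : mpoly (n + n) C) v XD.
by rewrite /wmulX mulr1 wact1.
Qed.

Lemma wactd (C : comNzRingType) n (V : lmodType C) (X D : 'I_n -> V -> V) j v :
  weyl_rep X D -> wact X D (wd j) v = D j v.
Proof.
move=> XD; have := wact_wmulD j (1 : mpoly (n + n) C) v XD.
by rewrite /wmulD mulr1 -{1}mpolyC1 mderivC add0r wact1.
Qed.

Lemma wxE (C : comNzRingType) n (j : 'I_n) (T : weyl C n) : wx j * T = wmulX j T.
Proof. by apply: wactx; exact: weyl_repW. Qed.

Lemma wdE (C : comNzRingType) n (j : 'I_n) (T : weyl C n) : wd j * T = wmulD j T.
Proof. by apply: wactd; exact: weyl_repW. Qed.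

Lemma wd_wx (C : comNzRingType) n (i j : 'I_n) :
  wd i * wx j = wx j * wd i + (i == j)%:R :> weyl C n.
Proof.
have [_ _ _ _ H] := @weyl_repW C n; have := H i j (1 : weyl C n).
by rewrite -!wxE -!wdE !mulr1 scaler_nat.
Qed.

Lemma weyl_rep_mul (C : comNzRingType) (n : nat) (A : algType C) (x d : 'I_n -> A) :
    (forall i j, x i * x j = x j * x i) -> (forall i j, d i * d j = d j * d i) ->
    (forall i j, d i * x j = x j * d i + (i == j)%:R) ->
  weyl_rep (fun j u => x j * u) (fun j u => d j * u).
Proof.
move=> xC dC dx; split => [j a u v|j a u v|i j v|i j v|i j v].
- by rewrite mulrDr scalerAr.
- by rewrite mulrDr scalerAr.
- by rewrite !mulrA xC.
- by rewrite !mulrA dC.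
- by rewrite !mulrA dx mulrDl scaler_nat mulr_natl.
Qed.

(* The algebra endomorphism x_j |-> x j, d_j |-> d j. *)
Definition wsubst {C : comNzRingType} {n : nat} {A : algType C} (x d : 'I_n -> A)
  (T : weyl C n) : A := wact (fun j u => x j * u) (fun j u => d j * u) T 1.

Lemma wsubstM (C : comNzRingType) (n : nat) (A : algType C) (x d : 'I_n -> A)
    (T U : weyl C n) :
    (forall i j, x i * x j = x j * x i) -> (forall i j, d i * d j = d j * d i) ->
    (forall i j, d i * x j = x j * d i + (i == j)%:R) ->
  wsubst x d (T * U) = wsubst x d T * wsubst x d U.
Proof.
move=> xC dC dx; rewrite /wsubst wact_wmul; last exact: weyl_rep_mul.
set u := wact _ _ U 1; rewrite /wact mulr_suml; apply: eq_bigr => m _.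
rewrite -scalerAl; congr (_ *: _); rewrite /wmon /iter_ops.
elim: {2 4}(enum _) => [|i s /= ->].
  elim: (enum _) => [|i s /= ->]; first by rewrite mul1r.
  by elim: (m _) => //= k ->; rewrite mulrA.
by elim: (m _) => //= k ->; rewrite mulrA.
Qed.

Section FourierAutomorphism.
Context {R : realType} {n : nat}.

Definition itau : R[i] := 0 +i* (2 * pi).

Definition wD (j : 'I_n) : weyl R[i] n := itau^-1 *: wd j.

(* The automorphism x_j |-> D_j, D_j |-> - x_j, where d_j = itau D_j, and its
   inverse. *)
Definition hatf : weyl R[i] n -> weyl R[i] n :=
  wsubst wD (fun j => - itau *: wx j).

Definition hatf_inv : weyl R[i] n -> weyl R[i] n :=
  wsubst (fun j => - wD j) (fun j => itau *: wx j).

End FourierAutomorphism.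

Section Holonomic.
Context {C : fieldType} {n : nat}.
Implicit Types (I : set (weyl C n)) (chi : {poly rat}).

(* Operators x^a d^b of total order |a| + |b| <= k. *)
Definition bernstein (k : nat) : set (weyl C n) := [set T | (msize T <= k.+1)%N].

(* dim_C of F_k / (F_k :&: I) is d, where F_k is the Bernstein filtration: this
   is the k-th piece of the filtration of A_n / I generated by the class of 1. *)
Definition filtered_dim I (k d : nat) : Prop :=
  exists b : 'I_d -> weyl C n,
    [/\ forall i, bernstein k (b i),
        forall c : 'I_d -> C, I (\sum_i c i *: b i) -> forall i, c i = 0 &
        forall T, bernstein k T -> exists c : 'I_d -> C, I (T - \sum_i c i *: b i)].

Definition hilbert_polynomial I chi : Prop :=
  \forall k \near \oo, exists2 d, filtered_dim I k d & chi.[k%:R] = d%:R.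

(* For a left ideal I, the cyclic left module A_n / I is holonomic: it is zero or
   its dimension, the degree of its Hilbert polynomial, is n. *)
Definition holonomic_quotient I : Prop :=
  I = setT \/ exists2 chi, hilbert_polynomial I chi & size chi = n.+1.

End Holonomic.

Notation fn R n := ('rV[R]_n -> R[i]^o).

Section Analysis.
Context {R : realType} {n : nat}.
Implicit Types (f s t : fn R n) (j k : 'I_n) (x xi : 'rV[R]_n).

Definition basis_vec j : 'rV[R]_n := delta_mx 0 j.

Definition dot x xi : R := \sum_j x 0 j * xi 0 j.

Definition expi (a : R) : R[i] := cos a +i* sin a.

Definition re_fn f : 'rV[R]_n -> R := fun x => complex.Re (f x).
Definition im_fn f : 'rV[R]_n -> R := fun x => complex.Im (f x).

Definition pderiv j f : fn R n :=
  fun x => 'D_(basis_vec j) (re_fn f) x +i* 'D_(basis_vec j) (im_fn f) x.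

Definition pderivs (l : seq 'I_n) f : fn R n := foldr pderiv f l.

Definition smooth f : Prop := forall l : seq 'I_n,
  [/\ continuous (re_fn (pderivs l f)), continuous (im_fn (pderivs l f)) &
      forall j x, derivable (re_fn (pderivs l f)) x (basis_vec j) /\
                  derivable (im_fn (pderivs l f)) x (basis_vec j)].

Definition schwartz : set (fn R n) := [set f | smooth f /\
  forall (a : 'I_n -> nat) (l : seq 'I_n), exists M : R, forall x,
    `|(\prod_j x 0 j ^+ a j)%:C * pderivs l f x| <= M%:C].

Definition xmul j f : fn R n := fun x => (x 0 j)%:C * f x.

Definition fn_act : weyl R[i] n -> fn R n -> fn R n := wact xmul pderiv.

End Analysis.

(* The integral over R^n as an iterated Lebesgue integral; it is only applied to
   absolutely integrable functions, where the two agree by Fubini's theorem. *)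
Fixpoint integral_rV {R : realType} (n : nat) : ('rV[R]_n -> R) -> R :=
  match n with
  | 0%N => fun f => f 0
  | m.+1 => fun f => (\int[lebesgue_measure]_(x in setT)
      integral_rV (fun y : 'rV[R]_m => f (row_mx (x%:M : 'M[R]_1) y : 'rV[R]_(1 + m))))%R
  end.

Section Operations.
Context {R : realType} {n : nat}.
Implicit Types (f s t phi psi : fn R n) (x xi y eta : 'rV[R]_n) (A : set (fn R n)).

Definition cintegral f : R[i] := integral_rV (re_fn f) +i* integral_rV (im_fn f).

Definition pointwise s t : fn R n := fun x => s x * t x.

Definition convolution s t : fn R n :=
  fun y => cintegral (fun x => s x * t (y - x)).

Definition fourier s : fn R n :=
  fun xi => cintegral (fun x => expi (2 * pi * dot x xi) * s x).

Definition translate x s : fn R n := fun y => s (y - x).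

Definition modulate xi s : fn R n := fun y => expi (2 * pi * dot xi y) * s y.

(* The Heisenberg group is generated by unit scalars, positions x and momenta xi.
   On signals x acts by translate x and xi by modulate xi; on spectra xi acts by
   translate xi and x by modulate x.  Signals and spectra being both elements of
   fn R n, a subspace is stable under both actions iff it is stable under all
   three families of operators. *)
Definition heisenberg_closed A : Prop := forall s, A s ->
  [/\ forall c : R[i], `|c| = 1 -> A (c *: s),
      forall x, A (translate x s) &
      forall xi, A (modulate xi s)].

Definition linear_subspace A : Prop :=
  A 0 /\ forall (c : R[i]) s t, A s -> A t -> A (c *: s + t).

Definition twain_subsinglet A : Prop :=
  [/\ A `<=` schwartz,
      linear_subspace A,
      (forall s t, A s -> A t -> A (pointwise s t)) /\
      (forall s t, A s -> A t -> A (convolution s t)),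
      heisenberg_closed A &
      forall s, A s -> A (fourier s)].

Definition regular_twain_subsinglet A : Prop :=
  twain_subsinglet A /\ set_bij A A fourier.

(* The inverse of the restriction of fourier to A. *)
Definition inv_fourier A : fn R n -> fn R n := 'pinv_(fun=> 0) A fourier.

Definition algebra_action A (act : weyl R[i] n -> fn R n -> fn R n) : Prop :=
  [/\ forall T s, A s -> A (act T s),
      forall T (c : R[i]) s t, A s -> A t ->
        act T (c *: s + t) = c *: act T s + act T t,
      forall (c : R[i]) T U s, A s -> act (c *: T + U) s = c *: act T s + act U s,
      forall s, A s -> act 1 s = s &
      forall T U s, A s -> act (T * U) s = act T (act U s)].

Definition weyl_heisenberg A (act : weyl R[i] n -> fn R n -> fn R n) : Prop :=
  let e j a s := modulate (a *: basis_vec j) s in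
  let t k a s := translate (a *: basis_vec k) s in
  forall (j k : 'I_n) (a : R) s, A s ->
  [/\ act (wD k) (e j a s) - e j a (act (wD k) s) = ((j == k)%:R * a%:C) *: e j a s,
      t k a (act (wx j) s) - act (wx j) (t k a s) = - ((j == k)%:R * a%:C) *: t k a s,
      e j a (act (wx k) s) = act (wx k) (e j a s) &
      t k a (act (wD j) s) = act (wD j) (t k a s)].

Definition weyl_products A (act : weyl R[i] n -> fn R n -> fn R n) : Prop :=
  forall (j : 'I_n) s t, A s -> A t ->
  [/\ act (wD j) (pointwise s t) = pointwise (act (wD j) s) t + pointwise s (act (wD j) t),
      act (wD j) (convolution s t) = convolution (act (wD j) s) t,
      act (wx j) (pointwise s t) = pointwise (act (wx j) s) t &
      act (wx j) (convolution s t) =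
        convolution (act (wx j) s) t + convolution s (act (wx j) t)].

Definition weyl_fourier A (act : weyl R[i] n -> fn R n -> fn R n) : Prop :=
  forall T s, A s ->
    fourier (act T s) = act (hatf T) (fourier s) /\
    inv_fourier A (act T s) = act (hatf_inv T) (inv_fourier A s).

Definition compatible_weyl_action A (act : weyl R[i] n -> fn R n -> fn R n) : Prop :=
  [/\ algebra_action A act, weyl_heisenberg A act, weyl_products A act &
      weyl_fourier A act].

Definition test_function : set (fn R n) :=
  [set phi | smooth phi /\ compact (closure [set x | phi x != 0])].

(* D'(R^n): functionals that are linear and continuous on test functions.  Values
   off the test functions are irrelevant. *)
Definition is_distribution (u : fn R n -> R[i]^o) : Prop :=
  (forall (c : R[i]) phi psi, test_function phi -> test_function psi ->
    u (c *: phi + psi) = c * u phi + u psi) /\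
  (forall K : set 'rV[R]_n, compact K -> exists (N : nat) (M : R),
    forall phi (B : R), test_function phi -> [set x | phi x != 0] `<=` K ->
      (forall l x, (size l <= N)%N -> `|pderivs l phi x| <= B%:C) ->
      `|u phi| <= (M * B)%:C).

(* The action on distributions is the transpose: <x_j u, phi> = <u, x_j phi> and
   <d_j u, phi> = - <u, d_j phi>. *)
Definition distr_act : weyl R[i] n -> (fn R n -> R[i]^o) -> (fn R n -> R[i]^o) :=
  wact (fun j u phi => u (xmul j phi)) (fun j u phi => - u (pderiv j phi)).

Definition annihilator (u : fn R n -> R[i]^o) : set (weyl R[i] n) :=
  [set T | forall phi, test_function phi -> distr_act T u phi = 0].

Definition holonomic_distribution : set (fn R n -> R[i]^o) :=
  [set u | is_distribution u /\ holonomic_quotient (annihilator u)].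

Definition distribution_of s : fn R n -> R[i]^o :=
  fun phi => cintegral (pointwise s phi).

(* The holonomic Schwartz class, S being embedded in D' by distribution_of. *)
Definition holonomic_schwartz : set (fn R n) :=
  schwartz `&` distribution_of @^-1` holonomic_distribution.

End Operations.

(* Main.v *)
Require Import Defs.
From HB Require Import structures.
From mathcomp Require Import all_boot all_order all_algebra.
From mathcomp Require Import complex ring lra.
From mathcomp Require Import -(notations) ssrcomplements mpoly.
From mathcomp Require Import all_classical all_reals all_analysis.
From mathcomp Require Import measurable_realfun.
Set Implicit Arguments.
Unset Strict Implicit.
Unset Printing Implicit Defensive.
Import Order.TTheory GRing.Theory Num.Theory.
Import numFieldNormedType.Exports.
Local Open Scope complex_scope.
Local Open Scope classical_set_scope.
Local Open Scope ring_scope.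

(** Holonomicity of a Schwartz function is a growth condition, and the growth survives every
    operation. For Schwartz [s] the annihilator of its distribution is the annihilator of the
    function ([annihilatorE], by pairing with [conj s] times a bump), so the Bernstein filtration of
    A_n / I becomes Gam_k(s), the space of all T s with T of order at most k. Every left ideal has a
    Hilbert polynomial: the monomials that are not leading monomials of the ideal form a basis of
    the quotient ([filtered_dim_ncomps]), and by Dickson's lemma their number is eventually
    polynomial ([eventually_poly_ncomps]). If s is nonzero, its polynomial multiples are linearly
    independent ([xonly_faithful]), so the degree is at least n. Hence s is holonomic iff dim
    Gam_k(s) = O(k^n), which is [holonomic_schwartzP].

    Sums and the Weyl action respect this bound at once. Translation, modulation and the Fourier
    transform carry x_j and d_j to operators of order at most one, so they preserve growth
    ([hol_map]). Convolution is a product conjugated by the Fourier transform ([convolutionE]). The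
    product is the crux ([grows_pointwise]): uv is the diagonal restriction of u(x)v(y), whose
    filtration grows like k^(2n). The coordinates are identified one at a time. Multiplication by
    x_j - y_j is injective and lands in the kernel of the restriction to y_j = x_j, so the
    filtration before the restriction contains about k copies of the one after it; each
    identification therefore lowers the exponent by one ([Gmix_bound]), and n of them leave k^n.

    The analytic half makes the Fourier transform an automorphism of the Schwartz space. It is a
    composition of transforms in one variable each, which exchange derivatives and coordinates
    ([fpart_schwartz]), commute and are self-adjoint by Fubini ([fpartC], [fpart_adj]), and are
    inverted by Gaussian summation ([fourier_inversion1]). The compatibility identities of the Weyl
    action are then checked on generators and extended to A_n by [fn_act_transport]. *)

(** * Integrals over the line of continuous functions dominated by 1 / (1 + t^2) *)

Section RealLine.
Context {R : realType}.
Implicit Types f g : R -> R.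
Local Notation mu := (@lebesgue_measure R).

(** An explicit dominating function, rather than mere integrability, serves at once for linearity,
    dominated differentiation and Fubini. *)
Definition decays f :=
  continuous f /\ exists M, forall t, `|f t| <= M * (oneDsqr t)^-1.

Definition intR f : R := (\int[mu]_(x in setT) f x)%R.

Lemma oneDsqrV_ge0 (t : R) : 0 <= (oneDsqr t)^-1.
Proof. by rewrite invr_ge0 (le_trans ler01)// oneDsqr_ge1. Qed.

Lemma integral_oneDsqrV : (\int[mu]_x ((oneDsqr x)^-1)%:E = pi%:E)%E.
Proof.
rewrite (@ge0_symfun_integralT _ (fun x => (oneDsqr x)^-1))//=.
- rewrite (_ : [set x | _] = `[0, +oo[%classic); last first.
    by apply/seteqP; split => x/=; rewrite in_itv/= andbT.
  by rewrite integral0y_oneDsqr -EFinM mulrCA divff// mulr1.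
- exact: continuous_oneDsqrV.
- by move=> x /=; rewrite /oneDsqr sqrrN.
Qed.

Lemma integrable_oneDsqrV M : mu.-integrable setT (EFin \o (fun t : R => M * (oneDsqr t)^-1)).
Proof.
have H : mu.-integrable setT (EFin \o (fun t : R => (oneDsqr t)^-1)).
  have m : measurable_fun setT (fun t : R => (oneDsqr t)^-1).
    by apply: continuous_measurable_fun; exact: continuous_oneDsqrV.
  apply/integrableP; split; first exact/measurable_EFinP.
  apply/abse_integralP => //; first exact/measurable_EFinP.
  by rewrite /= integral_oneDsqrV ltry.
have := integrableZl measurableT M H; congr (integrable _ _ _).
Qed.

Lemma decays_integrable f : decays f -> mu.-integrable setT (EFin \o f).
Proof.
move=> [cf [M fM]].
apply: (le_integrable _ _ _ (integrable_oneDsqrV M)) => //.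
  by apply/measurable_EFinP; exact: continuous_measurable_fun.
move=> t _ /=; rewrite lee_fin (le_trans (fM t))//.
exact: ler_norm.
Qed.

Lemma intRP f g (a : R) : decays f -> decays g ->
  intR (fun t => a * f t + g t) = a * intR f + intR g.
Proof.
move=> df dg; have If := decays_integrable df; have Ig := decays_integrable dg.
have Iaf : mu.-integrable setT (EFin \o (fun t => a * f t)).
  by have := integrableZl measurableT a If; congr (integrable _ _ _).
by rewrite /intR RintegralD//= RintegralZl.
Qed.

Lemma decaysP f g (a : R) : decays f -> decays g -> decays (fun t => a * f t + g t).
Proof.
move=> [cf [M fM]] [cg [N gN]]; split.
  move=> x; apply: cvgD; last exact: cg.
  by apply: cvgM; [exact: cvg_cst|exact: cf].
exists (`|a| * M + N) => t; rewrite mulrDl -mulrA (le_trans (ler_normD _ _))//.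
by rewrite lerD// normrM ler_wpM2l.
Qed.

Lemma decays0 : decays (fun _ => 0).
Proof.
split; first by move=> ?; exact: cvg_cst.
by exists 0 => t; rewrite normr0 mul0r.
Qed.

Lemma intR0 : intR (fun _ => 0) = 0.
Proof. by rewrite /intR Rintegral_cst // mul0r. Qed.

Lemma decaysZ f (a : R) : decays f -> decays (fun t => a * f t).
Proof.
move=> df; have := decaysP a df decays0.
by rewrite (_ : (fun t => _ + _) = fun t => a * f t)//; apply/funext => t; rewrite addr0.
Qed.

Lemma intRZ f (a : R) : decays f -> intR (fun t => a * f t) = a * intR f.
Proof.
move=> df; have := intRP a df decays0; rewrite intR0 addr0 => <-.
by congr intR; apply/funext => t; rewrite addr0.
Qed.

Lemma decaysD f g : decays f -> decays g -> decays (fun t => f t + g t).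
Proof.
move=> df dg; have := decaysP 1 df dg.
by rewrite (_ : (fun t => 1 * _ + _) = fun t => f t + g t)//; apply/funext => t; rewrite mul1r.
Qed.

Lemma intRD f g : decays f -> decays g -> intR (fun t => f t + g t) = intR f + intR g.
Proof.
move=> df dg; have := intRP 1 df dg; rewrite mul1r => <-.
by congr intR; apply/funext => t; rewrite mul1r.
Qed.

Lemma decaysN f : decays f -> decays (fun t => - f t).
Proof. by move=> /(decaysZ (-1)); under eq_fun do rewrite mulN1r. Qed.

Lemma intRN f : decays f -> intR (fun t => - f t) = - intR f.
Proof. by move=> /(intRZ (-1)); under eq_fun do rewrite mulN1r; rewrite mulN1r. Qed.

Lemma decaysB f g : decays f -> decays g -> decays (fun t => f t - g t).
Proof. by move=> df /decaysN; exact: decaysD. Qed.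

Lemma intRB f g : decays f -> decays g -> intR (fun t => f t - g t) = intR f - intR g.
Proof. by move=> df dg; rewrite intRD ?intRN//; exact: decaysN. Qed.

Lemma le_intR f g : decays f -> decays g -> (forall t, f t <= g t) -> intR f <= intR g.
Proof.
move=> /decays_integrable If /decays_integrable Ig fg.
by apply: le_Rintegral => // x _; exact: fg.
Qed.

Lemma decays_oneDsqrV : decays (fun t => (oneDsqr t)^-1).
Proof.
split; first exact: continuous_oneDsqrV.
by exists 1 => t; rewrite mul1r ger0_norm// oneDsqrV_ge0.
Qed.

Lemma intR_oneDsqrV : intR (fun t => (oneDsqr t)^-1) = pi.
Proof. by rewrite /intR /Rintegral integral_oneDsqrV. Qed.

Lemma intR_bound f (g : R -> R) : decays f -> decays g -> (forall t, `|f t| <= g t) ->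
  `|intR f| <= intR g.
Proof.
move=> df dg fg; rewrite ler_norml -intRN//; apply/andP; split; apply: le_intR => //.
- exact: decaysN.
- by move=> t; have := fg t; rewrite ler_norml => /andP[].
- by move=> t; have := fg t; rewrite ler_norml => /andP[].
Qed.

Lemma intR_norm_le f M : decays f -> (forall t, `|f t| <= M * (oneDsqr t)^-1) ->
  `|intR f| <= pi * M.
Proof.
move=> df fM; rewrite mulrC -intR_oneDsqrV -intRZ; last exact: decays_oneDsqrV.
by apply: intR_bound => //; apply: decaysZ; exact: decays_oneDsqrV.
Qed.

Lemma cvgNy_atan : atan x @[x --> -oo] --> - (pi / 2 : R).
Proof.
apply/cvgNy_compNP; rewrite (_ : atan \o _ = -%R \o atan).
  by apply: cvgN; exact: cvgy_atan.
by apply/funext => x /=; rewrite atanN.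
Qed.

(** The line is split at 0; the negative half is reflected onto the positive one, where [- H (- x)]
    is a primitive of [h (- x)]. *)
Lemma ge0_FTCT (h H : R -> R) (l l' : R) : (forall x, 0 <= h x) -> continuous h ->
  (forall x : R, is_derive x (1 : R) H (h x)) -> H x @[x --> +oo] --> l ->
  H x @[x --> -oo] --> l' -> intR h = l - l'.
Proof.
move=> h0 ch dH Hl Hl'.
have cH : continuous H.
  by move=> x; apply: differentiable_continuous; apply/derivable1_diffP; have [] := dH x.
have dHN (x : R) : is_derive x (1 : R) (fun x => - H (- x)) (h (- x)).
  have d2 := is_deriveN (is_derive_id x (1 : R)).
  have d := is_deriveN (is_derive1_comp (dH (- x)) d2).
  by apply: (is_derive_eq d); rewrite mulrN1 opprK.
have mh : measurable_fun [set: R] h by exact: continuous_measurable_fun.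
have chN : continuous (fun x => h (- x)).
  by move=> x; apply: continuous_comp; [exact: opp_continuous|exact: ch].
have E1 : (\int[mu]_(x in `[0%R, +oo[) (h x)%:E = l%:E - (H 0)%:E)%E.
  apply: ge0_continuous_FTC2y => //.
  - exact: continuous_subspaceT.
  - by apply: cvg_at_right_filter; exact: cH.
  - by move=> x _; rewrite derive1E; exact: derive_val.
have E2 : (\int[mu]_(x in `]-oo, 0%R]) (h x)%:E = (H 0)%:E - l'%:E)%E.
  rewrite -{1}oppr0 ge0_integration_by_substitutionNy//; last first.
    exact: continuous_subspaceT.
  rewrite (@ge0_continuous_FTC2y _ _ (fun x => - H (- x)) _ (- l'))//=.
  - by rewrite !oppr0 EFinN opprK addeC.
  - exact: continuous_subspaceT.
  - by apply: cvgN; move/cvgNy_compNP: Hl'.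
  - apply: cvg_at_right_filter; apply: cvgN.
    by apply: continuous_comp; [exact: opp_continuous|exact: cH].
  - by move=> x _; rewrite derive1E; exact: derive_val.
have : (\int[mu]_x (h x)%:E = (l - l')%:E)%E.
  rewrite -(setUv `[0, +oo[%classic) ge0_integral_setU//=; last 4 first.
    exact: measurableC.
    by apply/measurable_EFinP; rewrite setUv.
    by move=> x _; rewrite lee_fin.
    exact/disj_setPCl.
  rewrite setCitvr integral_itv_bndo_bndc; last exact/measurable_EFinP/measurable_funTS.
  by rewrite E1 E2 -!EFinB -EFinD addrA subrK.
by rewrite /intR /Rintegral => ->.
Qed.

Lemma cvg0_oneDsqrV_le (F : set_system R) g M {FF : Filter F} :
  (oneDsqr t)^-1 @[t --> F] --> (0 : R) ->
  (forall t, `|g t| <= M * (oneDsqr t)^-1) -> g t @[t --> F] --> (0 : R).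
Proof.
move=> q0 gM; apply/cvgr0Pnorm_le => e e0.
have := q0; move=> /cvgr0_norm_lt /(_ (e / (`|M| + 1))).
have M0 : 0 < `|M| + 1 by rewrite ltr_wpDl.
move=> /(_ (divr_gt0 e0 M0)); apply: filterS => t.
rewrite ger0_norm ?oneDsqrV_ge0// ltr_pdivlMr// => /ltW te.
rewrite (le_trans (gM t))// (le_trans _ te)// mulrC ler_wpM2l ?oneDsqrV_ge0//.
by rewrite (le_trans (ler_norm M))// lerDl.
Qed.

Lemma oneDsqrV_cvgy : (oneDsqr t)^-1 @[t --> +oo] --> (0 : R).
Proof.
apply/cvgr0Pnorm_le => e e0; near=> t.
rewrite ger0_norm ?oneDsqrV_ge0// -[leRHS]invrK lef_pV2 ?posrE ?invr_gt0 ?oneDsqr_gt0//.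
have t1 : 1 <= t by near: t; apply: nbhs_pinfty_ge; rewrite num_real.
have t2 : e^-1 <= t by near: t; apply: nbhs_pinfty_ge; rewrite num_real.
by rewrite (le_trans t2)// /oneDsqr; nra.
Unshelve. all: by end_near. Qed.

Lemma oneDsqrV_cvgNy : (oneDsqr t)^-1 @[t --> -oo] --> (0 : R).
Proof.
apply/cvgNy_compNP; rewrite (_ : _ \o _ = fun t => (oneDsqr t)^-1).
  exact: oneDsqrV_cvgy.
by apply/funext => t /=; rewrite /oneDsqr sqrrN.
Qed.

(** Adding N / (1 + t^2) makes the integrand nonnegative, with primitive N atan + g. As g vanishes
    at both ends, the total is N pi, which is the contribution of the added term alone. *)
Lemma intR_derive g g' : decays g -> decays g' -> (forall x : R, is_derive x (1 : R) g (g' x)) ->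
  intR g' = 0.
Proof.
move=> [_ [M gM]] dg' gg'; have [cg' [N gN]] := dg'.
have N0 : 0 <= N.
  by have := gN 0; rewrite /oneDsqr expr0n addr0 invr1 mulr1; apply: le_trans.
have dq := decaysZ N decays_oneDsqrV.
suff : intR (fun t => N * (oneDsqr t)^-1 + g' t) = N * pi.
  rewrite intRD// intRZ; last exact: decays_oneDsqrV.
  by rewrite intR_oneDsqrV => /eqP; rewrite -subr_eq0 addrAC subrr add0r => /eqP.
rewrite (@ge0_FTCT _ (fun t => N * atan t + g t) (N * (pi / 2) + 0) (N * - (pi / 2) + 0)).
- by rewrite !addr0 mulrN opprK -mulrDr -splitr.
- by move=> x; have := gN x; rewrite ler_norml => /andP[] + _; lra.
- by have [] := decaysD dq dg'.
- apply: cvgD; last by apply: cvg0_oneDsqrV_le gM; exact: oneDsqrV_cvgy.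
  by apply: cvgM; [exact: cvg_cst|exact: cvgy_atan].
- apply: cvgD; last by apply: cvg0_oneDsqrV_le gM; exact: oneDsqrV_cvgNy.
  by apply: cvgM; [exact: cvg_cst|exact: cvgNy_atan].
Qed.

End RealLine.

(** * Differentiation under the integral sign and Fubini's theorem *)

Section TwoVariables.
Context {R : realType}.
Local Notation mu := (@lebesgue_measure R).

Lemma is_derive_intR (F F' : R -> R -> R) M (a : R) :
  (forall x, decays (F x)) -> (forall x t : R, is_derive x (1 : R) (F^~ t) (F' x t)) ->
  (forall x t, `|F' x t| <= M * (oneDsqr t)^-1) ->
  is_derive a (1 : R) (fun x => intR (F x)) (intR (F' a)).
Proof.
move=> dF FF' F'M.
have p1 x t : partial1of2 F x t = F' x t.
  by rewrite /partial1of2 derive1E; have [] := FF' x t.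
have M0 : 0 <= M.
  by have := F'M 0 0; rewrite /oneDsqr expr0n addr0 invr1 mulr1; apply: le_trans.
have aI : `]a - 1, a + 1[%classic a by rewrite /= in_itv /= ltrBlDr ltrDl ltr01.
have dFt x t : derivable (F^~ t) x 1 by have [] := FF' x t.
have D1 := derivable_under_integral measurableT aI
  (fun x _ => decays_integrable (dF x)) (fun x t _ _ => dFt x t) _
  (integrable_oneDsqrV M) _.
have D2 := differentiation_under_integral measurableT aI
  (fun x _ => decays_integrable (dF x)) (fun x t _ _ => dFt x t) _
  (integrable_oneDsqrV M) _.
have h1 (t : R) : 0 <= M * (oneDsqr t)^-1 by rewrite mulr_ge0// oneDsqrV_ge0.
have h2 (x t : R) : `]a - 1, a + 1[%classic x -> [set: R] t ->
    `|partial1of2 F x t| <= M * (oneDsqr t)^-1 by move=> _ _; rewrite p1.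
apply: DeriveDef; first exact: D1 h1 h2.
rewrite -derive1E (D2 h1 h2) /intR.
by apply: eq_Rintegral => t _; rewrite p1.
Qed.

(** An open set of the plane is the union of the countably many rational boxes that it contains. *)
Lemma measurable_open2 (O : set (R * R)) : open O -> measurable O.
Proof.
move=> oO.
pose box (k : rat * rat * rat * rat) : set (R * R) :=
  `]ratr k.1.1.1, ratr k.1.1.2[%classic `*` `]ratr k.1.2, ratr k.2[%classic.
(* Indices that encode no box, or a box not contained in [O], contribute the empty set. *)
pose A i := if unpickle i is Some k then if `[< box k `<=` O >] then box k else set0 else set0.
have -> : O = \bigcup_i A i.
  apply/seteqP; split => [[x y] Oxy|z [i _]]; last first.
    by rewrite /A; case: unpickle => // k; case: asboolP => // kO; exact: kO.
  have : nbhs (x, y) O by rewrite nbhsE /=; exists O.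
  move=> /nbhs_ballP[e /= e0 beO].
  have [a /andP[a1 a2]] : {a : rat | x - e < ratr a < x}.
    have := @rat_in_itvoo R (x - e) x; rewrite ltrBlDr ltrDl => /(_ e0).
    by move=> /cid[a]; rewrite in_itv /= => h; exists a.
  have [b /andP[b1 b2]] : {a : rat | x < ratr a < x + e}.
    have := @rat_in_itvoo R x (x + e); rewrite ltrDl => /(_ e0).
    by move=> /cid[b]; rewrite in_itv /= => h; exists b.
  have [c /andP[c1 c2]] : {a : rat | y - e < ratr a < y}.
    have := @rat_in_itvoo R (y - e) y; rewrite ltrBlDr ltrDl => /(_ e0).
    by move=> /cid[c]; rewrite in_itv /= => h; exists c.
  have [d /andP[d1 d2]] : {a : rat | y < ratr a < y + e}.
    have := @rat_in_itvoo R y (y + e); rewrite ltrDl => /(_ e0).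
    by move=> /cid[d]; rewrite in_itv /= => h; exists d.
  exists (pickle (a, b, c, d)); first exact: I.
  rewrite /A pickleK; case: asboolP => [_|[]].
    by rewrite /box /=; split; rewrite /= in_itv /= ?a2 ?c2.
  move=> [u v] [/=]; rewrite !in_itv /= => /andP[u1 u2] /andP[v1 v2].
  apply: beO; split => /=; rewrite /ball /= ltr_norml; apply/andP; split; lra.
apply: bigcupT_measurable => i; rewrite /A; case: unpickle => // k.
by case: ifP => // _; apply: measurableX; exact: measurable_itv.
Qed.

Lemma measurable_continuous2 (F : R * R -> R) : continuous F -> measurable_fun setT F.
Proof.
move=> /continuousP cF; apply: (measurability _ (RGenOpens.measurableE R)).
move=> _ [_ [a [b ->] <-]]; rewrite setTI; apply: measurable_open2.
by apply: cF; exact: interval_open.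
Qed.

Lemma continuous_pair1 (F : R * R -> R) s : continuous F -> continuous (fun t => F (s, t)).
Proof.
move=> cF t; apply: (continuous_comp (f := fun t => (s, t))); last exact: cF.
by apply: (@cvg_pair _ _ _ _ (nbhs s) (nbhs t)); [exact: cvg_cst|exact: cvg_id].
Qed.

Lemma continuous_pair2 (F : R * R -> R) t : continuous F -> continuous (fun s => F (s, t)).
Proof.
move=> cF s; apply: (continuous_comp (f := fun s => (s, t))); last exact: cF.
by apply: (@cvg_pair _ _ _ _ (nbhs s) (nbhs t)); [exact: cvg_id|exact: cvg_cst].
Qed.

Lemma intR_swap (F : R -> R -> R) M : continuous (fun z : R * R => F z.1 z.2) ->
  (forall s t, `|F s t| <= M * (oneDsqr s)^-1 * (oneDsqr t)^-1) ->
  intR (fun s => intR (F s)) = intR (fun t => intR (F^~ t)).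
Proof.
move=> cF FM.
have d1 s : decays (F s).
  by split; [exact: (@continuous_pair1 (fun z => F z.1 z.2) s cF)|exists (M * (oneDsqr s)^-1)].
have d2 t : decays (F^~ t).
  split; [exact: (@continuous_pair2 (fun z => F z.1 z.2) t cF)|exists (M * (oneDsqr t)^-1) => s].
  by rewrite mulrAC.
have mF := measurable_continuous2 cF.
have iF : (mu \x mu)%E.-integrable setT (EFin \o (fun z : R * R => F z.1 z.2)).
  apply/integrable12ltyP; first exact/measurable_EFinP.
  apply: (@le_lt_trans _ _ (\int[mu]_x (pi * M * (oneDsqr x)^-1)%:E)%E).
    apply: ge0_le_integral => //=.
    - by move=> x _; apply: integral_ge0 => y _; rewrite lee_fin.
    - apply: (@measurable_fun_fubini_tonelli_F _ _ _ _ _ mu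
        (fun z : R * R => `|F z.1 z.2|%:E)).
        by apply/measurable_EFinP; exact: measurableT_comp.
      by move=> z; rewrite lee_fin.
    - exact: (measurable_int mu (integrable_oneDsqrV (R := R) (pi * M))).
    move=> x _; apply: (@le_trans _ _ (\int[mu]_y (M * (oneDsqr x)^-1 * (oneDsqr y)^-1)%:E)%E).
      apply: ge0_le_integral => //=.
      - apply/measurable_EFinP; apply: measurableT_comp => //.
        by apply: continuous_measurable_fun; have [] := d1 x.
      - exact: (measurable_int mu (integrable_oneDsqrV (R := R) (M * (oneDsqr x)^-1))).
      - by move=> y _; rewrite lee_fin.
    have I := integrable_oneDsqrV (R := R) (M * (oneDsqr x)^-1).
    rewrite -[leLHS]fineK; last exact: integrable_fin_num I.
    rewrite -/(Rintegral mu setT _) -/(intR _) intRZ; last exact: decays_oneDsqrV.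
    by rewrite intR_oneDsqrV lee_fin mulrAC [M * pi]mulrC.
  have I := integrable_oneDsqrV (R := R) (pi * M).
  by rewrite -[ltLHS]fineK ?ltry//; exact: integrable_fin_num I.
have := Fubini iF => /(congr1 fine).
have E1 x : (\int[mu]_y (EFin \o (fun z : R * R => F z.1 z.2)) (x, y))%E = (intR (F x))%:E.
  exact: esym (fineK (integrable_fin_num measurableT (decays_integrable (d1 x)))).
have E2 y : (\int[mu]_x (EFin \o (fun z : R * R => F z.1 z.2)) (x, y))%E = (intR (F^~ y))%:E.
  exact: esym (fineK (integrable_fin_num measurableT (decays_integrable (d2 y)))).
by under eq_integral do rewrite E1; under [in X in _ = fine X]eq_integral do rewrite E2.
Qed.

End TwoVariables.

(** * Complex-valued calculus: modulus, derivatives and integrals by real and imaginary parts *)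

Section ComplexNumbers.
Context {R : realType}.
Implicit Types z w : R[i].

Definition nrm z : R := Normc.normc z.

Lemma nrmE z : `|z| = (nrm z)%:C. Proof. by []. Qed.

Lemma nrm_ge0 z : 0 <= nrm z.
Proof. by rewrite -ler0c -nrmE. Qed.

Lemma nrmM z w : nrm (z * w) = nrm z * nrm w.
Proof. exact: Normc.normcM. Qed.

Lemma nrmD z w : nrm (z + w) <= nrm z + nrm w.
Proof. exact: le_normcD. Qed.

Lemma nrm0 : nrm 0 = 0.
Proof. by rewrite /nrm Normc.normc0. Qed.

Lemma nrm_real (a : R) : nrm a%:C = `|a|.
Proof. by rewrite /nrm /= expr0n addr0 sqrtr_sqr. Qed.

Lemma Re_le_nrm z : `|complex.Re z| <= nrm z.
Proof. by rewrite -lecR -nrmE; exact: normc_ge_Re. Qed.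

Lemma Im_le_nrm z : `|complex.Im z| <= nrm z.
Proof.
by case: z => a b; rewrite /nrm /= -sqrtr_sqr ler_wsqrtr// lerDr sqr_ge0.
Qed.

Lemma nrm_le z : nrm z <= `|complex.Re z| + `|complex.Im z|.
Proof.
case: z => a b; rewrite /nrm /= -[leRHS]ger0_norm ?addr_ge0// -sqrtr_sqr.
rewrite ler_wsqrtr// sqrrD !real_normK ?num_real//.
by rewrite lerD2r lerDl mulrn_wge0// mulr_ge0.
Qed.

Lemma nrm_expi (a : R) : nrm (expi a) = 1.
Proof. by rewrite /nrm /expi /= cos2Dsin2 sqrtr1. Qed.

Lemma expiD (a b : R) : expi (a + b) = expi a * expi b.
Proof.
rewrite /expi sinD cosD; apply/eqP; rewrite eq_complex /= eqxx /=.
by apply/eqP; ring.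
Qed.

Lemma expi0 : expi (0 : R) = 1.
Proof. by rewrite /expi cos0 sin0. Qed.

Lemma cReD z w : complex.Re (z + w) = complex.Re z + complex.Re w.
Proof. by case: z w => [? ?] [? ?]. Qed.

Lemma cImD z w : complex.Im (z + w) = complex.Im z + complex.Im w.
Proof. by case: z w => [? ?] [? ?]. Qed.

Lemma cReM z w :
  complex.Re (z * w) = complex.Re z * complex.Re w - complex.Im z * complex.Im w.
Proof. by case: z w => [? ?] [? ?]. Qed.

Lemma cImM z w :
  complex.Im (z * w) = complex.Re z * complex.Im w + complex.Im z * complex.Re w.
Proof. by case: z w => [? ?] [? ?]. Qed.

Lemma complexP z w :
  complex.Re z = complex.Re w -> complex.Im z = complex.Im w -> z = w.
Proof. by case: z w => [? ?] [? ?] /= -> ->. Qed.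

End ComplexNumbers.

Section ComplexDerivative.
Context {R : realType} {V : normedModType R}.
Implicit Types (f g : V -> R[i]) (x v : V) (l m : R[i]).

Definition is_cderive x v f l :=
  is_derive x v (fun y => complex.Re (f y)) (complex.Re l) /\
  is_derive x v (fun y => complex.Im (f y)) (complex.Im l).

Lemma is_cderive_eq x v f l m : is_cderive x v f l -> l = m -> is_cderive x v f m.
Proof. by move=> ? <-. Qed.

Lemma is_cderive_cst x v (c : R[i]) : is_cderive x v (fun=> c) 0.
Proof. by split; exact: is_derive_cst. Qed.

Lemma is_cderiveD x v f g l m : is_cderive x v f l -> is_cderive x v g m ->
  is_cderive x v (fun y => f y + g y) (l + m).
Proof.
move=> [f1 f2] [g1 g2]; split.
  by under eq_fun do rewrite cReD; rewrite cReD; exact: is_deriveD.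
by under eq_fun do rewrite cImD; rewrite cImD; exact: is_deriveD.
Qed.

Lemma is_cderiveM x v f g l m : is_cderive x v f l -> is_cderive x v g m ->
  is_cderive x v (fun y => f y * g y) (l * g x + f x * m).
Proof.
move=> [f1 f2] [g1 g2]; split.
  under eq_fun do rewrite cReM; rewrite cReD !cReM.
  apply: (is_derive_eq (is_deriveB (is_deriveM f1 g1) (is_deriveM f2 g2))).
  by rewrite /GRing.scale /=; ring.
under eq_fun do rewrite cImM; rewrite cImD !cImM.
apply: (is_derive_eq (is_deriveD (is_deriveM f1 g2) (is_deriveM f2 g1))).
by rewrite /GRing.scale /=; ring.
Qed.

Lemma is_cderiveZ x v f l (c : R[i]) : is_cderive x v f l ->
  is_cderive x v (fun y => c * f y) (c * l).
Proof.
move=> fl; apply: (is_cderive_eq (is_cderiveM (is_cderive_cst x v c) fl)).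
by rewrite mul0r add0r.
Qed.

Lemma is_cderive_unique x v f l m : is_cderive x v f l -> is_cderive x v f m -> l = m.
Proof.
by move=> [[_ f1] [_ f2]] [[_ g1] [_ g2]]; apply: complexP; rewrite -?f1 -?f2.
Qed.

Lemma is_cderive_real x v (f : V -> R) (l : R) : is_derive x v f l ->
  is_cderive x v (fun y => (f y)%:C) l%:C.
Proof. by move=> fl; split => //=; exact: is_derive_cst. Qed.

End ComplexDerivative.

Section ComplexIntegral.
Context {R : realType}.
Implicit Types (f g : R -> R[i]).

Definition cdecays f :=
  decays (fun t => complex.Re (f t)) /\ decays (fun t => complex.Im (f t)).

Definition intC f : R[i] :=
  intR (fun t => complex.Re (f t)) +i* intR (fun t => complex.Im (f t)).

Lemma cdecays_nrm f M : continuous (fun t => complex.Re (f t)) ->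
  continuous (fun t => complex.Im (f t)) ->
  (forall t, nrm (f t) <= M * (oneDsqr t)^-1) -> cdecays f.
Proof.
move=> cr ci fM; split; split => //; exists M => t; apply: le_trans (fM t).
  exact: Re_le_nrm.
exact: Im_le_nrm.
Qed.

Lemma cdecaysP (c : R[i]) f g : cdecays f -> cdecays g ->
  cdecays (fun t => c * f t + g t).
Proof.
move=> [f1 f2] [g1 g2]; split.
  under eq_fun do rewrite cReD cReM; apply: decaysD => //.
  by apply: decaysB; exact: decaysZ.
under eq_fun do rewrite cImD cImM; apply: decaysD => //.
by apply: decaysD; exact: decaysZ.
Qed.

Lemma intCP (c : R[i]) f g : cdecays f -> cdecays g ->
  intC (fun t => c * f t + g t) = c * intC f + intC g.
Proof.
move=> [f1 f2] [g1 g2]; apply: complexP.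
  rewrite cReD cReM /=; under [LHS]eq_Rintegral do rewrite cReD cReM.
  rewrite -/(intR _) intRD ?intRB ?intRZ//; do ?exact: decaysZ.
  by apply: decaysB; exact: decaysZ.
rewrite cImD cImM /=; under [LHS]eq_Rintegral do rewrite cImD cImM.
rewrite -/(intR _) intRD ?intRD ?intRZ//; try exact: decaysZ.
by apply: decaysD; exact: decaysZ.
Qed.

Lemma cdecays0 : cdecays (fun=> 0).
Proof. by split; exact: decays0. Qed.

Lemma intC0 : intC (fun=> 0) = 0.
Proof. by rewrite /intC intR0. Qed.

Lemma cdecaysZ (c : R[i]) f : cdecays f -> cdecays (fun t => c * f t).
Proof.
by move=> df; have := cdecaysP c df cdecays0; under eq_fun do rewrite addr0.
Qed.

Lemma intCZ (c : R[i]) f : cdecays f -> intC (fun t => c * f t) = c * intC f.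
Proof.
move=> df; have := intCP c df cdecays0; rewrite intC0 addr0 => <-.
by congr intC; apply/funext => t; rewrite addr0.
Qed.

Lemma nrm_intC f M : cdecays f -> (forall t, nrm (f t) <= M * (oneDsqr t)^-1) ->
  nrm (intC f) <= 2 * pi * M.
Proof.
move=> [f1 f2] fM; apply: (le_trans (nrm_le _)).
rewrite -mulrA mulr_natl mulr2n; apply: lerD; apply: intR_norm_le => // t.
  exact: le_trans (Re_le_nrm _) (fM t).
exact: le_trans (Im_le_nrm _) (fM t).
Qed.

Lemma intC_derive g g' : cdecays g -> cdecays g' ->
  (forall x : R, is_cderive x (1 : R) g (g' x)) -> intC g' = 0.
Proof.
move=> [g1 g2] [h1 h2] gg'; apply: complexP => /=.
  by apply: (intR_derive g1 h1) => x; case: (gg' x).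
by apply: (intR_derive g2 h2) => x; case: (gg' x).
Qed.

Lemma is_cderive_intC (F F' : R -> R -> R[i]) M (a : R) :
  (forall x, cdecays (F x)) ->
  (forall x t : R, is_cderive x (1 : R) (F^~ t) (F' x t)) ->
  (forall x t, nrm (F' x t) <= M * (oneDsqr t)^-1) ->
  is_cderive a (1 : R) (fun x => intC (F x)) (intC (F' a)).
Proof.
move=> dF FF' F'M; split.
  apply: (is_derive_intR (M := M) (F' := fun x t => complex.Re (F' x t))).
  - by move=> x; case: (dF x).
  - by move=> x t; case: (FF' x t).
  - by move=> x t; apply: le_trans (F'M x t); exact: Re_le_nrm.
apply: (is_derive_intR (M := M) (F' := fun x t => complex.Im (F' x t))).
- by move=> x; case: (dF x).
- by move=> x t; case: (FF' x t).
- by move=> x t; apply: le_trans (F'M x t); exact: Im_le_nrm.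
Qed.

Lemma intC_swap (F : R -> R -> R[i]) M :
  continuous (fun z : R * R => complex.Re (F z.1 z.2)) ->
  continuous (fun z : R * R => complex.Im (F z.1 z.2)) ->
  (forall s t, nrm (F s t) <= M * (oneDsqr s)^-1 * (oneDsqr t)^-1) ->
  intC (fun s => intC (F s)) = intC (fun t => intC (F^~ t)).
Proof.
move=> c1 c2 FM; apply: complexP => /=.
  apply: (intR_swap (M := M) (F := fun s t => complex.Re (F s t))) => // s t.
  by apply: le_trans (FM s t); exact: Re_le_nrm.
apply: (intR_swap (M := M) (F := fun s t => complex.Im (F s t))) => // s t.
by apply: le_trans (FM s t); exact: Im_le_nrm.
Qed.

Lemma is_derive_cos_lin (x a b : R) :
  is_derive x (1 : R) (fun y => cos (a * y + b)) (- (a * sin (a * x + b))).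
Proof.
have d := is_deriveD (is_deriveZ a (is_derive_id x (1 : R))) (is_derive_cst b x 1).
apply: (is_derive_eq (is_derive1_comp (is_derive_cos _) d)).
by rewrite /GRing.scale /= mulr1 addr0 mulrC mulrN.
Qed.

Lemma is_derive_sin_lin (x a b : R) :
  is_derive x (1 : R) (fun y => sin (a * y + b)) (a * cos (a * x + b)).
Proof.
have d := is_deriveD (is_deriveZ a (is_derive_id x (1 : R))) (is_derive_cst b x 1).
apply: (is_derive_eq (is_derive1_comp (is_derive_sin _) d)).
by rewrite /GRing.scale /= mulr1 addr0 mulrC.
Qed.

Lemma is_cderive_expi (x a b : R) :
  is_cderive x (1 : R) (fun y => expi (a * y + b)) ((0 +i* a) * expi (a * x + b)).
Proof.
split; rewrite ?cReM ?cImM /=.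
  by rewrite mul0r sub0r; exact: is_derive_cos_lin.
by rewrite mul0r add0r; exact: is_derive_sin_lin.
Qed.

End ComplexIntegral.

(** * Continuity, partial derivatives and function classes on R^n *)

Section RealContinuity.
Context {R : realType} {T : topologicalType}.
Implicit Types f g : T -> R.

Lemma continuous_cst (a : R) : continuous (fun _ : T => a).
Proof. exact: cst_continuous. Qed.

Lemma continuous_add f g : continuous f -> continuous g -> continuous (fun x => f x + g x).
Proof. by move=> cf cg x; exact: cvgD (cf x) (cg x). Qed.

Lemma continuous_sub f g : continuous f -> continuous g -> continuous (fun x => f x - g x).
Proof. by move=> cf cg x; exact: cvgB (cf x) (cg x). Qed.

Lemma continuous_mul f g : continuous f -> continuous g -> continuous (fun x => f x * g x).
Proof. by move=> cf cg x; exact: cvgM (cf x) (cg x). Qed.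

End RealContinuity.

Notation fn R n := ('rV[R]_n -> R[i]^o).

Section Classes.
Context {R : realType} {n : nat}.
Implicit Types (f g : fn R n) (i j k : 'I_n) (x y : 'rV[R]_n) (s t : R).
Implicit Types (P Q S : fn R n -> Prop).

(** Setting a coordinate is written as a displacement along the basis vector, so that a partial
    derivative is literally the derivative along a slice. *)
Definition upd x j t : 'rV[R]_n := x + (t - x 0 j) *: basis_vec j.

Lemma updE x j t k : upd x j t 0 k = if k == j then t else x 0 k.
Proof.
rewrite !mxE eqxx /=; case: eqVneq => [->|_]; last by rewrite mulr0 addr0.
by rewrite mulr1 addrC subrK.
Qed.

Lemma upd_eq x j t : upd x j t 0 j = t. Proof. by rewrite updE eqxx. Qed.

Lemma upd_neq x j t k : k != j -> upd x j t 0 k = x 0 k.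
Proof. by rewrite updE => /negbTE ->. Qed.

Lemma upd_id x j : upd x j (x 0 j) = x.
Proof. by rewrite /upd subrr scale0r addr0. Qed.

Lemma upd_upd x j s t : upd (upd x j s) j t = upd x j t.
Proof. by apply/rowP => k; rewrite !updE; case: eqP. Qed.

Lemma updC x i j s t : i != j -> upd (upd x i s) j t = upd (upd x j t) i s.
Proof.
by move=> ij; apply/rowP => k; rewrite !updE; case: (eqVneq k j) => // ->; rewrite eq_sym (negbTE ij).
Qed.

Lemma continuous_upd x j : continuous (upd x j).
Proof.
move=> t; apply: cvgD; first exact: cvg_cst.
by apply: cvgZr_tmp; apply: cvgB; [exact: cvg_id|exact: cvg_cst].
Qed.

Lemma is_derive_slice (h : 'rV[R]_n -> R) x j t l :
  is_derive (upd x j t) (basis_vec j) h l <->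
  is_derive t (1 : R) (fun s => h (upd x j s)) l.
Proof.
have E : (fun r : R => r^-1 *: ((h \o shift (upd x j t)) (r *: basis_vec j) - h (upd x j t)))
  = (fun r => r^-1 *: (((fun s => h (upd x j s)) \o shift t) (r *: (1 : R)) - h (upd x j t))).
  apply/funext => r /=; congr (_ *: (h _ - _)).
  by rewrite /upd addrCA -scalerDl addrA [r *: 1]mulr1.
by split=> -[d1 d2]; split; move: d1 d2; rewrite /derivable /derive E.
Qed.

Definition pd j f g := forall x, is_cderive x (basis_vec j) f (g x).

Lemma pd_pderiv j f g : pd j f g -> pderiv j f = g.
Proof.
by move=> fg; apply/funext => x; case: (fg x) => -[_ d1] [_ d2]; apply: complexP.
Qed.

Lemma pd_sliceP j f g : pd j f g <->
  (forall x t, is_cderive t (1 : R) (fun s => f (upd x j s)) (g (upd x j t))).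
Proof.
split=> [fg x t|fg x].
  by case: (fg (upd x j t)) => d1 d2; split; apply/is_derive_slice.
by rewrite -(upd_id x j); case: (fg x (x 0 j)) => d1 d2; split; apply/is_derive_slice.
Qed.

Lemma pdP j c f g f' g' : pd j f f' -> pd j g g' -> pd j (c *: f + g) (c *: f' + g').
Proof.
by move=> ff gg x; apply: is_cderiveD; [exact: is_cderiveZ|exact: gg].
Qed.

Lemma pdM j f g f' g' : pd j f f' -> pd j g g' ->
  pd j (pointwise f g) (pointwise f' g + pointwise f g').
Proof. by move=> ff gg x; apply: is_cderiveM; [exact: ff|exact: gg]. Qed.

Lemma pd_cst j c : pd j (fun=> c) 0.
Proof. by move=> x; exact: is_cderive_cst. Qed.

Lemma is_derive_coord x j k :
  is_derive x (basis_vec j) (fun y : 'rV[R]_n => y 0 k) (k == j)%:R.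
Proof.
rewrite -(upd_id x j); apply/is_derive_slice.
under eq_fun do rewrite updE.
by case: eqP => _; [exact: is_derive_id|exact: is_derive_cst].
Qed.

Lemma pd_xmul j k f f' : pd j f f' -> pd j (xmul k f) (xmul k f' + (k == j)%:R *: f).
Proof.
move=> ff x; rewrite /xmul.
apply: (is_cderive_eq (is_cderiveM (is_cderive_real (is_derive_coord x j k)) (ff x))).
by rewrite /= addrC; congr (_ + _ * _); case: eqP.
Qed.

(** Differentiability to order [m] with [f] and all these derivatives in [P]. The derivative is
    existential, so that a proof exhibits one instead of computing [pderiv]. *)
Fixpoint ck P (m : nat) f : Prop := P f /\
  if m is m'.+1 then forall j, exists2 g, pd j f g & ck P m' g else True.

Lemma ckP P m f : ck P m f -> P f.
Proof. by case: m => [|m] []. Qed.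

Lemma ck_weak P m f : ck P m.+1 f -> ck P m f.
Proof.
elim: m f => [|m IH] f [Pf Hf]; first by split.
by split=> // j; have [g fg /IH] := Hf j; exists g.
Qed.

Lemma ck_sub P Q m f : (forall g, P g -> Q g) -> ck P m f -> ck Q m f.
Proof.
move=> PQ; elim: m f => [|m IH] f [Pf Hf]; split=> //; try exact: PQ.
by move=> j; have [g fg /IH] := Hf j; exists g.
Qed.

Definition lin_closed P := P 0 /\ forall c f g, P f -> P g -> P (c *: f + g).

Lemma ck_lin P m c f g : lin_closed P -> ck P m f -> ck P m g -> ck P m (c *: f + g).
Proof.
move=> [_ Pl]; elim: m f g => [|m IH] f g [Pf Hf] [Pg Hg]; split=> //; try exact: Pl.
move=> j; have [f' ff hf] := Hf j; have [g' gg hg] := Hg j.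
by exists (c *: f' + g'); [exact: pdP|exact: IH].
Qed.

Lemma ck0 P m : lin_closed P -> ck P m 0.
Proof.
move=> Pl; elim: m => [|m IH]; split => //; try exact: Pl.1.
by move=> j; exists 0 => //; exact: pd_cst.
Qed.

Lemma ckZ P m c f : lin_closed P -> ck P m f -> ck P m (c *: f).
Proof. by move=> Pl fP; have := ck_lin c Pl fP (ck0 m Pl); rewrite addr0. Qed.

Lemma ckD P m f g : lin_closed P -> ck P m f -> ck P m g -> ck P m (f + g).
Proof. by move=> Pl fP gP; have := ck_lin 1 Pl fP gP; rewrite scale1r. Qed.

Lemma ckM P Q S m f g : lin_closed S ->
  (forall f g, P f -> Q g -> S (pointwise f g)) ->
  ck P m f -> ck Q m g -> ck S m (pointwise f g).
Proof.
move=> Sl PQS; elim: m f g => [|m IH] f g [Pf Hf] [Qg Hg]; split=> //; try exact: PQS.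
move=> j; have [f' ff hf] := Hf j; have [g' gg hg] := Hg j.
exists (pointwise f' g + pointwise f g'); first exact: pdM.
apply: ckD => //; apply: IH => //; apply: ck_weak; split => //.
Qed.

Definition cont f := continuous (re_fn f) /\ continuous (im_fn f).
Definition bdd f := exists M, forall x, nrm (f x) <= M.
Definition rapid f := forall l : seq 'I_n, bdd (foldr xmul f l).
Definition cbdd f := cont f /\ bdd f.
Definition crapid f := cont f /\ rapid f.

Lemma fn_linE (c : R[i]) f g x : (c *: f + g) x = (c * (f x : R[i]) + (g x : R[i])) :> R[i].
Proof. by []. Qed.

Lemma cont_lin : lin_closed cont.
Proof.
split; first by split; exact: (@continuous_cst _ _ 0).
move=> c f g [f1 f2] [g1 g2]; split.
  rewrite (_ : re_fn _ = fun x => complex.Re c * re_fn f x - complex.Im c * im_fn f x + re_fn g x).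
    apply: continuous_add => //; apply: continuous_sub; apply: continuous_mul => //; exact: continuous_cst.
  by apply/funext => x; rewrite /re_fn fn_linE cReD cReM.
rewrite (_ : im_fn _ = fun x => complex.Re c * im_fn f x + complex.Im c * re_fn f x + im_fn g x).
  apply: continuous_add => //; apply: continuous_add; apply: continuous_mul => //; exact: continuous_cst.
by apply/funext => x; rewrite /im_fn fn_linE cImD cImM.
Qed.

Lemma cont_mul f g : cont f -> cont g -> cont (pointwise f g).
Proof.
move=> [f1 f2] [g1 g2]; split.
  rewrite (_ : re_fn _ = fun x => re_fn f x * re_fn g x - im_fn f x * im_fn g x).
    by apply: continuous_sub; exact: continuous_mul.
  by apply/funext => x; rewrite /re_fn cReM.
rewrite (_ : im_fn _ = fun x => re_fn f x * im_fn g x + im_fn f x * re_fn g x).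
  by apply: continuous_add; exact: continuous_mul.
by apply/funext => x; rewrite /im_fn cImM.
Qed.

Lemma continuous_coord k : continuous (fun x : 'rV[R]_n => x 0 k).
Proof. exact: coord_continuous. Qed.

Lemma cont_xmul k f : cont f -> cont (xmul k f).
Proof.
apply: (@cont_mul (fun x => (x 0 k)%:C)); split; last exact: (@continuous_cst _ _ 0).
exact: continuous_coord.
Qed.

Lemma bdd_lin : lin_closed bdd.
Proof.
split; first by exists 0 => x; rewrite nrm0.
move=> c f g [M fM] [N gN]; exists (nrm c * M + N) => x.
by rewrite (le_trans (nrmD _ _))// lerD// nrmM ler_wpM2l// nrm_ge0.
Qed.

Lemma bdd_mul f g : bdd f -> bdd g -> bdd (pointwise f g).
Proof.
move=> [M fM] [N gN]; exists (M * N) => x.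
by rewrite nrmM ler_pM// nrm_ge0.
Qed.

Lemma xmulsE l f x : foldr xmul f l x = (\prod_(j <- l) x 0 j)%:C * f x.
Proof.
elim: l => [|j l IH] /=; first by rewrite big_nil mul1r.
by rewrite /xmul IH big_cons rmorphM mulrA.
Qed.

Lemma rapid_lin : lin_closed rapid.
Proof.
split=> [l|c f g rf rg l].
  exists 0 => x; rewrite xmulsE mulr0; by rewrite nrm0.
have [M fM] := rf l; have [N gN] := rg l; exists (nrm c * M + N) => x.
have -> : foldr xmul (c *: f + g) l x = c * foldr xmul f l x + foldr xmul g l x.
  by rewrite !xmulsE mulrDr mulrCA.
by rewrite (le_trans (nrmD _ _))// lerD// nrmM ler_wpM2l// nrm_ge0.
Qed.

Lemma rapid_bdd f : rapid f -> bdd f.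
Proof. by move=> /(_ [::]). Qed.

Lemma rapid_xmul k f : rapid f -> rapid (xmul k f).
Proof. by move=> rf l; have := rf (rcons l k); rewrite -cats1 foldr_cat. Qed.

Lemma rapid_mul f g : rapid f -> bdd g -> rapid (pointwise f g).
Proof.
move=> rf [N gN] l; have [M fM] := rf l; exists (M * N) => x.
rewrite xmulsE mulrA -xmulsE nrmM; apply: ler_pM => //; exact: nrm_ge0.
Qed.

Lemma lin_closedI P Q : lin_closed P -> lin_closed Q -> lin_closed (fun f => P f /\ Q f).
Proof.
by move=> [P0 Pl] [Q0 Ql]; split=> // c f g [? ?] [? ?]; split; [exact: Pl|exact: Ql].
Qed.

Lemma cbdd_lin : lin_closed cbdd.
Proof. exact: lin_closedI cont_lin bdd_lin. Qed.

Lemma crapid_lin : lin_closed crapid.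
Proof. exact: lin_closedI cont_lin rapid_lin. Qed.

Lemma crapid_mul f g : crapid f -> cbdd g -> crapid (pointwise f g).
Proof. by move=> [? ?] [? ?]; split; [exact: cont_mul|exact: rapid_mul]. Qed.

Lemma cbdd_mul f g : cbdd f -> cbdd g -> cbdd (pointwise f g).
Proof. by move=> [? ?] [? ?]; split; [exact: cont_mul|exact: bdd_mul]. Qed.

Lemma crapid_cbdd f : crapid f -> cbdd f.
Proof. by move=> [? /rapid_bdd]. Qed.

Lemma ck_xmul m k f : ck crapid m f -> ck crapid m (xmul k f).
Proof.
have cr g : crapid g -> crapid (xmul k g).
  by move=> [? ?]; split; [exact: cont_xmul|exact: rapid_xmul].
elim: m f => [|m IH] f [Pf Hf]; split=> //; try exact: cr.
move=> j; have [f' ff hf] := Hf j.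
exists (xmul k f' + (k == j)%:R *: f); first exact: pd_xmul.
apply: ckD; [exact: crapid_lin|exact: IH|].
by apply: ckZ; [exact: crapid_lin|apply: ck_weak; split].
Qed.

Lemma smoothP f : smooth f <-> forall m, ck cont m f.
Proof.
split=> [sf m|H l].
  suff H l : ck cont m (pderivs l f) by exact: (H [::]).
  elim: m l => [|m IH] l; have [c1 c2 d] := sf l; split=> //.
  move=> j; exists (pderiv j (pderivs l f)); last exact: (IH (j :: l)).
  by move=> x; have [d1 d2] := d j x; split; split.
have {}H m : ck cont m (pderivs l f).
  elim: l m => [|j l IH] m /=; first exact: H.
  by have [_ /(_ j)[g fg]] := IH m.+1; rewrite (pd_pderiv fg).
have [[c1 c2] d] := H 1%N; split => // j x; have [g fg _] := d j.
by have [[]] := fg x => ? _ [].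
Qed.

Lemma prodr_count (l : seq 'I_n) (F : 'I_n -> R) :
  \prod_(j <- l) F j = \prod_j F j ^+ count_mem j l.
Proof.
elim: l => [|i l IH]; first by rewrite big_nil big1.
rewrite big_cons IH /=; under [RHS]eq_bigr do rewrite exprD.
rewrite big_split /=; congr (_ * _); rewrite (bigD1 i) //= eqxx expr1 big1 ?mulr1// => j.
by rewrite eq_sym => /negbTE ->.
Qed.

Lemma schwartzP f : schwartz f <-> forall m, ck crapid m f.
Proof.
split=> [[/smoothP sf bf] m|H].
  suff H l : ck crapid m (pderivs l f) by exact: (H [::]).
  have cl l' m' : ck cont m' (pderivs l' f).
    elim: l' m' => [|j l' IH] m' /=; first exact: sf.
    by have [_ /(_ j)[g fg]] := IH m'.+1; rewrite (pd_pderiv fg).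
  have crl l' : crapid (pderivs l' f).
    split=> [|a]; first by have [] := cl l' 0%N.
    have [M HM] := bf (fun j => count_mem j a) l'; exists M => x.
    rewrite xmulsE -lecR -nrmE; have := HM x; congr (`|_%:C * _| <= _).
    by rewrite prodr_count.
  elim: m l => [|m IH] l; split=> // j.
  exists (pderiv j (pderivs l f)); last exact: (IH (j :: l)).
  have [_ /(_ j)[g fg _]] := cl l 1%N.
  by rewrite (pd_pderiv fg).
split; first by apply/smoothP => m; apply: ck_sub (H m) => g [].
move=> a l; have {}H m : ck crapid m (pderivs l f).
  elim: l m => [|j l IH] m /=; first exact: H.
  by have [_ /(_ j)[g fg]] := IH m.+1; rewrite (pd_pderiv fg).
have [[_ rf] _] := H 0%N.
(* [a j] copies of each index [j] turn the exponent vector into a list of coordinate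
   multiplications. *)
have [M HM] := rf (flatten [seq nseq (a j) j | j <- enum 'I_n]); exists M => x.
have := HM x; rewrite xmulsE -lecR -nrmE; congr (`|_%:C * _| <= _).
rewrite big_flatten big_map big_enum /=; apply: eq_bigr => j _.
by rewrite big_nseq iter_mulr_1.
Qed.

End Classes.

Section SchwartzClosure.
Context {R : realType} {n : nat}.
Implicit Types (f g : fn R n) (j k : 'I_n) (x y : 'rV[R]_n).

Lemma schwartz_crapid f : schwartz f -> crapid f.
Proof. by move=> /schwartzP/(_ 0%N)[]. Qed.

Lemma schwartz_rapid f : schwartz f -> rapid f.
Proof. by case/schwartz_crapid. Qed.

Lemma schwartz_pd f j : schwartz f -> pd j f (pderiv j f).
Proof. by move=> /schwartzP/(_ 1%N)[_ /(_ j)[g fg _]]; rewrite (pd_pderiv fg). Qed.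

Lemma schwartz_pderiv f j : schwartz f -> schwartz (pderiv j f).
Proof.
move=> /schwartzP sf; apply/schwartzP => m.
by have [_ /(_ j)[g fg]] := sf m.+1; rewrite (pd_pderiv fg).
Qed.

Lemma schwartz_xmul f j : schwartz f -> schwartz (xmul j f).
Proof. by move=> /schwartzP sf; apply/schwartzP => m; exact: ck_xmul. Qed.

Lemma schwartzL (c : R[i]) f g : schwartz f -> schwartz g -> schwartz (c *: f + g).
Proof.
move=> /schwartzP sf /schwartzP sg; apply/schwartzP => m.
by apply: ck_lin => //; exact: crapid_lin.
Qed.

Lemma schwartz0 : schwartz (0 : fn R n).
Proof. by apply/schwartzP => m; apply: ck0; exact: crapid_lin. Qed.

Lemma schwartzZ (c : R[i]) f : schwartz f -> schwartz (c *: f).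
Proof. by move=> sf; have := schwartzL c sf schwartz0; rewrite addr0. Qed.

Lemma schwartzD f g : schwartz f -> schwartz g -> schwartz (f + g).
Proof. by move=> sf; have := schwartzL 1 sf; rewrite scale1r; apply. Qed.

Lemma schwartz_pointwise f g : schwartz f -> schwartz g -> schwartz (pointwise f g).
Proof.
move=> /schwartzP sf /schwartzP sg; apply/schwartzP => m.
apply: (ckM crapid_lin _ (sf m) (sg m)) => u v cu cv.
by apply: crapid_mul => //; exact: crapid_cbdd.
Qed.

Lemma schwartz_mul f g : schwartz f -> (forall m, ck cbdd m g) -> schwartz (pointwise f g).
Proof.
move=> /schwartzP sf sg; apply/schwartzP => m.
by apply: (ckM crapid_lin _ (sf m) (sg m)) => u v; exact: crapid_mul.
Qed.

End SchwartzClosure.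

(** * Bounded partial derivatives imply continuity *)

Section BoundedDerivatives.
Context {R : realType} {n : nat}.
Implicit Types (x y : 'rV[R]_n).

Lemma le_norm_MVT (h dh : R -> R) (M a b : R) : (forall t : R, is_derive t (1 : R) h (dh t)) ->
  (forall t, `|dh t| <= M) -> `|h b - h a| <= M * `|b - a|.
Proof.
move=> hd hM; wlog ab : a b / a <= b.
  move=> H; have [/H//|/ltW/H] := leP a b.
  by rewrite distrC [`|a - b|]distrC.
have ch : continuous h.
  by move=> t; apply: differentiable_continuous; apply/derivable1_diffP; have [] := hd t.
have [c _ ->] := MVT_segment ab (fun t _ => hd t) (continuous_subspaceT ch).
by rewrite normrM ler_wpM2r.
Qed.

(** The coordinates of [x] are changed into those of [y] one at a time, with the mean value theorem
    on each slice. *)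
Lemma lipschitz_partials (h : 'rV[R]_n -> R) (dh : 'I_n -> 'rV[R]_n -> R) (M : R) x y :
  (forall j x, is_derive x (basis_vec j) h (dh j x)) -> (forall j x, `|dh j x| <= M) ->
  `|h y - h x| <= M * \sum_j `|y 0 j - x 0 j|.
Proof.
move=> hd hM.
pose z l := foldr (fun j u => upd u j (y 0 j)) x l.
have zE l j : z l 0 j = if j \in l then y 0 j else x 0 j.
  elim: l => //= i l IH; rewrite updE in_cons.
  by case: eqVneq => [->//|_] /=.
have -> : y = z (enum 'I_n) by apply/rowP => j; rewrite zE mem_enum.
rewrite -[\sum_j _]big_enum /=.
have -> : \sum_(i <- enum 'I_n) `|z (enum 'I_n) 0 i - x 0 i| =
    \sum_(i <- enum 'I_n) `|y 0 i - x 0 i|.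
  by apply: eq_bigr => i _; rewrite zE mem_enum.
elim: (enum 'I_n) (enum_uniq 'I_n) => [_|j l IH /= /andP[jl ul]].
  by rewrite subrr normr0 big_nil mulr0.
rewrite big_cons mulrDr -(subrK (h (z l)) (h (upd _ _ _))) -addrA.
apply: (le_trans (ler_normD _ _)); apply: lerD; last exact: IH.
have jx : z l 0 j = x 0 j by rewrite zE (negbTE jl).
have dj t : is_derive t (1 : R) (fun s => h (upd (z l) j s)) (dh j (upd (z l) j t)).
  exact/is_derive_slice.
by have := le_norm_MVT (z l 0 j) (y 0 j) dj (fun t => hM j _); rewrite upd_id jx.
Qed.

Lemma continuous_partials (h : 'rV[R]_n -> R) (dh : 'I_n -> 'rV[R]_n -> R) (M : R) :
  (forall j x, is_derive x (basis_vec j) h (dh j x)) -> (forall j x, `|dh j x| <= M) ->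
  continuous h.
Proof.
move=> hd hM x; apply/(@cvgrPdist_le _ _ _ (nbhs x)) => e e0.
have cs (l : seq 'I_n) : continuous (fun y : 'rV[R]_n => \sum_(j <- l) `|y 0 j - x 0 j|).
  elim: l => [|j l IH]; first by under eq_fun do rewrite big_nil; exact: continuous_cst.
  under eq_fun do rewrite big_cons; apply: continuous_add => // u.
  have cj := continuous_sub (@continuous_coord R n j) (@continuous_cst R _ (x 0 j)).
  exact: (continuous_comp (cj u) (@norm_continuous _ _ _)).
have := continuous_mul (@continuous_cst R _ M) (cs (index_enum 'I_n)) (x := x).
rewrite /continuous_at big1 ?mulr0 => [|j _]; last by rewrite subrr normr0.
move=> /(@cvgr0Pnorm_le _ _ _ (nbhs x)) /(_ e e0); apply: filterS => y ye.
rewrite distrC (le_trans (lipschitz_partials x y hd hM))// (le_trans (ler_norm _))//.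
Qed.

(** Meant for partial transforms and plane waves, whose derivatives are visibly bounded: joint
    continuity then costs no further estimate. *)
Lemma cont_partials (f : fn R n) : (forall j, exists2 g, pd j f g & bdd g) -> cont f.
Proof.
move=> H; have /choice[g gP] : forall j, exists g, pd j f g /\ bdd g.
  by move=> j; have [g ? ?] := H j; exists g.
have [M gM] : exists M, forall j x, nrm (g j x) <= M.
  have /choice[M HM] : forall j, exists M, forall x, nrm (g j x) <= M.
    by move=> j; have [_ []] := gP j; move=> M; exists M.
  exists (\sum_j `|M j|) => j x; rewrite (le_trans (HM j x))// (le_trans (ler_norm _))//.
  by rewrite (bigD1 j) //= lerDl sumr_ge0.
split.
  apply: (continuous_partials (dh := fun j x => complex.Re (g j x)) (M := M)) => j x.
    by have [/(_ x)[]] := gP j.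
  exact: le_trans (Re_le_nrm _) (gM j x).
apply: (continuous_partials (dh := fun j x => complex.Im (g j x)) (M := M)) => j x.
  by have [/(_ x)[]] := gP j.
exact: le_trans (Im_le_nrm _) (gM j x).
Qed.

End BoundedDerivatives.

(** * The Fourier transform in one variable *)

Section PartialFourier.
Context {R : realType} {n : nat}.
Implicit Types (f g : fn R n) (j k : 'I_n) (x y : 'rV[R]_n) (e : R).

(** The frequency occupies the coordinate [j] that the integration variable vacates, so the result
    is again a function on R^n and the transforms compose. The sign of [e] distinguishes the
    transform from its inverse. *)
Definition fpart e j f : fn R n :=
  fun x => intC (fun t => expi (e * x 0 j * t) * f (upd x j t)).

Lemma slice_bound f j : rapid f ->
  exists M, forall x t, nrm (f (upd x j t)) <= M * (oneDsqr t)^-1.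
Proof.
move=> rf; have [M fM] := rf [::]; have [N fN] := rf [:: j; j].
exists (M + N) => x t; rewrite ler_pdivlMr ?oneDsqr_gt0// mulrC /oneDsqr mulrDl mul1r lerD//.
have := fN (upd x j t); rewrite xmulsE nrmM nrm_real !big_cons big_nil mulr1 upd_eq.
by rewrite -expr2 ger0_norm// sqr_ge0.
Qed.

Lemma slice_cont f j x : cont f ->
  continuous (fun t => complex.Re (f (upd x j t))) /\
  continuous (fun t => complex.Im (f (upd x j t))).
Proof.
move=> [c1 c2]; split => t.
  exact: (@continuous_comp _ _ _ (upd x j) (re_fn f) _ (@continuous_upd _ _ x j t) (c1 _)).
exact: (@continuous_comp _ _ _ (upd x j) (im_fn f) _ (@continuous_upd _ _ x j t) (c2 _)).
Qed.

Lemma continuous_expi (a b : R) :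
  continuous (fun t => complex.Re (expi (a * t + b))) /\
  continuous (fun t => complex.Im (expi (a * t + b))).
Proof.
split=> t /=; apply: differentiable_continuous; apply/derivable1_diffP.
  by have [] := is_derive_cos_lin t a b.
by have [] := is_derive_sin_lin t a b.
Qed.

Lemma continuous_cmul (T : topologicalType) (u v : T -> R[i]) :
  continuous (fun t => complex.Re (u t)) -> continuous (fun t => complex.Im (u t)) ->
  continuous (fun t => complex.Re (v t)) -> continuous (fun t => complex.Im (v t)) ->
  continuous (fun t => complex.Re (u t * v t)) /\ continuous (fun t => complex.Im (u t * v t)).
Proof.
move=> u1 u2 v1 v2; split.
  under eq_fun do rewrite cReM.
  by apply: continuous_sub; exact: continuous_mul.
under eq_fun do rewrite cImM.
by apply: continuous_add; exact: continuous_mul.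
Qed.

Lemma slice_cdecays f j x (a : R) : crapid f ->
  cdecays (fun t => expi (a * t) * f (upd x j t)).
Proof.
move=> [cf rf]; have [M fM] := slice_bound j rf.
have [c1 c2] := slice_cont j x cf.
have [e1 e2] := continuous_expi a 0.
have [d1 d2] := continuous_cmul e1 e2 c1 c2.
have E : (fun t => expi (a * t) * f (upd x j t)) = (fun t => expi (a * t + 0) * f (upd x j t)).
  by apply/funext => t; rewrite addr0.
rewrite E; apply: (cdecays_nrm (M := M)) => // t.
by rewrite nrmM nrm_expi mul1r.
Qed.

Lemma fpart_bdd e j f : crapid f -> bdd (fpart e j f).
Proof.
move=> cf; have [M fM] := slice_bound j cf.2; exists (2 * pi * M) => x.
apply: nrm_intC => [|t]; first exact: slice_cdecays.
by rewrite nrmM nrm_expi mul1r.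
Qed.

Lemma fpartP e j c f g : crapid f -> crapid g ->
  fpart e j (c *: f + g) = c *: fpart e j f + fpart e j g.
Proof.
move=> cf cg; apply/funext => x; rewrite fn_linE -intCP; do ?exact: slice_cdecays.
by congr intC; apply/funext => t; rewrite fn_linE mulrDr mulrCA.
Qed.

Lemma fpartZ e j c f : crapid f -> fpart e j (c *: f) = c *: fpart e j f.
Proof.
move=> cf; apply/funext => x; rewrite -[RHS]/(c * _) -intCZ; last exact: slice_cdecays.
by congr intC; apply/funext => t; rewrite mulrCA.
Qed.

Lemma xmul_fpart e j k f : k != j -> crapid f ->
  xmul k (fpart e j f) = fpart e j (xmul k f).
Proof.
move=> kj cf; apply/funext => x; rewrite /xmul -intCZ; last exact: slice_cdecays.
by congr intC; apply/funext => t; rewrite /= upd_neq// mulrCA.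
Qed.

Lemma pd_fpart e j k f g : k != j -> crapid f -> crapid g -> pd k f g ->
  pd k (fpart e j f) (fpart e j g).
Proof.
move=> kj cf cg /pd_sliceP fg; apply/pd_sliceP => x s.
have [M gM] := slice_bound j cg.2.
pose F (h : fn R n) s t := expi (e * x 0 j * t) * h (upd (upd x j t) k s).
have jk : j != k by rewrite eq_sym.
have E h : (fun s => fpart e j h (upd x k s)) = (fun s => intC (F h s)).
  apply/funext => r; congr intC; apply/funext => t.
  by rewrite /F (upd_neq _ _ jk) (updC _ _ _ kj).
rewrite E -[fpart e j g _]/((fun s => fpart e j g (upd x k s)) s) E.
apply: (is_cderive_intC (M := M) (F' := F g)).
- move=> r; have := slice_cdecays j (upd x k r) (e * x 0 j) cf; congr cdecays.
  by apply/funext => t; rewrite /F (updC _ _ _ jk).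
- by move=> r t; apply: is_cderiveZ; exact: fg.
- by move=> r t; rewrite /F nrmM nrm_expi mul1r (updC _ _ _ jk).
Qed.

Lemma pd_fpart_eq e j f : crapid f ->
  pd j (fpart e j f) (fpart e j ((0 +i* e) *: xmul j f)).
Proof.
move=> cf; have cxf : crapid (xmul j f).
  by split; [apply: cont_xmul|apply: rapid_xmul]; have [] := cf.
apply/pd_sliceP => x s; rewrite fpartZ //.
have [M gM] := slice_bound j cxf.2.
pose F s t := expi (e * s * t) * f (upd x j t).
pose F' s t := expi (e * s * t) * ((0 +i* e) * xmul j f (upd x j t)).
have E : (fun s => fpart e j f (upd x j s)) = (fun s => intC (F s)).
  apply/funext => r; congr intC; apply/funext => t; rewrite /F upd_eq.
  by rewrite upd_upd.
rewrite E.
have -> : ((0 +i* e) *: fpart e j (xmul j f)) (upd x j s) = intC (F' s).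
  rewrite -[LHS]/(_ * _) -intCZ; last exact: slice_cdecays.
  congr intC; apply/funext => t; rewrite /F' upd_upd upd_eq.
  by rewrite mulrCA.
apply: (is_cderive_intC (M := nrm (0 +i* e) * M)).
- by move=> r; exact: slice_cdecays.
- move=> r t; have d := is_cderive_expi r (e * t) 0.
  have E1 u : (fun z : R => expi (e * z * t) * u) = (fun z => u * expi (e * t * z + 0) : R[i]).
    by apply/funext => z; rewrite addr0 mulrAC mulrC.
  rewrite /F E1; apply: (is_cderive_eq (is_cderiveZ _ d)).
  rewrite /F' /xmul upd_eq addr0 [e * r * t]mulrAC.
  have -> : 0 +i* (e * t) = (0 +i* e) * t%:C.
    by apply: complexP; rewrite ?cReM ?cImM /= ?mulr0 ?mul0r ?subr0 ?add0r ?addr0.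
  move: (f _ : R[i]) (expi _) (0 +i* e) (t%:C) => a b c d'.
  by rewrite [a * _]mulrC -[LHS]mulrA [c * _ * _]mulrC -mulrA; congr (_ * _); rewrite mulrC mulrA.
- by move=> r t; rewrite /F' nrmM nrm_expi mul1r nrmM -mulrA ler_wpM2l ?nrm_ge0.
Qed.

(** Integration by parts: the derivative in t of the kernel times [f] has integral zero. *)
Lemma fpart_pd e j f g : crapid f -> crapid g -> pd j f g ->
  fpart e j g = (- (0 +i* e)) *: xmul j (fpart e j f).
Proof.
move=> cf cg /pd_sliceP fg; apply/funext => x.
have d1 := slice_cdecays j x (e * x 0 j) cf; have d2 := slice_cdecays j x (e * x 0 j) cg.
have : intC (fun t => ((0 +i* e) * (x 0 j)%:C) * (expi (e * x 0 j * t) * f (upd x j t)) +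
    expi (e * x 0 j * t) * g (upd x j t)) = 0; last first.
  rewrite intCP// => /eqP; rewrite addrC addr_eq0 => /eqP Ig.
  rewrite -[LHS]/(intC _) Ig -[RHS]/(_ * ((x 0 j)%:C * intC _)).
  by rewrite mulNr mulrA.
apply: (intC_derive d1); first exact: cdecaysP.
move=> t; have d := is_cderive_expi t (e * x 0 j) 0.
have E1 : (fun z : R => expi (e * x 0 j * z + 0)) = (fun z => expi (e * x 0 j * z)).
  by apply/funext => z; rewrite addr0.
rewrite E1 addr0 in d.
apply: (is_cderive_eq (is_cderiveM d (fg x t))); congr (_ + _).
rewrite -mulrA; congr (_ * _).
by apply: complexP; rewrite ?cReM ?cImM /= ?mulr0 ?mul0r ?subr0 ?add0r ?addr0.
Qed.

Lemma imul_neq0 (a : R) : a != 0 -> 0 +i* a != 0.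
Proof. by rewrite eq_complex /= eqxx. Qed.

Lemma xmul_fpart_eq e j f g : e != 0 -> crapid f -> crapid g -> pd j f g ->
  xmul j (fpart e j f) = (- (0 +i* e))^-1 *: fpart e j g.
Proof.
move=> e0 cf cg fg; rewrite (fpart_pd e cf cg fg) scalerA mulVf ?scale1r//.
by rewrite oppr_eq0 imul_neq0.
Qed.

(** Multiplying by a coordinate or differentiating gives the transform of another Schwartz function,
    so every required bound is an instance of [fpart_bdd]. For the coordinate [j] this divides by
    [e]. *)
Lemma fpart_schwartz e j f : e != 0 -> schwartz f -> schwartz (fpart e j f).
Proof.
move=> e0.
have xf k g : schwartz g -> exists2 h, schwartz h & xmul k (fpart e j g) = fpart e j h.
  move=> sg; have [->|kj] := eqVneq k j; last first.
    by exists (xmul k g); [exact: schwartz_xmul|exact: xmul_fpart (schwartz_crapid sg)].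
  have sg' := schwartz_pderiv j sg.
  exists ((- (0 +i* e))^-1 *: pderiv j g); first exact: schwartzZ.
  rewrite fpartZ; last exact: schwartz_crapid.
  by apply: xmul_fpart_eq => //; [exact: schwartz_crapid|exact: schwartz_crapid|exact: schwartz_pd].
have bf l g : schwartz g -> bdd (foldr xmul (fpart e j g) l).
  elim: l g => [|k l IH] g sg; first exact: fpart_bdd (schwartz_crapid sg).
  have [h sh E] := xf k g sg; have [M HM] := IH h sh; exists M => x.
  have -> : foldr xmul (fpart e j g) (k :: l) x = foldr xmul (xmul k (fpart e j g)) l x.
    by rewrite !xmulsE big_cons rmorphM /xmul mulrA [X in X * _]mulrC.
  by rewrite E.
have pf k g : schwartz g -> exists2 h, schwartz h & pd k (fpart e j g) (fpart e j h).
  move=> sg; have [->|kj] := eqVneq k j.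
    exists ((0 +i* e) *: xmul j g); last exact: pd_fpart_eq (schwartz_crapid sg).
    by apply: schwartzZ; exact: schwartz_xmul.
  exists (pderiv k g); first exact: schwartz_pderiv.
  apply: pd_fpart => //; try exact: schwartz_crapid.
    by apply: schwartz_crapid; exact: schwartz_pderiv.
  exact: schwartz_pd.
have cf g : schwartz g -> crapid (fpart e j g).
  move=> sg; split; last by move=> l; exact: bf.
  apply: cont_partials => k; have [h sh] := pf k g sg; exists (fpart e j h) => //.
  exact: fpart_bdd (schwartz_crapid sh).
move=> sf; apply/schwartzP => m; elim: m f sf => [|m IH] f sf; split=> //; try exact: cf.
by move=> k; have [h sh ?] := pf k f sf; exists (fpart e j h) => //; exact: IH.
Qed.

End PartialFourier.

(** * Gaussians, their integrals and their Fourier transforms *)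

Section Gaussian.
Context {R : realType}.
Implicit Types (a b d e t u s : R).

Definition gau b a t : R := expR (- b * (t - a) ^+ 2).

Lemma gau_gt0 b a t : 0 < gau b a t. Proof. exact: expR_gt0. Qed.

Lemma continuous_gau b a : continuous (gau b a).
Proof.
move=> t; apply: (@continuous_comp _ _ _ (fun t => - b * (t - a) ^+ 2) expR).
  have ci : continuous (fun t => t - a).
    by apply: continuous_sub; [move=> ?; exact: cvg_id|exact: continuous_cst].
  exact: continuous_mul (@continuous_cst _ _ _) (continuous_mul ci ci) _.
exact: continuous_expR.
Qed.

Lemma oneDsqr_gt0 t : 0 < oneDsqr t. Proof. exact: lt_le_trans ltr01 (oneDsqr_ge1 t). Qed.

(** The second power leaves room for a factor t. With m at most 1 and b / 2, m (1 + t^2) <= 1 + b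
    t^2 / 2 <= exp (b t^2 / 2), and this is squared. *)
Lemma gau_sqr_bound b : 0 < b ->
  exists2 M, 0 <= M & forall t, gau b 0 t <= M * ((oneDsqr t)^-1 * (oneDsqr t)^-1).
Proof.
move=> b0; pose m := Num.min (b / 2) 1.
have m0 : 0 < m by rewrite lt_min divr_gt0// ltr01.
have m1 : m <= 1 by rewrite ge_min lexx orbT.
have m2 : m <= b / 2 by rewrite ge_min lexx.
exists (m^-1 * m^-1) => [|t]; first by rewrite mulr_ge0// invr_ge0 ltW.
have H : expR (- (b / 2) * t ^+ 2) <= m^-1 * (oneDsqr t)^-1.
  rewrite mulNr expRN -invfM lef_pV2 ?posrE ?expR_gt0 ?mulr_gt0// ?oneDsqr_gt0//.
  apply: le_trans (expR_ge1Dx _); rewrite /oneDsqr mulrDr mulr1 lerD//.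
  by rewrite ler_wpM2r// sqr_ge0.
have -> : gau b 0 t = expR (- (b / 2) * t ^+ 2) * expR (- (b / 2) * t ^+ 2).
  by rewrite -expRD /gau subr0; congr expR; lra.
rewrite mulrACA; apply: ler_pM => //; exact: expR_ge0.
Qed.

(** Peetre's inequality, used to recentre a bound. *)
Lemma oneDsqrV_shift a t : (oneDsqr (t - a))^-1 <= 2 * oneDsqr a * (oneDsqr t)^-1.
Proof.
have key : oneDsqr t <= 2 * oneDsqr a * oneDsqr (t - a).
  (* The difference of the two sides as a sum of squares. *)
  rewrite /oneDsqr -subr_ge0 [X in 0 <= X](_ : _ = (t - 2 * a) ^+ 2 + 1 + 2 * (a * (t - a)) ^+ 2).
    by have := sqr_ge0 (t - 2 * a); have := sqr_ge0 (a * (t - a)); lra.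
  ring.
rewrite -[leLHS]mul1r ler_pdivrMr ?oneDsqr_gt0// mulrAC.
by rewrite ler_pdivlMr ?oneDsqr_gt0// mul1r.
Qed.

Lemma oneDsqrV_le1 t : (oneDsqr t)^-1 <= 1.
Proof. by rewrite invf_le1 ?oneDsqr_gt0// oneDsqr_ge1. Qed.

Lemma decays_le (f : R -> R) M : continuous f ->
  (forall t, `|f t| <= M * (oneDsqr t)^-1) -> decays f.
Proof. by move=> cf fM; split => //; exists M. Qed.

Lemma decays_gau b a : 0 < b -> decays (gau b a).
Proof.
move=> b0; have [M M0 bM] := gau_sqr_bound b0.
apply: (@decays_le _ (M * (2 * oneDsqr a))); first exact: continuous_gau.
move=> t; rewrite gtr0_norm ?gau_gt0//.
have -> : gau b a t = gau b 0 (t - a) by rewrite /gau subr0.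
rewrite (le_trans (bM _))// -mulrA ler_wpM2l// (le_trans _ (oneDsqrV_shift a t))//.
by rewrite -[leRHS]mul1r ler_wpM2r ?oneDsqrV_ge0// oneDsqrV_le1.
Qed.

Lemma norm_oneDsqrV_le1 t : `|t| * (oneDsqr t)^-1 <= 1.
Proof.
rewrite ler_pdivrMr ?oneDsqr_gt0// mul1r /oneDsqr -(real_normK (num_real t)).
by have := normr_ge0 t; nra.
Qed.

Lemma decays_mul_gau b : 0 < b -> decays (fun t => t * gau b 0 t).
Proof.
move=> b0; have [M M0 bM] := gau_sqr_bound b0.
apply: (@decays_le _ M).
  by apply: continuous_mul; [move=> t; exact: cvg_id|exact: continuous_gau].
move=> t; rewrite normrM (gtr0_norm (gau_gt0 _ _ _)).
rewrite (le_trans (ler_wpM2l (normr_ge0 t) (bM t)))// mulrCA ler_wpM2l// mulrA.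
by rewrite -[leRHS]mul1r ler_wpM2r ?oneDsqrV_ge0// norm_oneDsqrV_le1.
Qed.

(** Normalisation of the normal density of mean a and variance 1 / (2 b). *)
Lemma intR_gau b a : 0 < b -> intR (gau b a) = Num.sqrt (pi / b).
Proof.
move=> b0; pose s : R := Num.sqrt ((2 * b)^-1).
have s2 : s ^+ 2 = (2 * b)^-1 by rewrite sqr_sqrtr// invr_ge0 mulr_ge0// ltW.
have s0 : s != 0 by rewrite gt_eqF// sqrtr_gt0 invr_gt0 mulr_gt0.
have pk : normal_peak s = (Num.sqrt (pi / b))^-1.
  rewrite /normal_peak s2; congr (_^-1); congr Num.sqrt.
  by rewrite -mulr_natr invfM; field; rewrite gt_eqF.
have p0 : Num.sqrt (pi / b) != 0 by rewrite gt_eqF// sqrtr_gt0 divr_gt0// pi_gt0.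
have E t : normal_pdf a s t = (Num.sqrt (pi / b))^-1 * gau b a t.
  rewrite normal_pdfE// pk /normal_fun /gau s2; congr (_ * expR _).
  by rewrite -mulr_natr invfM; field; rewrite gt_eqF.
have := integral_normal_pdf a s; under eq_integral do rewrite E.
move=> /(congr1 fine); rewrite -/(Rintegral _ _ _) -/(intR _) intRZ; last exact: decays_gau.
by rewrite /= => /(congr1 ( *%R (Num.sqrt (pi / b)))); rewrite mulrA divff// mul1r mulr1.
Qed.

Lemma is_derive_gau b t : is_derive t (1 : R) (gau b 0) (- 2 * b * (t * gau b 0 t)).
Proof.
have E : gau b 0 = fun t => expR (- b * (t * t)).
  by apply/funext => z; rewrite /gau subr0 expr2.
have d1 := is_deriveM (is_derive_id t (1 : R)) (is_derive_id t (1 : R)).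
have d3 := is_derive1_comp (is_derive_expR _) (is_deriveZ (- b) d1).
rewrite E; apply: (is_derive_eq d3); rewrite /GRing.scale /=; ring.
Qed.

Definition gauF e b u : R[i] := intC (fun t => expi (e * u * t) * (gau b 0 t)%:C).

Lemma cdecays_real (f : R -> R) : decays f -> cdecays (fun t => (f t)%:C).
Proof. by move=> df; split => //=; exact: decays0. Qed.

Lemma cdecays_cont (f : R -> R[i]) : cdecays f ->
  continuous (fun t => complex.Re (f t)) /\ continuous (fun t => complex.Im (f t)).
Proof. by move=> [[c1 _] [c2 _]]. Qed.

Lemma cdecays_bound (f : R -> R[i]) : cdecays f ->
  exists M, forall t, nrm (f t) <= M * (oneDsqr t)^-1.
Proof.
move=> [[_ [M fM]] [_ [N fN]]]; exists (M + N) => t.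
by rewrite mulrDl (le_trans (nrm_le _))// lerD.
Qed.

Lemma cdecays_expi a (f : R -> R[i]) : cdecays f -> cdecays (fun t => expi (a * t) * f t).
Proof.
move=> df; have [c1 c2] := cdecays_cont df; have [M fM] := cdecays_bound df.
have [e1 e2] := continuous_expi a 0.
have [d1 d2] := continuous_cmul e1 e2 c1 c2.
have -> : (fun t => expi (a * t) * f t) = (fun t => expi (a * t + 0) * f t).
  by apply/funext => t; rewrite addr0.
by apply: (cdecays_nrm (M := M)) => // t; rewrite nrmM nrm_expi mul1r.
Qed.

(** Differentiating under the integral brings down i e t, and t times the Gaussian is proportional
    to its derivative; an integration by parts returns the transform itself, multiplied by a
    multiple of u. *)
Lemma is_cderive_gauF e b u : 0 < b ->
  is_cderive u (1 : R) (gauF e b) ((- (e ^+ 2 / (2 * b) * u))%:C * gauF e b u).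
Proof.
move=> b0; pose f t : R[i] := (gau b 0 t)%:C; pose g t : R[i] := (t * gau b 0 t)%:C.
have df := cdecays_real (decays_gau 0 b0); have dg := cdecays_real (decays_mul_gau b0).
have [M gM] := cdecays_bound dg.
have d1 : is_cderive u (1 : R) (gauF e b)
    (intC (fun t => (0 +i* e) * (expi (e * u * t) * g t))).
  apply: (is_cderive_intC (M := nrm (0 +i* e) * M)
      (F' := fun u t => (0 +i* e) * (expi (e * u * t) * g t))).
  - by move=> x; exact: cdecays_expi.
  - move=> x t; have d := is_cderive_expi x (e * t) 0.
    have E1 (w : R[i]) : (fun z : R => expi (e * z * t) * w) = (fun z => w * expi (e * t * z + 0)).
      by apply/funext => z; rewrite addr0 mulrAC mulrC.
    rewrite /= E1; apply: (is_cderive_eq (is_cderiveZ _ d)).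
    rewrite addr0 [e * x * t]mulrAC /g; apply: complexP; rewrite ?(cReM, cImM) /=; ring.
  - by move=> x t; rewrite nrmM [nrm (_ * g t)]nrmM nrm_expi mul1r -mulrA ler_wpM2l ?nrm_ge0 ?gM.
apply: (is_cderive_eq d1).
have dfu := cdecays_expi (e * u) df; have dgu := cdecays_expi (e * u) dg.
rewrite intCZ//.
have : intC (fun t => ((0 +i* e) * u%:C) * (expi (e * u * t) * f t) +
    (- 2 * b)%:C * (expi (e * u * t) * g t)) = 0.
  apply: (intC_derive dfu); first by apply: cdecaysP => //; exact: cdecaysZ.
  move=> t; have d := is_cderive_expi t (e * u) 0.
  have E1 : (fun z : R => expi (e * u * z + 0)) = (fun z => expi (e * u * z)).
    by apply/funext => z; rewrite addr0.
  rewrite E1 addr0 in d.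
  apply: (is_cderive_eq (is_cderiveM d (is_cderive_real (is_derive_gau b t)))).
  rewrite /f /g; apply: complexP; rewrite ?(cReM, cImM, cReD, cImD) /=; ring.
rewrite intCP ?intCZ//; last exact: cdecaysZ.
rewrite -/(gauF e b u) => H.
have b2 : (- 2 * b)%:C != 0 :> R[i].
  by rewrite eq_complex /= eqxx andbT mulf_neq0 ?oppr_eq0 ?pnatr_eq0// gt_eqF.
apply: (mulfI b2); move: H => /eqP; rewrite addr_eq0 => /eqP H.
rewrite mulrCA -[(- 2 * b)%:C * intC _]opprK -H.
move: (gauF e b u) => [x y]; apply: complexP; rewrite /= ?(mulr0, mul0r); field; exact: lt0r_neq0.
Qed.

(** By the differential equation [is_cderive_gauF], the product of the transform with exp (c u^2) is
    constant; its value at 0 is the Gaussian integral. *)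
Lemma gauFE e b u : 0 < b ->
  gauF e b u = (Num.sqrt (pi / b) * gau (e ^+ 2 / (4 * b)) 0 u)%:C.
Proof.
move=> b0; pose c := e ^+ 2 / (4 * b).
pose h u := (expR (c * u ^+ 2))%:C * gauF e b u.
have dh x : is_cderive x (1 : R) h 0.
  have d2 : is_derive x (1 : R) (fun u => expR (c * u ^+ 2)) (2 * c * x * expR (c * x ^+ 2)).
    have E : (fun u => expR (c * u ^+ 2)) = fun u => expR (c * (u * u)).
      by apply/funext => z; rewrite expr2.
    have d3 := is_deriveZ c (is_deriveM (is_derive_id x (1 : R)) (is_derive_id x (1 : R))).
    rewrite E; apply: (is_derive_eq (is_derive1_comp (is_derive_expR _) d3)).
    by rewrite /GRing.scale /= expr2; ring.
  apply: (is_cderive_eq (is_cderiveM (is_cderive_real d2) (is_cderive_gauF e x b0))).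
  rewrite mulrA -mulrDl -!rmorphM -rmorphD.
  rewrite (_ : _ + _ = 0) ?rmorph0 ?mul0r//.
  by rewrite /c; field; exact: lt0r_neq0.
have hc : h u = h 0.
  have H (p : R -> R) : (forall x, is_derive x (1 : R) p 0) -> p u = p 0.
    move=> dp; apply/eqP; rewrite -subr_eq0 -normr_le0.
    have := le_norm_MVT (dh := fun=> 0) (M := 0) 0 u dp.
    by rewrite mul0r; apply => t; rewrite normr0.
  apply: complexP.
    by apply: (H (fun u => complex.Re (h u))) => x; case: (dh x).
  by apply: (H (fun u => complex.Im (h u))) => x; case: (dh x).
have g0 : gauF e b 0 = (Num.sqrt (pi / b))%:C.
  rewrite /gauF -(intR_gau 0 b0).
  have -> : (fun t => expi (e * 0 * t) * (gau b 0 t)%:C) = (fun t => (gau b 0 t)%:C).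
    by apply/funext => t; rewrite mulr0 mul0r expi0 mul1r.
  by apply: complexP => //=; exact: intR0.
have E0 : (expR (c * u ^+ 2))%:C != 0 :> R[i].
  by rewrite eq_complex /= eqxx andbT gt_eqF// expR_gt0.
apply: (mulfI E0); rewrite -/(h u) hc /h g0 expr0n /= mulr0 expR0 -!rmorphM; congr (_%:C).
rewrite mul1r mulrCA /gau subr0 mulNr expRN -/c divff ?mulr1//.
by rewrite gt_eqF// expR_gt0.
Qed.

(** Half of the exponent absorbs |u|. In the scale v = u / s with s = sqrt (2 / b) the claim is |v|
    exp (- v^2) <= |v| / (1 + v^2) <= 1. *)
Lemma norm_mul_gau_le b u : 0 < b ->
  `|u| * gau b 0 u <= Num.sqrt (2 / b) * gau (b / 2) 0 u.
Proof.
move=> b0; have -> : gau b 0 u = gau (b / 2) 0 u * gau (b / 2) 0 u.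
  by rewrite /gau -expRD; congr expR; rewrite subr0; lra.
rewrite mulrA ler_wpM2r ?(ltW (gau_gt0 _ _ _))//.
set s := Num.sqrt _; have s0 : 0 < s by rewrite sqrtr_gt0 divr_gt0.
have s2 : b / 2 = (s ^+ 2)^-1 by rewrite sqr_sqrtr ?divr_ge0// ?(ltW b0)// invf_div.
have H : `|u / s| * (oneDsqr (u / s))^-1 <= 1 := norm_oneDsqrV_le1 _.
have H2 : gau (b / 2) 0 u <= (oneDsqr (u / s))^-1.
  rewrite /gau subr0 s2 mulNr expRN lef_pV2 ?posrE ?expR_gt0 ?oneDsqr_gt0//.
  by apply: le_trans (expR_ge1Dx _); rewrite /oneDsqr expr_div_n mulrC.
have -> : `|u| = s * `|u / s|.
  by rewrite normrM normfV (gtr0_norm s0) mulrCA divff ?mulr1// gt_eqF.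
rewrite -mulrA -[leRHS]mulr1 ler_wpM2l ?(ltW s0)// (le_trans _ H)//.
by rewrite ler_wpM2l.
Qed.

End Gaussian.

(** * Partial transforms commute and are self-adjoint *)

Section Swap.
Context {R : realType} {n : nat}.
Implicit Types (f g : fn R n) (i j k : 'I_n) (x y : 'rV[R]_n) (e : R).

Definition cont2 (F : R -> R -> R[i]) :=
  continuous (fun z : R * R => complex.Re (F z.1 z.2)) /\
  continuous (fun z : R * R => complex.Im (F z.1 z.2)).

Lemma cont2M F G : cont2 F -> cont2 G -> cont2 (fun s t => F s t * G s t).
Proof.
move=> [F1 F2] [G1 G2].
exact: (@continuous_cmul _ _ (fun z => F z.1 z.2) (fun z => G z.1 z.2)).
Qed.

Lemma continuous_fst2 : continuous (fun z : R * R => z.1).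
Proof. by move=> z; exact: cvg_fst. Qed.

Lemma continuous_snd2 : continuous (fun z : R * R => z.2).
Proof. by move=> z; exact: cvg_snd. Qed.

Lemma continuous_comp1 (T U V : topologicalType) (f : T -> U) (g : U -> V) :
  continuous f -> continuous g -> continuous (fun u : T => g (f u)).
Proof. by move=> cf cg u; exact: continuous_comp (cf u) (cg _). Qed.

Lemma cont2_fst (u : R -> R[i]) : continuous (fun t => complex.Re (u t)) ->
  continuous (fun t => complex.Im (u t)) -> cont2 (fun s _ => u s).
Proof. by move=> c1 c2; split; [exact: (continuous_comp1 continuous_fst2 c1)|exact: (continuous_comp1 continuous_fst2 c2)]. Qed.

Lemma cont2_snd (u : R -> R[i]) : continuous (fun t => complex.Re (u t)) ->
  continuous (fun t => complex.Im (u t)) -> cont2 (fun _ t => u t).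
Proof. by move=> c1 c2; split; [exact: (continuous_comp1 continuous_snd2 c1)|exact: (continuous_comp1 continuous_snd2 c2)]. Qed.

Lemma cont2_expi (h : R * R -> R) : continuous h -> cont2 (fun s t => expi (h (s, t))).
Proof.
move=> ch; have E : h = fun z => h (z.1, z.2) by apply/funext => -[].
rewrite E in ch; split => /=.
  exact: continuous_comp1 ch (@continuous_cos _).
exact: continuous_comp1 ch (@continuous_sin _).
Qed.

Lemma cont2_fn f (h : R * R -> 'rV[R]_n) : cont f -> continuous h ->
  cont2 (fun s t => f (h (s, t))).
Proof.
move=> [c1 c2] ch; have E : h = fun z => h (z.1, z.2) by apply/funext => -[].
by rewrite E in ch; split; [exact: continuous_comp1 ch c1|exact: continuous_comp1 ch c2].
Qed.

Lemma slice2_bound f i j : i != j -> rapid f ->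
  exists M, forall x s t, nrm (f (upd (upd x i s) j t)) <= M * (oneDsqr s)^-1 * (oneDsqr t)^-1.
Proof.
move=> ij rf; have [M0 H0] := rf [::]; have [M1 H1] := rf [:: i; i].
have [M2 H2] := rf [:: j; j]; have [M3 H3] := rf [:: i; i; j; j].
exists (M0 + M1 + M2 + M3) => x s t.
rewrite ler_pdivlMr ?oneDsqr_gt0// ler_pdivlMr ?oneDsqr_gt0//.
set z := upd _ _ _.
have zi : z 0 i = s by rewrite /z upd_neq// upd_eq.
have zj : z 0 j = t by rewrite /z upd_eq.
have b1 : s ^+ 2 * nrm (f z) <= M1.
  have := H1 z; rewrite xmulsE nrmM nrm_real !big_cons big_nil mulr1 zi -expr2.
  by rewrite ger0_norm// sqr_ge0.
have b2 : t ^+ 2 * nrm (f z) <= M2.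
  have := H2 z; rewrite xmulsE nrmM nrm_real !big_cons big_nil mulr1 zj -expr2.
  by rewrite ger0_norm// sqr_ge0.
have b3 : s ^+ 2 * t ^+ 2 * nrm (f z) <= M3.
  have := H3 z; rewrite xmulsE nrmM nrm_real !big_cons big_nil mulr1 zi zj.
  rewrite (_ : s * (s * (t * t)) = s ^+ 2 * t ^+ 2); last by rewrite !expr2 !mulrA.
  by rewrite ger0_norm// mulr_ge0// sqr_ge0.
have b0 : nrm (f z) <= M0 by exact: (H0 z).
rewrite /oneDsqr (_ : _ * _ * _ = nrm (f z) + s ^+ 2 * nrm (f z) + t ^+ 2 * nrm (f z)
  + s ^+ 2 * t ^+ 2 * nrm (f z)); last by ring.
by rewrite !lerD.
Qed.

Lemma fpartC e e' i j f : i != j -> crapid f ->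
  fpart e i (fpart e' j f) = fpart e' j (fpart e i f).
Proof.
move=> ij cf; have ji : j != i by rewrite eq_sym.
apply/funext => x; have [M HM] := slice2_bound ij cf.2.
pose F s t : R[i] := expi (e * x 0 i * s) * (expi (e' * x 0 j * t) * f (upd (upd x i s) j t)).
have sd1 s : cdecays (fun t => expi (e' * x 0 j * t) * f (upd (upd x i s) j t)).
  exact: slice_cdecays.
have sd2 t : cdecays (fun s => expi (e * x 0 i * s) * f (upd (upd x j t) i s)).
  exact: slice_cdecays.
transitivity (intC (fun s => intC (F s))).
  congr intC; apply/funext => s; rewrite /F intCZ//; congr (_ * intC _).
  by apply/funext => t; rewrite upd_neq.
transitivity (intC (fun t => intC (F^~ t))); last first.
  congr intC; apply/funext => t; rewrite -[RHS]/(_ * intC _) -intCZ; last first.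
    have := sd2 t; congr cdecays.
    by apply/funext => s; rewrite (upd_neq _ _ ij).
  congr intC; apply/funext => s.
  by rewrite /F mulrCA (updC _ _ _ ij) (upd_neq _ _ ij).
have cl (a : R) (p : R * R -> R) : continuous p -> continuous (fun z => a * p z).
  by move=> cp; exact: continuous_mul (@continuous_cst _ _ _) cp.
have cF : cont2 F.
  apply: cont2M; first exact: cont2_expi (cl _ _ continuous_fst2).
  apply: cont2M; first exact: cont2_expi (cl _ _ continuous_snd2).
  apply: (@cont2_fn f (fun z => upd (upd x i z.1) j z.2)); first exact: cf.1.
  have -> : (fun z : R * R => upd (upd x i z.1) j z.2) = (fun z => x +
      ((z.1 - x 0 i) *: basis_vec i + (z.2 - x 0 j) *: basis_vec j)).
    by apply/funext => z; rewrite addrA /upd -/(upd x i z.1) (upd_neq _ _ ji).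
  move=> z; apply: cvgD; first exact: cvg_cst.
  apply: cvgD; apply: cvgZr_tmp; apply: cvgB; try exact: cvg_cst.
    exact: continuous_fst2.
  exact: continuous_snd2.
apply: (intC_swap (M := M)); [exact: cF.1|exact: cF.2|move=> s t].
by rewrite /F !nrmM !nrm_expi !mul1r.
Qed.

(** Fubini, the kernel [expi (e * t * s)] being symmetric in s and t. *)
Lemma fpart_adj e j f g x : crapid f -> crapid g ->
  intC (fun t => fpart e j f (upd x j t) * g (upd x j t)) =
  intC (fun t => f (upd x j t) * fpart e j g (upd x j t)).
Proof.
move=> cf cg; have [M fM] := slice_bound j cf.2; have [N gN] := slice_bound j cg.2.
pose F t s : R[i] := expi (e * t * s) * (f (upd x j s) * g (upd x j t)).
have Z h (c : R[i]) y : crapid h -> fpart e j h y * c =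
    intC (fun t => expi (e * y 0 j * t) * (h (upd y j t) * c)).
  move=> ch; rewrite mulrC -intCZ; last exact: slice_cdecays.
  by congr intC; apply/funext => t; rewrite mulrCA [c * _]mulrC.
transitivity (intC (fun t => intC (F t))).
  congr intC; apply/funext => t; rewrite Z//; congr intC; apply/funext => s.
  by rewrite /F upd_eq upd_upd.
transitivity (intC (fun s => intC (F^~ s))); last first.
  congr intC; apply/funext => s; rewrite mulrC Z//; congr intC; apply/funext => t.
  by rewrite /F upd_eq upd_upd [g _ * _]mulrC [e * t * s]mulrAC.
have [f1 f2] := slice_cont j x cf.1; have [g1 g2] := slice_cont j x cg.1.
have cF : cont2 F.
  apply: cont2M.
    apply: (@cont2_expi (fun z => e * z.1 * z.2)).
    apply: continuous_mul; last exact: continuous_snd2.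
    exact: continuous_mul (@continuous_cst _ _ _) continuous_fst2.
  by apply: cont2M; [exact: cont2_snd|exact: cont2_fst].
apply: (intC_swap (M := M * N)); [exact: cF.1|exact: cF.2|move=> t s].
rewrite /F nrmM nrm_expi mul1r nrmM.
rewrite (_ : M * N * _ * _ = (M * (oneDsqr s)^-1) * (N * (oneDsqr t)^-1)); last by ring.
by rewrite ler_pM ?nrm_ge0.
Qed.

End Swap.

(** * Fourier inversion in one variable *)

Section Inversion.
Context {R : realType}.
Implicit Types (a b d e t u s : R) (g : R -> R[i]).

Lemma nrm_intC_le g (h : R -> R) : cdecays g -> decays h ->
  (forall t, nrm (g t) <= h t) -> nrm (intC g) <= 2 * intR h.
Proof.
move=> [g1 g2] dh gh; apply: (le_trans (nrm_le _)).
rewrite mulr_natl mulr2n; apply: lerD; apply: intR_bound => // t.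
  exact: le_trans (Re_le_nrm _) (gh t).
exact: le_trans (Im_le_nrm _) (gh t).
Qed.

Lemma cdecaysM_real g (h : R -> R) M : cdecays g -> continuous h ->
  (forall t, `|h t| <= M) -> cdecays (fun t => g t * (h t)%:C).
Proof.
move=> dg ch hM; have [c1 c2] := cdecays_cont dg; have [N gN] := cdecays_bound dg.
have [d1 d2] := continuous_cmul c1 c2 (v := fun t => (h t)%:C) ch (@continuous_cst _ _ 0).
apply: (cdecays_nrm (M := N * M)) => // t.
by rewrite nrmM nrm_real mulrAC ler_pM ?nrm_ge0.
Qed.

Lemma gau_le1 b a t : 0 <= b -> gau b a t <= 1.
Proof.
by move=> b0; rewrite /gau -expR0 ler_expR mulNr oppr_le0 mulr_ge0// sqr_ge0.
Qed.

Lemma gau_ge b t : 0 <= b -> 1 - gau b 0 t <= b * t ^+ 2.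
Proof.
move=> b0; rewrite lerBlDr -lerBlDl; apply: le_trans (expR_ge1Dx _).
by rewrite subr0 mulNr.
Qed.

Let alg1 (p d : R) : d != 0 -> (2 * p) ^+ 2 / (4 * d) = p ^+ 2 / d.
Proof. by move=> d0; field. Qed.

Let alg2 (p d : R) : p != 0 -> d != 0 -> p / d * (p / (p ^+ 2 / d)) = 1.
Proof. by move=> p0 d0; field; rewrite ?p0 ?d0. Qed.

Let alg3 (p h : R) : p != 0 -> h != 0 ->
  p / h ^+ 2 * (2 / (p ^+ 2 / h ^+ 2) * (p / (p ^+ 2 / h ^+ 2 / 2))) = (2 * h / p) ^+ 2.
Proof. by move=> p0 h0; field; rewrite ?p0 ?h0. Qed.

Let alg4 (p h L : R) : 2 * (L * (2 * h / p)) = h * (2 * (L * (2 / p))).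
Proof. ring. Qed.

(** Gaussian summation. Damping the inverse integral by exp (- h^2 s^2) changes it by O(h^2),
    because of the decay of [gh]. By Fubini the damped integral is the average of [g] for a Gaussian
    probability density centred at a, of width proportional to h, and the Lipschitz bound at a puts
    it within O(h) of [g a]. Then h tends to 0. *)
Lemma fourier_inversion1 e g (L M a : R) : e ^+ 2 = (2 * pi) ^+ 2 -> 0 <= L ->
  let gh s := intC (fun t => expi (e * s * t) * g t) in
  cdecays g -> (forall t, nrm (g t - g a) <= L * `|t - a|) ->
  cdecays gh -> (forall s, s ^+ 2 * nrm (gh s) <= M * (oneDsqr s)^-1) ->
  intC (fun s => expi (- e * a * s) * gh s) = g a.
Proof.
move=> e2 L0 gh dg gL dgh ghM; set I := intC _.
have p0 : 0 < pi :> R := pi_gt0 R.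
have eta_bound h : 0 < h -> nrm (I - g a) <= 2 * pi * (h ^+ 2 * M) + 2 * (L * (2 * h / pi)).
  move=> h0; pose d := h ^+ 2; have d0 : 0 < d by rewrite exprn_gt0.
  pose A := intC (fun s => expi (- e * a * s) * gh s * (gau d 0 s)%:C).
  have dI := cdecays_expi (- e * a) dgh.
  have gau1 b t : 0 < b -> `|gau b 0 t| <= 1.
    by move=> b0; rewrite gtr0_norm ?gau_gt0// gau_le1// ltW.
  have dA := cdecaysM_real dI (@continuous_gau _ d 0) (fun t => gau1 _ _ d0).
  rewrite -(subrK A I) -addrA; apply: (le_trans (nrmD _ _)); apply: lerD.
    have -> : I - A = intC (fun s => (- 1) * (expi (- e * a * s) * gh s * (gau d 0 s)%:C)
        + expi (- e * a * s) * gh s).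
      by rewrite intCP// mulN1r addrC.
    apply: nrm_intC => [|s]; first exact: cdecaysP.
    rewrite (_ : _ + _ = expi (- e * a * s) * gh s * (1 - gau d 0 s)%:C); last first.
      by rewrite rmorphB mulrBr mulr1 mulN1r addrC.
    rewrite !nrmM nrm_expi mul1r nrm_real ger0_norm ?subr_ge0 ?gau_le1 ?(ltW d0)//.
    rewrite -mulrA (le_trans _ (ler_wpM2l (ltW d0) (ghM s)))// mulrA mulrC.
    by rewrite ler_wpM2r ?nrm_ge0 ?gau_ge ?(ltW d0).
  (* [b] is the exponent e^2 / (4 d) of the transformed damping factor, kept opaque; with [r] as
     prefactor the transformed Gaussian has mass one. *)
  have [b bE] : exists b, b = pi ^+ 2 / d by exists (pi ^+ 2 / d).
  have b0 : 0 < b by rewrite bE divr_gt0// exprn_gt0.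
  pose r := Num.sqrt (pi / d); have r0 : 0 < r by rewrite sqrtr_gt0 divr_gt0.
  have KE u : gauF e d u = (r * gau b 0 u)%:C.
    by rewrite gauFE// e2 alg1 ?lt0r_neq0// -bE.
  have shift t : gau b 0 (t - a) = gau b a t by rewrite /gau subr0.
  have AE : A = intC (fun t => g t * (r * gau b a t)%:C).
    pose F s t := expi (- e * a * s) * (gau d 0 s)%:C * (expi (e * s * t) * g t).
    have cF : cont2 F.
      have [g1 g2] := cdecays_cont dg.
      apply: cont2M; apply: cont2M.
      - apply: (@cont2_expi _ (fun z => - e * a * z.1)).
        exact: continuous_mul (@continuous_cst _ _ _) continuous_fst2.
      - exact: (@cont2_fst _ (fun s => (gau d 0 s)%:C) (@continuous_gau _ d 0) (@continuous_cst _ _ 0)).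
      - apply: (@cont2_expi _ (fun z => e * z.1 * z.2)).
        apply: continuous_mul; last exact: continuous_snd2.
        exact: continuous_mul (@continuous_cst _ _ _) continuous_fst2.
      - exact: (cont2_snd g1 g2).
    have [Mg gM] := cdecays_bound dg.
    have dgau := decays_gau 0 d0; have [_ [Md dM]] := dgau.
    transitivity (intC (fun s => intC (F s))).
      congr intC; apply/funext => s; rewrite mulrAC /gh -intCZ//.
      exact: cdecays_expi.
    rewrite (@intC_swap _ F (Md * Mg)).
    - congr intC; apply/funext => t.
      rewrite -shift -KE /gauF -intCZ; last exact: cdecays_expi (cdecays_real dgau).
      congr intC; apply/funext => s; rewrite /F.
      rewrite (_ : e * (t - a) * s = - e * a * s + e * s * t); last by ring.
      by rewrite expiD; ring.
    - by case: cF.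
    - by case: cF.
    - move=> s t; rewrite /F !nrmM !nrm_expi !mul1r nrm_real.
      rewrite (_ : Md * Mg * _ * _ = (Md * (oneDsqr s)^-1) * (Mg * (oneDsqr t)^-1)).
        by rewrite ler_pM ?nrm_ge0.
      ring.
  have drg : decays (fun t => r * gau b a t) by apply: decaysZ; exact: decays_gau.
  have int1 : intR (fun t => r * gau b a t) = 1.
    rewrite intRZ; last exact: decays_gau.
    rewrite intR_gau// -sqrtrM ?divr_ge0// ?(ltW p0) ?(ltW d0)//.
    by rewrite bE alg2 ?sqrtr1// lt0r_neq0.
  have dgK : cdecays (fun t => g t * (r * gau b a t)%:C).
    apply: (cdecaysM_real (M := r)) => //; first by case: drg.
    move=> t; rewrite normrM (gtr0_norm r0) -[leRHS]mulr1 ler_wpM2l ?(ltW r0)//.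
    by rewrite -shift gau1.
  have dK := cdecays_real drg.
  have -> : A - g a = intC (fun t => (- g a) * (r * gau b a t)%:C + g t * (r * gau b a t)%:C).
    rewrite intCP// -AE (_ : intC (fun t => (r * gau b a t)%:C) = 1) ?mulr1 1?addrC//.
    by apply: complexP => //=; exact: intR0.
  rewrite (_ : L * (2 * h / pi) = intR (fun t => L * r * Num.sqrt (2 / b) * gau (b / 2) a t)).
    apply: nrm_intC_le; first exact: cdecaysP.
      by apply: decaysZ; apply: decays_gau; rewrite divr_gt0.
    move=> t; rewrite addrC mulNr -mulrBl nrmM nrm_real normrM (gtr0_norm r0) gtr0_norm ?gau_gt0//.
    have H := norm_mul_gau_le (t - a) b0.
    have sh2 : gau (b / 2) 0 (t - a) = gau (b / 2) a t by rewrite /gau subr0.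
    rewrite shift sh2 in H.
    have -> : L * r * Num.sqrt (2 / b) * gau (b / 2) a t =
        r * (L * (Num.sqrt (2 / b) * gau (b / 2) a t)).
      by rewrite [L * r]mulrC !mulrA.
    rewrite mulrCA ler_wpM2l ?(ltW r0)//.
    apply: le_trans (ler_wpM2r (ltW (gau_gt0 _ _ _)) (gL t)) _.
    by rewrite -[L * _ * _]mulrA ler_wpM2l.
  rewrite intRZ; last by apply: decays_gau; rewrite divr_gt0.
  rewrite intR_gau ?divr_gt0// -!mulrA; congr (_ * _).
  have b20 : 0 <= 2 / b by rewrite divr_ge0// ltW.
  rewrite -sqrtrM// -sqrtrM ?divr_ge0 ?(ltW p0) ?(ltW d0)//.
  rewrite bE alg3 ?lt0r_neq0// sqrtr_sqr ger0_norm ?mulrA//.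
  by rewrite mulr_ge0 ?mulr_ge0 ?invr_ge0 ?(ltW h0) ?(ltW p0).
have X0 := nrm_ge0 (I - g a); set X := nrm _ in eta_bound X0.
apply/eqP; rewrite -subr_eq0; apply/eqP/Normc.eq0_normc; rewrite -/(nrm _) -/X.
apply/eqP; rewrite eq_le X0 andbT leNgt; apply/negP => Xgt.
(* For h <= 1 the error bound is at most h c, which the choice h <= X / (2 c) keeps below X. The
   summand 1 makes c positive. *)
pose c := 2 * pi * `|M| + 2 * (L * (2 / pi)) + 1.
have c0 : 0 < c.
  rewrite ltr_wpDl// addr_ge0// !mulr_ge0// ?invr_ge0 ?(ltW p0)//.
pose h := Num.min 1 (X / (2 * c)).
have h0 : 0 < h by rewrite lt_min ltr01 divr_gt0// mulr_gt0.
have h1 : h <= 1 by rewrite ge_min lexx.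
have hX : h * c <= X / 2.
  have : h <= X / (2 * c) by rewrite ge_min lexx orbT.
  rewrite -(ler_pM2r c0) => /le_trans; apply; rewrite invfM mulrA divfK//.
  by rewrite gt_eqF.
have := eta_bound h h0; apply/negP; rewrite -ltNge.
apply: (@le_lt_trans _ _ (h * c)); last first.
  by apply: le_lt_trans hX _; rewrite ltr_pdivrMr// mulr_natr mulr2n ltrDl.
have -> : h * c = h * (2 * pi * `|M|) + h * (2 * (L * (2 / pi))) + h.
  by rewrite /c [LHS]mulrDr [X in X + _]mulrDr mulr1.
rewrite ler_wpDr ?(ltW h0)//; apply: lerD; last by rewrite alg4.
rewrite [leRHS]mulrCA ler_wpM2l ?mulr_ge0 ?(ltW p0)//.
apply: (@le_trans _ _ (h ^+ 2 * `|M|)); first by rewrite ler_wpM2l ?sqr_ge0 ?ler_norm.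
by rewrite ler_wpM2r// expr2 -[leRHS]mulr1 ler_wpM2l// ltW.
Qed.

Lemma fpartK {n : nat} e (j : 'I_n) (f : fn R n) : e ^+ 2 = (2 * pi) ^+ 2 -> schwartz f ->
  fpart (- e) j (fpart e j f) = f.
Proof.
move=> e2 sf; have cf := schwartz_crapid sf.
have e0 : e != 0.
  rewrite -sqrf_eq0 e2 sqrf_eq0 mulf_neq0 ?pnatr_eq0//.
  by rewrite gt_eqF// pi_gt0.
have sF := fpart_schwartz j e0 sf; have cF := schwartz_crapid sF.
apply/funext => x; have [L fL] := rapid_bdd (schwartz_rapid (schwartz_pderiv j sf)).
have L0 : 0 <= L by exact: le_trans (nrm_ge0 _) (fL 0).
have [M FM] := slice_bound j (schwartz_rapid (schwartz_xmul j (schwartz_xmul j sF))).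
pose g t := f (upd x j t).
have dec (h : fn R n) : crapid h -> cdecays (fun t => h (upd x j t)).
  move=> ch; have := slice_cdecays j x 0 ch; congr cdecays.
  by apply/funext => t; rewrite mul0r expi0 mul1r.
have ghE s : intC (fun t => expi (e * s * t) * g t) = fpart e j f (upd x j s).
  by congr intC; apply/funext => t; rewrite upd_eq upd_upd.
have gx : g (x 0 j) = f x by rewrite /g upd_id.
rewrite -gx; transitivity (intC (fun s => expi (- e * x 0 j * s) *
    intC (fun t => expi (e * s * t) * g t))).
  by congr intC; apply/funext => t; rewrite ghE.
(* Real and imaginary parts are each Lipschitz with constant [L], whence [2 * L]. [M] comes from the
   transform multiplied twice by the coordinate [j], which is still Schwartz. *)
apply: (@fourier_inversion1 e g (2 * L) M) => //.
- by rewrite mulr_ge0.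
- exact: dec.
- move=> t; apply: (le_trans (nrm_le _)).
  have sl := (@pd_sliceP _ _ j f _).1 (schwartz_pd j sf) x.
  have E z w : (z - w : R[i]) = z + (-1) * w by rewrite mulN1r.
  rewrite E cReD cImD cReM cImM /= !mulN1r !oppr0 !mul0r subr0 addr0.
  rewrite -[2 * L * _]mulrA mulr_natl mulr2n; apply: lerD.
    apply: (@le_norm_MVT _ (fun t => complex.Re (g t))
      (fun t => complex.Re (pderiv j f (upd x j t)))) => s; first by case: (sl s).
    exact: le_trans (Re_le_nrm _) (fL _).
  apply: (@le_norm_MVT _ (fun t => complex.Im (g t))
    (fun t => complex.Im (pderiv j f (upd x j t)))) => s; first by case: (sl s).
  exact: le_trans (Im_le_nrm _) (fL _).
- by under eq_fun do rewrite ghE; exact: dec.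
- move=> s; rewrite ghE; have := FM x s; rewrite /xmul upd_eq !nrmM nrm_real mulrA -expr2.
  by rewrite real_normK ?num_real.
Qed.

End Inversion.

(** * The integral over R^n as a composition of one-variable averages *)

Section IteratedIntegral.
Context {R : realType}.

Definition avgR {n} (j : 'I_n) (h : 'rV[R]_n -> R) : 'rV[R]_n -> R :=
  fun x => intR (fun t => h (upd x j t)).

Definition avgC {n} (j : 'I_n) (f : fn R n) : fn R n := fun x => intC (fun t => f (upd x j t)).

Lemma row_mx_ord0 n (t : R) (y : 'rV[R]_n) :
  (row_mx (t%:M : 'M[R]_1) y : 'rV[R]_(n.+1)) 0 ord0 = t.
Proof.
transitivity ((t%:M : 'M[R]_1) 0 0); last by rewrite mxE.
rewrite -(row_mxEl (t%:M : 'M[R]_1) y 0 0).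
by congr (fun_of_matrix _ _ _); exact: val_inj.
Qed.

Lemma row_mx_lift n (t : R) (y : 'rV[R]_n) (j : 'I_n) :
  (row_mx (t%:M : 'M[R]_1) y : 'rV[R]_(n.+1)) 0 (lift ord0 j) = y 0 j.
Proof.
rewrite -(row_mxEr (t%:M : 'M[R]_1) y 0 j).
by congr (fun_of_matrix _ _ _); exact: val_inj.
Qed.

Lemma upd_row_mx n (t s : R) (y : 'rV[R]_n) j :
  upd (row_mx (t%:M : 'M[R]_1) y : 'rV[R]_(n.+1)) (lift ord0 j) s = row_mx (t%:M : 'M[R]_1) (upd y j s).
Proof.
apply/rowP => k; rewrite updE; case: (unliftP ord0 k) => [i|] ->.
  by rewrite !row_mx_lift updE (inj_eq lift_inj).
by rewrite !row_mx_ord0.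
Qed.

(** Every coordinate of the base point is overwritten by an integration variable, so [x] can be
    arbitrary. *)
Lemma integral_rVE n (h : 'rV[R]_n -> R) x : integral_rV h = foldr avgR h (enum 'I_n) x.
Proof.
elim: n h x => [|n IH] h x /=.
  rewrite (_ : enum 'I_0 = [::]); last by apply/size0nil; rewrite size_enum_ord.
  by congr h; apply/rowP => -[].
rewrite enum_ordSl /=; apply: eq_Rintegral => t _.
pose y : 'rV[R]_n := \row_j x 0 (lift ord0 j).
have -> : upd x ord0 t = row_mx (t%:M : 'M[R]_1) y.
  apply/rowP => k; rewrite updE; case: (unliftP ord0 k) => [i|] ->.
    by rewrite row_mx_lift mxE.
  by rewrite row_mx_ord0.
rewrite (IH _ y); elim: (enum 'I_n) y => //= j l IHl y.
by apply: eq_Rintegral => s _; rewrite upd_row_mx IHl.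
Qed.

Lemma cintegralE n (f : fn R n) x : cintegral f = foldr avgC f (enum 'I_n) x.
Proof.
rewrite /cintegral !(integral_rVE _ x).
have E1 l : foldr avgR (re_fn f) l = re_fn (foldr avgC f l).
  by elim: l => //= j l ->.
have E2 l : foldr avgR (im_fn f) l = im_fn (foldr avgC f l).
  by elim: l => //= j l ->.
by rewrite E1 E2; apply: complexP.
Qed.

End IteratedIntegral.

(** * The Fourier transform on the Schwartz space of R^n *)

Section FourierTransform.
Context {R : realType} {n : nat}.
Implicit Types (f g : fn R n) (i j k : 'I_n) (x y xi : 'rV[R]_n) (e : R) (l : seq 'I_n).

(** Operators that only look along lines in direction [j], composed over [l], only look at the
    points that agree with [x] outside [l]. *)
Lemma foldr_local (O : 'I_n -> fn R n -> fn R n) l f g x :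
  (forall j u v z, (forall t, u (upd z j t) = v (upd z j t)) -> O j u z = O j v z) ->
  (forall y, (forall k, k \notin l -> y 0 k = x 0 k) -> f y = g y) ->
  foldr O f l x = foldr O g l x.
Proof.
move=> loc; elim: l x => [|j l IH] x H /=; first exact: H.
apply: loc => t; apply: IH => y Hy; apply: H => k.
rewrite in_cons negb_or => /andP[kj kl].
by rewrite Hy// upd_neq.
Qed.

Lemma fpart_local e j f g x : (forall t, f (upd x j t) = g (upd x j t)) ->
  fpart e j f x = fpart e j g x.
Proof. by move=> H; congr intC; apply/funext => t; rewrite H. Qed.

Lemma avgC_local j f g x : (forall t, f (upd x j t) = g (upd x j t)) ->
  avgC j f x = avgC j g x.
Proof. by move=> H; congr intC; apply/funext => t. Qed.

Definition ftl e l f := foldr (fpart e) f l.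

Lemma ftl_cons e j l f : ftl e (j :: l) f = fpart e j (ftl e l f).
Proof. by []. Qed.

Lemma ftl_schwartz e l f : e != 0 -> schwartz f -> schwartz (ftl e l f).
Proof. by move=> e0 sf; elim: l => //= j l IH; exact: fpart_schwartz. Qed.

Lemma ftlP e l c f g : e != 0 -> schwartz f -> schwartz g ->
  ftl e l (c *: f + g) = c *: ftl e l f + ftl e l g.
Proof.
move=> e0 sf sg; elim: l => //= j l ->.
by rewrite fpartP//; apply: schwartz_crapid; exact: ftl_schwartz.
Qed.

Lemma ftlZ e l c f : e != 0 -> schwartz f -> ftl e l (c *: f) = c *: ftl e l f.
Proof.
move=> e0 sf; elim: l => //= j l ->.
by rewrite fpartZ//; apply: schwartz_crapid; exact: ftl_schwartz.
Qed.

Lemma ftl_fpart e e' l i f : e != 0 -> e' != 0 -> i \notin l -> schwartz f ->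
  ftl e' l (fpart e i f) = fpart e i (ftl e' l f).
Proof.
move=> e0 e'0 + sf; elim: l => // j l IH; rewrite in_cons negb_or => /andP[ij il].
have ji : j != i by rewrite eq_sym.
rewrite !ftl_cons (IH il) (fpartC _ _ ji)//.
by apply: schwartz_crapid; exact: ftl_schwartz.
Qed.

(** In [ftl] the coordinates of [x] in [l] play the part of frequencies, whence the condition that
    they agree with [xi]. Integrating over [i] overwrites that coordinate only, and the part of the
    exponential that involves [i] is a constant for the inner integrals. *)
Lemma avg_ftl e l f xi x : e != 0 -> uniq l -> schwartz f ->
  (forall j, j \in l -> x 0 j = xi 0 j) ->
  foldr avgC (fun y => expi (e * \sum_(j <- l) y 0 j * xi 0 j) * f y) l x = ftl e l f x.
Proof.
move=> e0; elim: l f x => [|i l IH] f x /=.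
  by move=> _ _ _; rewrite big_nil mulr0 expi0 mul1r.
move=> /andP[il ul] sf Hx; congr intC; apply/funext => t.
rewrite [e * x 0 i]mulrC [_ * e]mulrC Hx ?mem_head//.
pose c := expi (e * xi 0 i * t).
transitivity (ftl e l (c *: f) (upd x i t)); last by rewrite ftlZ.
rewrite -IH//; last 2 first.
- exact: schwartzZ.
- move=> j jl; rewrite upd_neq ?Hx// ?in_cons ?jl ?orbT//.
  by apply: contraNneq il => <-.
apply: foldr_local => [|y Hy]; first exact: avgC_local.
have Ec : expi (e * (t * xi 0 i)) = c by rewrite /c [t * _]mulrC mulrA.
rewrite big_cons Hy// upd_eq mulrDr expiD Ec -[(c *: f) y]/(c * f y).
by rewrite [RHS]mulrCA mulrA.
Qed.

Lemma cintegral_ft e f xi : e != 0 -> schwartz f ->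
  cintegral (fun y => expi (e * dot y xi) * f y) = ftl e (enum 'I_n) f xi.
Proof.
move=> e0 sf; rewrite (cintegralE _ xi) -(@avg_ftl _ _ _ xi)//; last exact: enum_uniq.
by congr (foldr _ _ _ _); apply/funext => y; rewrite /dot big_enum.
Qed.

Lemma dotC x y : dot x y = dot y x.
Proof. by rewrite /dot; apply: eq_bigr => j _; rewrite mulrC. Qed.

Lemma dotD x y z : dot x (y + z) = dot x y + dot x z.
Proof. by rewrite /dot -big_split; apply: eq_bigr => j _; rewrite mxE mulrDr. Qed.

Lemma dotN x y : dot x (- y) = - dot x y.
Proof. by rewrite /dot -sumrN; apply: eq_bigr => j _; rewrite mxE mulrN. Qed.

Lemma dot0 x : dot x 0 = 0.
Proof. by rewrite /dot big1// => j _; rewrite mxE mulr0. Qed.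

Definition ft e f := ftl e (enum 'I_n) f.

Lemma ftE e f xi : e != 0 -> schwartz f ->
  ft e f xi = cintegral (fun y => expi (e * dot y xi) * f y).
Proof. by move=> e0 sf; rewrite cintegral_ft. Qed.

Lemma ft_schwartz e f : e != 0 -> schwartz f -> schwartz (ft e f).
Proof. exact: ftl_schwartz. Qed.

Lemma ftP e c f g : e != 0 -> schwartz f -> schwartz g ->
  ft e (c *: f + g) = c *: ft e f + ft e g.
Proof. exact: ftlP. Qed.

(** Reduces facts on the integral, such as linearity and the vanishing of integrals of derivatives,
    to facts on the transform. *)
Lemma cintegralE0 e f : e != 0 -> schwartz f -> cintegral f = ft e f 0.
Proof.
move=> e0 sf; rewrite ftE//; congr cintegral; apply/funext => y.
by rewrite dot0 mulr0 expi0 mul1r.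
Qed.

Definition two_pi : R := 2 * pi.

Lemma two_pi_neq0 : two_pi != 0.
Proof. by rewrite mulf_neq0 ?pnatr_eq0// gt_eqF// pi_gt0. Qed.

Lemma ftlK e l f : uniq l -> e ^+ 2 = two_pi ^+ 2 -> schwartz f ->
  ftl (- e) l (ftl e l f) = f.
Proof.
move=> + e2 sf; have e0 : e != 0 by rewrite -sqrf_eq0 e2 sqrf_eq0 two_pi_neq0.
have Ne0 : - e != 0 by rewrite oppr_eq0.
elim: l => // i l IH /andP[il ul].
have s1 : schwartz (ftl e l f) by exact: ftl_schwartz.
rewrite !ftl_cons (ftl_fpart _ _ il)// fpartK ?IH//.
Qed.

Lemma ftK e f : e ^+ 2 = two_pi ^+ 2 -> schwartz f -> ft (- e) (ft e f) = f.
Proof. by apply: ftlK; exact: enum_uniq. Qed.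

Lemma pderiv_xmul f j k : k != j -> schwartz f -> pderiv j (xmul k f) = xmul k (pderiv j f).
Proof.
move=> kj sf; rewrite (pd_pderiv (pd_xmul k (schwartz_pd j sf))).
by rewrite (negbTE kj) scale0r addr0.
Qed.

Lemma pderiv_fpart e f j k : k != j -> schwartz f ->
  pderiv k (fpart e j f) = fpart e j (pderiv k f).
Proof.
move=> kj sf; apply: pd_pderiv; apply: pd_fpart => //; try exact: schwartz_crapid.
  by apply: schwartz_crapid; exact: schwartz_pderiv.
exact: schwartz_pd.
Qed.

Lemma pderiv_fpart_eq e f j : schwartz f ->
  pderiv j (fpart e j f) = fpart e j ((0 +i* e) *: xmul j f).
Proof. by move=> sf; apply: pd_pderiv; apply: pd_fpart_eq; exact: schwartz_crapid. Qed.

(** Write [f] as the inverse transform in the variable [i] of some [u]. For [j] different from [i],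
    the derivative in [j] passes through the transform, while the one in [i] becomes multiplication
    by the coordinate [i], and these two commute. *)
Lemma pderivC f i j : schwartz f -> pderiv i (pderiv j f) = pderiv j (pderiv i f).
Proof.
move=> sf; have [->//|ij] := eqVneq i j; have ji : j != i by rewrite eq_sym.
have t0 := two_pi_neq0; have Nt0 : - two_pi != 0 by rewrite oppr_eq0.
pose u := fpart two_pi i f; have su : schwartz u by exact: fpart_schwartz.
have -> : f = fpart (- two_pi) i u by rewrite /u fpartK.
have sdu : schwartz (pderiv j u) by exact: schwartz_pderiv.
have sxu : schwartz (xmul i u) by exact: schwartz_xmul.
rewrite (pderiv_fpart _ ji su) (pderiv_fpart_eq _ _ sdu) (pderiv_fpart_eq _ _ su).
rewrite (pderiv_fpart _ ji (schwartzZ _ sxu)).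
congr fpart; have -> : pderiv j ((0 +i* - two_pi) *: xmul i u) =
    (0 +i* - two_pi) *: pderiv j (xmul i u).
  apply: pd_pderiv; have := pdP (0 +i* - two_pi) (schwartz_pd j sxu) (@pd_cst _ _ j 0).
  by rewrite !addr0.
by rewrite pderiv_xmul.
Qed.

Lemma pderivP j c f g : schwartz f -> schwartz g ->
  pderiv j (c *: f + g) = c *: pderiv j f + pderiv j g.
Proof. by move=> sf sg; apply: pd_pderiv; apply: pdP; exact: schwartz_pd. Qed.

Lemma pderivZ j c f : schwartz f -> pderiv j (c *: f) = c *: pderiv j f.
Proof.
move=> sf; apply: pd_pderiv; have := pdP c (schwartz_pd j sf) (@pd_cst _ _ j 0).
by rewrite !addr0.
Qed.

Lemma xmulP j c f g : xmul j (c *: f + g) = c *: xmul j f + xmul j g.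
Proof. by apply/funext => x; rewrite /xmul !fn_linE mulrDr mulrCA. Qed.

Lemma xmulZ j c f : xmul j (c *: f) = c *: xmul j f.
Proof. by apply/funext => x; rewrite /xmul -[LHS]/(_ * (c * f x)) mulrCA. Qed.

Lemma ftl_xmul e l j f : e != 0 -> uniq l -> schwartz f ->
  ftl e l (xmul j f) =
    if j \in l then (0 +i* e)^-1 *: pderiv j (ftl e l f) else xmul j (ftl e l f).
Proof.
move=> e0 + sf; elim: l => // i l IH /andP[il ul].
have s1 : schwartz (ftl e l f) by exact: ftl_schwartz.
have c1 := schwartz_crapid s1.
rewrite !ftl_cons in_cons IH//.
have [ji|ji] /= := eqVneq j i.
  subst i; rewrite (negbTE il) pderiv_fpart_eq// fpartZ; last first.
    by apply: schwartz_crapid; exact: schwartz_xmul.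
  by rewrite scalerA mulVf ?imul_neq0// scale1r.
case: ifP => jl; last by rewrite xmul_fpart.
rewrite fpartZ; last by apply: schwartz_crapid; exact: schwartz_pderiv.
by rewrite pderiv_fpart.
Qed.

Lemma ftl_pderiv e l j f : e != 0 -> uniq l -> schwartz f ->
  ftl e l (pderiv j f) =
    if j \in l then (- (0 +i* e)) *: xmul j (ftl e l f) else pderiv j (ftl e l f).
Proof.
move=> e0 + sf; elim: l => // i l IH /andP[il ul].
have s1 : schwartz (ftl e l f) by exact: ftl_schwartz.
have c1 := schwartz_crapid s1; have sd := schwartz_pderiv j s1.
rewrite !ftl_cons in_cons IH//.
have [ji|ji] /= := eqVneq j i.
  subst i; rewrite (negbTE il); apply: fpart_pd => //; first exact: schwartz_crapid.
  exact: schwartz_pd.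
case: ifP => jl; last by rewrite pderiv_fpart.
rewrite fpartZ; last by apply: schwartz_crapid; exact: schwartz_xmul.
by rewrite xmul_fpart.
Qed.

Lemma ft_xmul e j f : e != 0 -> schwartz f ->
  ft e (xmul j f) = (0 +i* e)^-1 *: pderiv j (ft e f).
Proof. by move=> e0 sf; rewrite /ft ftl_xmul ?enum_uniq// mem_enum. Qed.

Lemma ft_pderiv e j f : e != 0 -> schwartz f ->
  ft e (pderiv j f) = (- (0 +i* e)) *: xmul j (ft e f).
Proof. by move=> e0 sf; rewrite /ft ftl_pderiv ?enum_uniq// mem_enum. Qed.

Lemma ftl_rev e l f : e != 0 -> uniq l -> schwartz f -> ftl e (rev l) f = ftl e l f.
Proof.
move=> e0 ul sf; elim: l ul => // i l IH /andP[il ul].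
rewrite rev_cons -cats1 /ftl foldr_cat -/(ftl e (rev l) (fpart e i f)).
by rewrite ftl_fpart ?mem_rev// IH.
Qed.

(** Both sides are transforms at frequency 0. Once the variable [j] is moved innermost, its
    transform at frequency 0 is a plain integral, to which [fpart_adj] applies. *)
Lemma cintegral_fpart_adj e j f g : e != 0 -> schwartz f -> schwartz g ->
  cintegral (pointwise (fpart e j f) g) = cintegral (pointwise f (fpart e j g)).
Proof.
move=> e0 sf sg.
have cf := schwartz_crapid sf; have cg := schwartz_crapid sg.
have s1 : schwartz (pointwise (fpart e j f) g).
  by apply: schwartz_pointwise => //; exact: fpart_schwartz.
have s2 : schwartz (pointwise f (fpart e j g)).
  by apply: schwartz_pointwise => //; exact: fpart_schwartz.
rewrite !(cintegralE0 e0)//.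
have [l1 [l2 El]] : exists l1 l2, enum 'I_n = l1 ++ j :: l2.
  by have /path.splitPr[l1 l2] : j \in enum 'I_n; [rewrite mem_enum|exists l1, l2].
have := enum_uniq 'I_n; rewrite /ft El cat_uniq /= negb_or.
move=> /and3P[u1 /andP[jl1 _] /andP[jl2 u2]].
have E h : schwartz h -> ftl e (l1 ++ j :: l2) h = ftl e (l1 ++ l2) (fpart e j h).
  move=> sh; rewrite /ftl !foldr_cat /= -!/(ftl e _ _); congr (ftl e l1 _).
  by rewrite -ftl_fpart.
rewrite !E//; apply: foldr_local => [i u v z|y Hy]; first exact: fpart_local.
have y0 : y 0 j = 0 by rewrite Hy ?mxE// mem_cat negb_or jl1.
rewrite /fpart y0 mulr0; have := fpart_adj e j y cf cg.
congr (intC _ = intC _); apply/funext => t; rewrite mul0r expi0 mul1r//.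
Qed.

(** The partial transforms cross one by one and arrive in reverse order, which [ftl_rev]
    corrects. *)
Lemma ft_adj e f g : e != 0 -> schwartz f -> schwartz g ->
  cintegral (pointwise (ft e f) g) = cintegral (pointwise f (ft e g)).
Proof.
move=> e0 sf sg; rewrite /ft -[in RHS]ftl_rev ?enum_uniq//.
elim: (enum 'I_n) g sg => // i l IH g sg.
rewrite rev_cons -cats1 [in RHS]/ftl foldr_cat -/(ftl e (rev l) (fpart e i g)).
rewrite ftl_cons cintegral_fpart_adj//; last exact: ftl_schwartz.
by rewrite IH//; exact: fpart_schwartz.
Qed.

End FourierTransform.

(** * The Weyl algebra acting on the Schwartz space *)

Definition schwartz_pred (R : realType) (n : nat) : {pred fn R n} := [pred f | `[< schwartz f >]].

Section SchwartzModule.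
Context (R : realType) (n : nat).

Lemma schwartz_predP (f : fn R n) : reflect (schwartz f) (f \in @schwartz_pred R n).
Proof. exact: asboolP. Qed.

Lemma schwartz_submod : submod_closed (@schwartz_pred R n).
Proof.
split; first by apply/schwartz_predP; exact: schwartz0.
by move=> c f g /schwartz_predP sf /schwartz_predP sg; apply/schwartz_predP; exact: schwartzL.
Qed.

HB.instance Definition _ := GRing.isSubmodClosed.Build R[i] (fn R n) (@schwartz_pred R n)
  schwartz_submod.

(** On arbitrary functions [pderiv] need not be linear. On this module the generators satisfy the
    Weyl relations ([weyl_repS]), so the general results on [weyl_rep] apply and are brought back
    along [val]. *)
Record schwartz_space := SchwartzFun { schwartz_val : fn R n; _ : schwartz_val \in @schwartz_pred R n }.
HB.instance Definition _ := [isSub for schwartz_val].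
HB.instance Definition _ := [Choice of schwartz_space by <:].
HB.instance Definition _ := [SubChoice_isSubLmodule of schwartz_space by <:].

End SchwartzModule.

Section Intertwining.
Context {C : comNzRingType} {n : nat} {V W : lmodType C}.

Lemma wact_intertwine (X D : 'I_n -> V -> V) (X' D' : 'I_n -> W -> W) (h : V -> W) T v :
  (forall a u w, h (a *: u + w) = a *: h u + h w) ->
  (forall j u, h (X j u) = X' j (h u)) -> (forall j u, h (D j u) = D' j (h u)) ->
  h (wact X D T v) = wact X' D' T (h v).
Proof.
move=> hl hX hD.
have it (f : 'I_n -> V -> V) (f' : 'I_n -> W -> W) e u :
    (forall j u, h (f j u) = f' j (h u)) -> h (iter_ops f e u) = iter_ops f' e (h u).
  move=> ff; rewrite /iter_ops; elim: (enum _) => //= j s <-.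
  by elim: (e j) => //= k <-.
have h0 : h 0 = 0 by have := hl (-1) 0 0; rewrite scaler0 addr0 scaleN1r addNr.
rewrite /wact; elim: (mpoly.msupp T) => [|m s IH]; first by rewrite !big_nil.
by rewrite !big_cons hl IH /wmon (it _ X') // (it _ D').
Qed.

Lemma wactv_linear (X D : 'I_n -> V -> V) T a u v : weyl_rep X D ->
  wact X D T (a *: u + v) = a *: wact X D T u + wact X D T v.
Proof.
move=> [Xl Dl _ _ _].
have it (f : 'I_n -> V -> V) e u' v' : (forall j a u v, f j (a *: u + v) = a *: f j u + f j v) ->
    iter_ops f e (a *: u' + v') = a *: iter_ops f e u' + iter_ops f e v'.
  move=> fl; rewrite /iter_ops; elim: (enum _) => //= j s ->.
  by elim: (e j) => //= k ->; rewrite fl.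
rewrite /wact scaler_sumr -big_split /=; apply: eq_bigr => m _.
by rewrite /wmon (it D)// (it X)// scalerDr !scalerA mulrC.
Qed.

End Intertwining.

(** The orbit map U -> U v is linear and turns left multiplication by [x j] and [d j] into their
    actions on V. *)
Lemma wact_wsubst (C : comNzRingType) (n : nat) (V : lmodType C) (X D : 'I_n -> V -> V)
    (x d : 'I_n -> weyl C n) T v : weyl_rep X D ->
  wact X D (wsubst x d T) v = wact (fun j => wact X D (x j)) (fun j => wact X D (d j)) T v.
Proof.
move=> XD.
transitivity (wact (fun j => wact X D (x j)) (fun j => wact X D (d j)) T (wact X D 1 v)); last first.
  by congr wact; exact: wact1.
apply: (@wact_intertwine C n (weyl C n) V _ _ _ _ (fun U => wact X D U v)).
- by move=> a U W; exact: wactP.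
- by move=> j U; rewrite wact_wmul// wact1.
- by move=> j U; rewrite wact_wmul// wact1.
Qed.

Section WeylActionSchwartz.
Context {R : realType} {n : nat}.
Implicit Types (f g : fn R n) (j k : 'I_n) (T U : weyl R[i] n).
Local Notation S := (schwartz_space R n).

Lemma sval_schwartz (u : S) : schwartz (val u).
Proof. exact/schwartz_predP/valP. Qed.

Definition mkS f (sf : schwartz f) : S := SchwartzFun (introT (schwartz_predP f) sf).

Definition xS j (u : S) : S := mkS (schwartz_xmul j (sval_schwartz u)).
Definition dS j (u : S) : S := mkS (schwartz_pderiv j (sval_schwartz u)).

Lemma valSP (a : R[i]) (u v : S) : val (a *: u + v) = a *: val u + val v.
Proof. by []. Qed.

Lemma weyl_repS : weyl_rep xS dS.
Proof.
split=> [j a u v|j a u v|i j v|i j v|i j v]; apply: val_inj.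
- exact: xmulP.
- by rewrite valSP; apply: pderivP; exact: sval_schwartz.
- by apply/funext => x; rewrite /= /xmul mulrCA.
- by apply: pderivC; exact: sval_schwartz.
- have sv := sval_schwartz v.
  by rewrite /= (pd_pderiv (pd_xmul j (schwartz_pd i sv))) eq_sym.
Qed.

Lemma val_wactS T u : val (wact xS dS T u) = fn_act T (val u).
Proof. exact: (@wact_intertwine _ _ S (fn R n) xS dS xmul pderiv val). Qed.

Lemma fn_act_schwartz T f : schwartz f -> schwartz (fn_act T f).
Proof. by move=> sf; rewrite -(val_wactS T (mkS sf)); exact: sval_schwartz. Qed.

Lemma fn_actvP T (c : R[i]) f g : schwartz f -> schwartz g ->
  fn_act T (c *: f + g) = c *: fn_act T f + fn_act T g.
Proof.
move=> sf sg; rewrite -(val_wactS T (mkS sf)) -(val_wactS T (mkS sg)) -valSP.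
by rewrite -wactv_linear ?val_wactS//; exact: weyl_repS.
Qed.

Lemma fn_actP (c : R[i]) T U f : fn_act (c *: T + U) f = c *: fn_act T f + fn_act U f.
Proof. exact: wactP. Qed.

Lemma fn_act1 f : fn_act 1 f = f.
Proof. exact: wact1. Qed.

Lemma fn_actZ (c : R[i]) T f : fn_act (c *: T) f = c *: fn_act T f.
Proof. exact: wactZ. Qed.

Lemma fn_actM T U f : schwartz f -> fn_act (T * U) f = fn_act T (fn_act U f).
Proof.
move=> sf; rewrite -(val_wactS U (mkS sf)) -!val_wactS.
by rewrite -wact_wmul ?val_wactS//; exact: weyl_repS.
Qed.

Lemma fn_act_x j f : schwartz f -> fn_act (wx j) f = xmul j f.
Proof.
by move=> sf; rewrite -(val_wactS _ (mkS sf)) wactx//; exact: weyl_repS.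
Qed.

Lemma fn_act_d j f : schwartz f -> fn_act (wd j) f = pderiv j f.
Proof.
by move=> sf; rewrite -(val_wactS _ (mkS sf)) wactd//; exact: weyl_repS.
Qed.

Lemma fn_act_D j f : schwartz f -> fn_act (wD j) f = itau^-1 *: pderiv j f.
Proof. by move=> sf; rewrite /wD fn_actZ fn_act_d. Qed.

(* Transport along any operator that maps the generators to elements of the Weyl algebra. *)
Lemma fn_act_transport (h : fn R n -> fn R n) (x d : 'I_n -> weyl R[i] n) T f :
  (forall g, schwartz g -> schwartz (h g)) ->
  (forall (a : R[i]) u v, schwartz u -> schwartz v -> h (a *: u + v) = a *: h u + h v) ->
  (forall j g, schwartz g -> h (xmul j g) = fn_act (x j) (h g)) ->
  (forall j g, schwartz g -> h (pderiv j g) = fn_act (d j) (h g)) ->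
  schwartz f -> h (fn_act T f) = fn_act (wsubst x d T) (h f).
Proof.
move=> hs hl hx hd sf.
pose hS (u : S) : S := mkS (hs _ (sval_schwartz u)).
have E : hS (wact xS dS T (mkS sf)) =
    wact (fun j => wact xS dS (x j)) (fun j => wact xS dS (d j)) T (hS (mkS sf)).
  apply: wact_intertwine.
  - by move=> a u v; apply: val_inj; rewrite /= hl//; exact: sval_schwartz.
  - move=> j u; apply: val_inj; rewrite val_wactS /= hx//; exact: sval_schwartz.
  - move=> j u; apply: val_inj; rewrite val_wactS /= hd//; exact: sval_schwartz.
have := congr1 val E; rewrite -wact_wsubst; last exact: weyl_repS.
by rewrite val_wactS /= val_wactS.
Qed.

Lemma fourierE f : schwartz f -> fourier f = ft two_pi f.
Proof.
by move=> sf; apply/funext => xi; rewrite ftE//; exact: two_pi_neq0.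
Qed.

Lemma two_piN_neq0 : - two_pi != 0 :> R.
Proof. by rewrite oppr_eq0 two_pi_neq0. Qed.

Lemma fourier_schwartz f : schwartz f -> schwartz (fourier f).
Proof. by move=> sf; rewrite fourierE//; apply: ft_schwartz => //; exact: two_pi_neq0. Qed.

Definition ifourier f := ft (- two_pi) f.

Lemma ifourier_schwartz f : schwartz f -> schwartz (ifourier f).
Proof. by move=> sf; apply: ft_schwartz => //; exact: two_piN_neq0. Qed.

Lemma fourierK f : schwartz f -> ifourier (fourier f) = f.
Proof. by move=> sf; rewrite fourierE// /ifourier ftK. Qed.

Lemma ifourierK f : schwartz f -> fourier (ifourier f) = f.
Proof.
move=> sf; rewrite fourierE; last exact: ifourier_schwartz.
by rewrite -[X in ft X]opprK /ifourier ftK// sqrrN.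
Qed.

Lemma imulN (a : R) : (0 +i* (- a) : R[i]) = - (0 +i* a).
Proof. by apply: complexP => /=; rewrite ?oppr0. Qed.

Lemma fourier_fn_act T f : schwartz f -> fourier (fn_act T f) = fn_act (hatf T) (fourier f).
Proof.
move=> sf; have t0 := @two_pi_neq0 R.
rewrite !fourierE//; last exact: fn_act_schwartz.
apply: fn_act_transport => //.
- by move=> g; exact: ft_schwartz.
- by move=> a u v; exact: ftP.
- by move=> j g sg; rewrite ft_xmul// fn_act_D//; exact: ft_schwartz.
- move=> j g sg; rewrite ft_pderiv// fn_actZ fn_act_x//; exact: ft_schwartz.
Qed.

Lemma ifourier_fn_act T f : schwartz f ->
  ifourier (fn_act T f) = fn_act (hatf_inv T) (ifourier f).
Proof.
move=> sf; have t0 := two_piN_neq0.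
apply: fn_act_transport => //.
- by move=> g; exact: ft_schwartz.
- by move=> a u v; exact: ftP.
- move=> j g sg; rewrite /ifourier ft_xmul// -[- wD j]scaleN1r fn_actZ fn_act_D; last exact: ft_schwartz.
  by rewrite imulN invrN scalerA mulN1r.
- by move=> j g sg; rewrite /ifourier ft_pderiv// fn_actZ fn_act_x ?imulN ?opprK//; exact: ft_schwartz.
Qed.

End WeylActionSchwartz.

(** * Plane waves, translations and convolution *)

Section Heisenberg.
Context {R : realType} {n : nat}.
Implicit Types (f g s t : fn R n) (j k : 'I_n) (x y xi : 'rV[R]_n) (a e : R).

Definition plane_wave a xi : fn R n := fun y => expi (a * dot xi y).

Lemma dot_upd xi x j (t : R) : dot xi (upd x j t) = xi 0 j * t + (dot xi x - xi 0 j * x 0 j).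
Proof.
have E (z : 'rV[R]_n) : dot xi z = xi 0 j * z 0 j + \sum_(k | k != j) xi 0 k * z 0 k.
  by rewrite /dot (bigD1 j).
rewrite !E upd_eq; set A := (\sum_(k | _) _); set B := (\sum_(k | _) _).
have -> : A = B by apply: eq_bigr => k kj; rewrite upd_neq.
by rewrite [X in X - _]addrC addrK.
Qed.

Lemma pd_plane_wave a xi j :
  pd j (plane_wave a xi) ((0 +i* (a * xi 0 j)) *: plane_wave a xi).
Proof.
apply/pd_sliceP => x t.
have E r : plane_wave a xi (upd x j r) =
    expi ((a * xi 0 j) * r + a * (dot xi x - xi 0 j * x 0 j)).
  by rewrite /plane_wave dot_upd mulrDr mulrA.
rewrite -[X in is_cderive _ _ _ X]/(_ * plane_wave a xi (upd x j t)) E.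
have -> : (fun r => plane_wave a xi (upd x j r)) = fun r : R =>
    expi ((a * xi 0 j) * r + a * (dot xi x - xi 0 j * x 0 j)).
  by apply/funext => r; rewrite E.
exact: is_cderive_expi.
Qed.

Lemma bdd_plane_wave a xi : bdd (plane_wave a xi).
Proof. by exists 1 => y; rewrite nrm_expi. Qed.

Lemma ck_plane_wave a xi m : ck cbdd m (plane_wave a xi).
Proof.
have cE : cbdd (plane_wave a xi).
  split; last exact: bdd_plane_wave.
  apply: cont_partials => j; exists ((0 +i* (a * xi 0 j)) *: plane_wave a xi).
    exact: pd_plane_wave.
  have := bdd_lin.2 (0 +i* (a * xi 0 j)) _ _ (bdd_plane_wave a xi) (bdd_lin (R := R) (n := n)).1.
  by rewrite addr0.
elim: m => [|m IH]; split => // j.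
exists ((0 +i* (a * xi 0 j)) *: plane_wave a xi); first exact: pd_plane_wave.
by apply: ckZ => //; exact: cbdd_lin.
Qed.

Definition hmod a xi s : fn R n := fun y => expi (a * dot xi y) * s y.

Lemma hmodE a xi s : hmod a xi s = pointwise s (plane_wave a xi).
Proof. by apply/funext => y; rewrite /hmod /pointwise mulrC. Qed.

Lemma modulateE xi s : modulate xi s = hmod two_pi xi s.
Proof. by []. Qed.

Lemma hmod_schwartz a xi s : schwartz s -> schwartz (hmod a xi s).
Proof. by rewrite hmodE => ss; apply: schwartz_mul => // m; exact: ck_plane_wave. Qed.

Lemma modulate_schwartz xi s : schwartz s -> schwartz (modulate xi s).
Proof. exact: hmod_schwartz. Qed.

Lemma pderiv_modulate xi j s : schwartz s -> pderiv j (modulate xi s) =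
  (itau * (xi 0 j)%:C) *: modulate xi s + modulate xi (pderiv j s).
Proof.
move=> ss; apply: pd_pderiv; rewrite !modulateE !hmodE.
have := pdM (schwartz_pd j ss) (pd_plane_wave two_pi xi j).
congr pd; rewrite addrC; congr (_ + _); apply/funext => y.
rewrite -[RHS]/(_ * (_ * _)) -[LHS]/(_ * (_ * _)) [RHS]mulrCA; congr (_ * (_ * _)).
by apply: complexP; rewrite ?(cReM, cImM) /= /two_pi; ring.
Qed.

Lemma xmul_modulate xi j s : xmul j (modulate xi s) = modulate xi (xmul j s).
Proof. by apply/funext => y; rewrite /xmul /modulate mulrCA. Qed.

Lemma ifourierE s y : schwartz s ->
  ifourier s y = cintegral (fun xi => expi (- two_pi * dot xi y) * s xi).
Proof. by move=> ss; rewrite /ifourier ftE// two_piN_neq0. Qed.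

(** Inversion, the shift being absorbed by the exponential kernel. Through it translates inherit the
    Schwartz property and their derivatives from modulation. *)
Lemma translateE x s : schwartz s -> translate x s = ifourier (modulate x (fourier s)).
Proof.
move=> ss; have sf := fourier_schwartz ss; apply/funext => y.
rewrite ifourierE; last exact: modulate_schwartz.
rewrite /translate -{1}(fourierK ss) ifourierE//; congr cintegral; apply/funext => xi.
rewrite /modulate [RHS]mulrA -expiD; congr (expi _ * _).
by rewrite dotD dotN [dot x xi]dotC mulrDr; congr (_ + _); rewrite mulrN mulNr opprK.
Qed.

Lemma translate_schwartz x s : schwartz s -> schwartz (translate x s).
Proof.
move=> ss; rewrite translateE//; apply: ifourier_schwartz; apply: modulate_schwartz.
exact: fourier_schwartz.
Qed.

Lemma pderiv_ft e j s : e != 0 -> schwartz s ->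
  pderiv j (ft e s) = (0 +i* e) *: ft e (xmul j s).
Proof. by move=> e0 ss; rewrite ft_xmul// scalerA divff ?scale1r// imul_neq0. Qed.

Lemma xmul_ft e j s : e != 0 -> schwartz s ->
  xmul j (ft e s) = (- (0 +i* e))^-1 *: ft e (pderiv j s).
Proof.
by move=> e0 ss; rewrite ft_pderiv// scalerA mulVf ?scale1r// oppr_eq0 imul_neq0.
Qed.

Lemma itau_neq0 : itau != 0 :> R[i].
Proof. exact: imul_neq0 two_pi_neq0. Qed.

Lemma pderiv_ifourier j s : schwartz s -> pderiv j (ifourier s) = (- itau) *: ifourier (xmul j s).
Proof. by move=> ss; rewrite /ifourier pderiv_ft ?imulN// two_piN_neq0. Qed.

Lemma xmul_ifourier j s : schwartz s -> xmul j (ifourier s) = itau^-1 *: ifourier (pderiv j s).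
Proof. by move=> ss; rewrite /ifourier xmul_ft ?imulN ?opprK// two_piN_neq0. Qed.

Lemma fourier_pderiv j s : schwartz s -> fourier (pderiv j s) = (- itau) *: xmul j (fourier s).
Proof.
move=> ss; rewrite !fourierE//; last exact: schwartz_pderiv.
by rewrite ft_pderiv// two_pi_neq0.
Qed.

Lemma fourier_xmul j s : schwartz s -> fourier (xmul j s) = itau^-1 *: pderiv j (fourier s).
Proof.
move=> ss; rewrite !fourierE//; last exact: schwartz_xmul.
by rewrite ft_xmul// two_pi_neq0.
Qed.

Lemma fourierZ (c : R[i]) s : schwartz s -> fourier (c *: s) = c *: fourier s.
Proof.
move=> ss; rewrite !fourierE//; last exact: schwartzZ.
by rewrite /ft ftlZ// two_pi_neq0.
Qed.

Lemma ifourierZ (c : R[i]) s : schwartz s -> ifourier (c *: s) = c *: ifourier s.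
Proof. by move=> ss; rewrite /ifourier /ft ftlZ// two_piN_neq0. Qed.

Lemma ifourierD s t : schwartz s -> schwartz t -> ifourier (s + t) = ifourier s + ifourier t.
Proof.
by move=> ss st; have := ftP 1 two_piN_neq0 ss st; rewrite !scale1r.
Qed.

Lemma modulateZ xi (c : R[i]) s : modulate xi (c *: s) = c *: modulate xi s.
Proof. by apply/funext => y; rewrite /modulate -[LHS]/(_ * (c * s y)) mulrCA. Qed.

Lemma translateZ x (c : R[i]) s : translate x (c *: s) = c *: translate x s.
Proof. by []. Qed.

Lemma pderiv_translate x j s : schwartz s ->
  pderiv j (translate x s) = translate x (pderiv j s).
Proof.
move=> ss; have sf := fourier_schwartz ss; have sm := modulate_schwartz x sf.
rewrite translateE// pderiv_ifourier// translateE; last exact: schwartz_pderiv.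
rewrite fourier_pderiv// modulateZ ifourierZ ?xmul_modulate//.
by apply: modulate_schwartz; exact: schwartz_xmul.
Qed.

Lemma xmul_translate x j s :
  xmul j (translate x s) = translate x (xmul j s) + (x 0 j)%:C *: translate x s.
Proof.
apply/funext => y; rewrite -[RHS]/(_ * _ + _ * _) /xmul /translate -mulrDl !mxE.
by rewrite -rmorphD subrK.
Qed.

(** By inversion, x -> t (y - x) is the transform of [w], the transform of [t] times a plane wave
    depending on y. Self-adjointness moves the transform from [w] to [s], and the plane wave is the
    kernel of the inverse transform. *)
Lemma convolutionE s t : schwartz s -> schwartz t ->
  convolution s t = ifourier (pointwise (fourier s) (fourier t)).
Proof.
move=> ss st; have t0 := @two_pi_neq0 R.
have sfs := fourier_schwartz ss; have sft := fourier_schwartz st.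
apply/funext => y.
pose w := hmod (- two_pi) y (fourier t).
have sw : schwartz w by exact: hmod_schwartz.
have E x : ft two_pi w x = t (y - x).
  rewrite ftE// -[in RHS](fourierK st) ifourierE//; congr cintegral; apply/funext => xi.
  rewrite /w /hmod mulrA -expiD; congr (expi _ * _).
  by rewrite dotD dotN [dot y xi]dotC mulrDr addrC; congr (_ + _); rewrite mulrNN.
have -> : convolution s t y = cintegral (pointwise s (ft two_pi w)).
  by congr cintegral; apply/funext => x; rewrite /pointwise E.
rewrite -ft_adj// -fourierE// ifourierE; last exact: schwartz_pointwise.
congr cintegral; apply/funext => xi.
by rewrite /pointwise /w /hmod mulrCA dotC.
Qed.

Lemma convolution_schwartz s t : schwartz s -> schwartz t -> schwartz (convolution s t).
Proof.
move=> ss st; rewrite convolutionE//; apply: ifourier_schwartz.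
by apply: schwartz_pointwise; exact: fourier_schwartz.
Qed.

Lemma pderiv_pointwise j s t : schwartz s -> schwartz t ->
  pderiv j (pointwise s t) = pointwise (pderiv j s) t + pointwise s (pderiv j t).
Proof. by move=> ss st; apply: pd_pderiv; apply: pdM; exact: schwartz_pd. Qed.

Lemma xmul_pointwise j s t : xmul j (pointwise s t) = pointwise (xmul j s) t.
Proof. by apply/funext => x; rewrite /xmul /pointwise mulrA. Qed.

Lemma pointwiseZl (c : R[i]) s t : pointwise (c *: s) t = c *: pointwise s t.
Proof. by apply/funext => x; rewrite /pointwise -[LHS]/((c * _) * _) -mulrA. Qed.

Lemma pointwiseZr (c : R[i]) s t : pointwise s (c *: t) = c *: pointwise s t.
Proof. by apply/funext => x; rewrite /pointwise -[LHS]/(_ * (c * _)) mulrCA. Qed.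

Lemma pderiv_convolution j s t : schwartz s -> schwartz t ->
  pderiv j (convolution s t) = convolution (pderiv j s) t.
Proof.
move=> ss st; have sds := schwartz_pderiv j ss.
have sfs := fourier_schwartz ss; have sft := fourier_schwartz st.
rewrite !convolutionE// pderiv_ifourier; last exact: schwartz_pointwise.
rewrite fourier_pderiv// pointwiseZl ifourierZ ?xmul_pointwise//.
by apply: schwartz_pointwise => //; exact: schwartz_xmul.
Qed.

Lemma xmul_convolution j s t : schwartz s -> schwartz t ->
  xmul j (convolution s t) = convolution (xmul j s) t + convolution s (xmul j t).
Proof.
move=> ss st; have sxs := schwartz_xmul j ss; have sxt := schwartz_xmul j st.
have sfs := fourier_schwartz ss; have sft := fourier_schwartz st.
have sdfs := schwartz_pderiv j sfs; have sdft := schwartz_pderiv j sft.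
rewrite !convolutionE// xmul_ifourier; last exact: schwartz_pointwise.
rewrite pderiv_pointwise// !fourier_xmul// pointwiseZl pointwiseZr.
rewrite !ifourierZ ?ifourierD ?scalerDr//; exact: schwartz_pointwise.
Qed.

End Heisenberg.

(** * The compatible Weyl action on a stable subspace *)

Section Compatibility.
Context {R : realType} {n : nat}.
Implicit Types (s t : fn R n) (A : set (fn R n)).

Lemma fourier_injective s t : schwartz s -> schwartz t -> fourier s = fourier t -> s = t.
Proof. by move=> ss st E; rewrite -(fourierK ss) E fourierK. Qed.

Lemma set_bij_fourier A : A `<=` schwartz -> (forall s, A s -> A (fourier s)) ->
  (forall s, A s -> A (ifourier s)) -> set_bij A A fourier.
Proof.
move=> AS AF AI; split.
- by move=> s As; exact: AF.
- move=> s t; rewrite !inE => As At; apply: fourier_injective; exact: AS.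
- by move=> s As; exists (ifourier s); [exact: AI|rewrite ifourierK//; exact: AS].
Qed.

Lemma inv_fourierE A s : A `<=` schwartz -> set_bij A A fourier -> A s ->
  inv_fourier A s = ifourier s.
Proof.
move=> AS [_ Finj Fsurj] As; have [u Au us] := Fsurj s As; rewrite -us.
rewrite fourierK; last exact: AS.
by rewrite /inv_fourier; apply: pinvKV; [exact: Finj|rewrite inE].
Qed.

(** The identities hold throughout the Schwartz space; only stability depends on [A]. The lemma thus
    serves both the full class and the holonomic one. *)
Lemma compatible_fn_act A : A `<=` schwartz ->
  linear_subspace A -> (forall T s, A s -> A (fn_act T s)) -> set_bij A A fourier ->
  compatible_weyl_action A fn_act.
Proof.
move=> AS Alin AT Abij; split.
- split.
  + exact: AT.
  + by move=> T c s t /AS ss /AS st; exact: fn_actvP.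
  + by move=> c T U s _; exact: fn_actP.
  + by move=> s _; exact: fn_act1.
  + by move=> T U s /AS ss; exact: fn_actM.
- move=> j k a s /AS ss.
  have sm := modulate_schwartz (a *: basis_vec j) ss.
  have st := translate_schwartz (a *: basis_vec k) ss.
  have st' := translate_schwartz (a *: basis_vec j) ss.
  have bE i l : (a *: basis_vec i : 'rV[R]_n) 0 l = (i == l)%:R * a.
    by rewrite !mxE eqxx /= eq_sym mulrC.
  split.
  + rewrite !fn_act_D// modulateZ pderiv_modulate// scalerDr addrK scalerA mulrA mulVf.
      rewrite mul1r bE rmorphM; congr (_ *: _); congr (_ * _).
      by rewrite rmorph_nat.
    exact: itau_neq0.
  + rewrite !fn_act_x// xmul_translate bE opprD addrA subrr add0r -scaleNr rmorphM.
    by rewrite rmorph_nat eq_sym.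
  + by rewrite !fn_act_x// xmul_modulate.
  + by rewrite !fn_act_D// pderiv_translate.
- move=> j s t /AS ss /AS st.
  have sp := schwartz_pointwise ss st; have sc := convolution_schwartz ss st.
  split.
  + by rewrite !fn_act_D// pderiv_pointwise// scalerDr pointwiseZl pointwiseZr.
  + rewrite !fn_act_D// pderiv_convolution//.
    have sd := schwartz_pderiv j ss.
    rewrite [in RHS]convolutionE//; last exact: schwartzZ.
    rewrite fourierZ// pointwiseZl ifourierZ -?convolutionE//.
    by apply: schwartz_pointwise; exact: fourier_schwartz.
  + by rewrite !fn_act_x// xmul_pointwise.
  + by rewrite !fn_act_x// xmul_convolution.
- move=> T s As; have ss := AS s As; split; first exact: fourier_fn_act.
  by rewrite !inv_fourierE//; [exact: ifourier_fn_act|exact: AT].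
Qed.

End Compatibility.

(** * Smooth functions of compact support *)

Section Bump.
Context {R : realType}.
Implicit Types (p q : {poly R}) (t u : R).

(* All derivatives of [exp (- 1 / t)], [t > 0], have this shape, [p] being evaluated at [1 / t]. *)
Definition flat p t : R := if 0 < t then p.[t^-1] * expR (- t^-1) else 0.

Lemma poly_expR_bound p : exists2 C, 0 <= C & forall u, 0 < u -> `|p.[u]| * expR (- u) <= C.
Proof.
(* From u^i <= i! exp u, term by term. *)
exists (\sum_(i < size p) `|p`_i| * i`!%:R) => [|u u0].
  by apply: sumr_ge0 => i _; rewrite mulr_ge0.
rewrite expRN -ler_pdivlMr ?invr_gt0 ?expR_gt0// invrK mulr_suml horner_coef.
apply: (le_trans (ler_norm_sum _ _ _)); apply: ler_sum => i _.
rewrite normrM -mulrA ler_wpM2l// normrX gtr0_norm//.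
case: (i : nat) => [|k]; first by rewrite expr0 fact0 mul1r -expR0 ler_expR ltW.
have := expR_ge1Dxn k (ltW u0); rewrite -ler_pdivrMl ?ltr0n ?fact_gt0// mulrC => h.
by apply: le_trans h; rewrite lerDr.
Qed.

Lemma flat_bound p : exists2 C, 0 <= C & forall t, `|flat p t| <= C.
Proof.
have [C C0 pC] := poly_expR_bound p; exists C => // t; rewrite /flat; case: ifP => t0.
  by rewrite normrM (gtr0_norm (expR_gt0 _)) pC// invr_gt0.
by rewrite normr0.
Qed.

Lemma flat_sqr p t : flat p t = t ^+ 2 * flat ('X^2 * p) t.
Proof.
rewrite /flat; case: ifP => t0; last by rewrite mulr0.
have -> : ('X^2 * p).[t^-1] = t ^- 2 * p.[t^-1] by rewrite hornerM hornerXn exprVn.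
by rewrite !mulrA divff ?mul1r// expf_neq0// gt_eqF.
Qed.

Lemma is_derive_near (f g : R -> R) t l : (\forall u \near t, f u = g u) ->
  is_derive t (1 : R) g l -> is_derive t (1 : R) f l.
Proof.
move=> fg gl; apply: near_eq_is_derive gl.
by apply: filterS fg => u ->.
Qed.

Lemma is_derive_quad (f : R -> R) C : (forall t, `|f t| <= C * t ^+ 2) ->
  is_derive (0 : R) (1 : R) f 0.
Proof.
move=> fC; have C0 : 0 <= C by have := fC 1; rewrite expr1n mulr1; exact: le_trans.
have f0 : f 0 = 0.
  by apply/eqP; rewrite -normr_le0; have := fC 0; rewrite expr0n mulr0.
have H : (fun h : R => h^-1 *: ((f \o shift 0) (h *: (1 : R)) - f 0)) @ 0^' --> (0 : R).
  apply/cvgr0Pnorm_le => e e0.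
  have e1 : 0 < e / (C + 1) by rewrite divr_gt0// ltr_wpDl.
  near=> h.
  have hE : h *: (1 : R) = h by rewrite /GRing.scale /= mulr1.
  rewrite /= hE addr0 f0 subr0 normrZ normfV.
  have h0 : h != 0 by near: h; exact: nbhs_dnbhs_neq.
  rewrite ler_pdivrMl ?normr_gt0// (le_trans (fC h))// -real_normK ?num_real//.
  rewrite expr2 mulrA mulrC ler_wpM2l//.
  have : `|h| <= e / (C + 1).
    by near: h; apply: nbhs_dnbhs; exact: (@nbhs0_le R R^o _ e1).
  rewrite ler_pdivlMr ?ltr_wpDl// mulrDr mulr1 mulrC => h1.
  by apply: le_trans h1; rewrite lerDl.
by split; [apply/cvg_ex; exists 0|exact: cvg_lim H].
Unshelve. all: by end_near. Qed.

(** For positive t this is the chain rule through 1 / t. At 0, [flat_sqr] and [flat_bound] make the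
    function O(t^2), so the derivative vanishes. *)
Lemma is_derive_flat p t :
  is_derive t (1 : R) (flat p) (flat ('X^2 * (p - p^`())) t).
Proof.
have [t0|t0|t0] := ltrgtP 0 t.
- have d1 := is_deriveV (f := @id R) (lt0r_neq0 t0) (is_derive_id t (1 : R)).
  have d2 : is_derive t^-1 (1 : R) (fun u => p.[u] * expR (- u))
      ((p^`()).[t^-1] * expR (- t^-1) - p.[t^-1] * expR (- t^-1)).
    have e1 := is_derive1_comp (is_derive_expR _) (is_deriveN (is_derive_id t^-1 (1 : R))).
    apply: (is_derive_eq (is_deriveM (is_derive_poly p t^-1) e1)).
    by rewrite /GRing.scale /=; ring.
  apply: (@is_derive_near _ (fun u => p.[u^-1] * expR (- u^-1))).
    near=> u; rewrite /flat ifT//; near: u; exact: lt_nbhsr.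
  apply: (is_derive_eq (is_derive1_comp d2 d1)).
  rewrite /flat t0 hornerM hornerXn hornerD hornerN /GRing.scale /= exprVn; ring.
- apply: (@is_derive_near _ (fun=> 0)).
    near=> u; rewrite /flat ifF//; apply/negbTE; rewrite -leNgt; apply: ltW; near: u.
    exact: lt_nbhsl.
  by rewrite /flat ltNge (ltW t0) /=; exact: is_derive_cst.
subst t; have [C C0 HC] := flat_bound ('X^2 * p).
have -> : flat ('X^2 * (p - p^`())) 0 = 0 by rewrite /flat ltxx.
apply: (@is_derive_quad _ C) => t; rewrite flat_sqr normrM ger0_norm ?sqr_ge0// mulrC.
by rewrite ler_wpM2r ?sqr_ge0.
Unshelve. all: by end_near. Qed.

Lemma continuous_flat p : continuous (flat p).
Proof.
move=> t; apply: differentiable_continuous; apply/derivable1_diffP.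
by have [] := is_derive_flat p t.
Qed.

Lemma flat1_gt0 t : 0 < t -> 0 < flat 1 t.
Proof. by move=> t0; rewrite /flat t0 hornerC mul1r expR_gt0. Qed.

Lemma flat_ge0 t : 0 <= flat 1 t.
Proof. by have [t0|t0] := ltP 0 t; [exact/ltW/flat1_gt0|rewrite /flat ltNge t0]. Qed.

Lemma flat_le0 p t : t <= 0 -> flat p t = 0.
Proof. by move=> t0; rewrite /flat ltNge t0. Qed.

End Bump.

Section BumpFunctions.
Context {R : realType} {n : nat}.
Implicit Types (f g s : fn R n) (j k : 'I_n) (x y c : 'rV[R]_n) (p : {poly R}) (a b : R).

Definition flatx p a b j : fn R n := fun x => (flat p (a * x 0 j + b))%:C.

Lemma pd_flatx p a b j k : pd k (flatx p a b j)
  (((j == k)%:R * a)%:C *: flatx ('X^2 * (p - p^`())) a b j).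
Proof.
apply/pd_sliceP => x t; rewrite -[X in is_cderive _ _ _ X]/(_%:C * _%:C) -rmorphM updE.
apply: is_cderive_real; under eq_fun do rewrite updE.
case: (eqVneq j k) => _; last by rewrite !mul0r; exact: is_derive_cst.
have d := is_deriveD (is_deriveZ a (is_derive_id t (1 : R))) (is_derive_cst b t 1).
apply: (is_derive_eq (is_derive1_comp (is_derive_flat p _) d)).
by rewrite /GRing.scale /= mulr1 addr0 mul1r mulrC.
Qed.

Lemma bdd_flatx p a b j : bdd (flatx p a b j).
Proof. by have [C _ H] := flat_bound p; exists C => x; rewrite nrm_real. Qed.

Lemma bddZ (r : R[i]) f : bdd f -> bdd (r *: f).
Proof. by move=> bf; have := bdd_lin.2 r f 0 bf bdd_lin.1; rewrite addr0. Qed.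

Lemma ck_flatx m p a b j : ck cbdd m (flatx p a b j).
Proof.
elim: m p => [|m IH] p; split => //; try split; try exact: bdd_flatx.
- apply: cont_partials => k; exists (((j == k)%:R * a)%:C *: flatx ('X^2 * (p - p^`())) a b j).
    exact: pd_flatx.
  by apply: bddZ; exact: bdd_flatx.
- apply: cont_partials => k; exists (((j == k)%:R * a)%:C *: flatx ('X^2 * (p - p^`())) a b j).
    exact: pd_flatx.
  by apply: bddZ; exact: bdd_flatx.
- move=> k; exists (((j == k)%:R * a)%:C *: flatx ('X^2 * (p - p^`())) a b j).
    exact: pd_flatx.
  by apply: ckZ => //; exact: cbdd_lin.
Qed.

Lemma ck_cst m (r : R[i]) : ck cbdd m ((fun=> r) : fn R n).
Proof.
have cr : cbdd ((fun=> r) : fn R n).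
  split; last by exists (nrm r).
  by split; exact: continuous_cst.
case: m => [|m]; split => // j; exists 0; first exact: pd_cst.
by apply: ck0; exact: cbdd_lin.
Qed.

Lemma ck_prod m (F : 'I_n -> fn R n) (l : seq 'I_n) : (forall j, ck cbdd m (F j)) ->
  ck cbdd m (fun x => \prod_(j <- l) F j x).
Proof.
move=> FP; elim: l => [|j l IH].
  by under [X in ck _ _ X]eq_fun do rewrite big_nil; exact: ck_cst.
under [X in ck _ _ X]eq_fun do rewrite big_cons.
by apply: (ckM cbdd_lin cbdd_mul (FP j) IH).
Qed.

(** The factor of index j is positive exactly when |x_j - c_j| < 1, and zero otherwise. *)
Definition bump_real c x : R :=
  \prod_j (flat 1 (1 * x 0 j + (1 - c 0 j)) * flat 1 (- 1 * x 0 j + (1 + c 0 j))).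

Definition bumpfn c : fn R n := fun x => (bump_real c x)%:C.

Lemma ck_bump c m : ck cbdd m (bumpfn c).
Proof.
have -> : bumpfn c = fun x => \prod_j (pointwise (flatx 1 1 (1 - c 0 j) j)
    (flatx 1 (- 1) (1 + c 0 j) j)) x.
  apply/funext => x; rewrite /bumpfn /bump_real rmorph_prod; apply: eq_bigr => j _.
  by rewrite rmorphM.
by apply: ck_prod => j; apply: (ckM cbdd_lin cbdd_mul); exact: ck_flatx.
Qed.

Lemma bump_ge0 c x : 0 <= bump_real c x.
Proof. by apply: prodr_ge0 => j _; rewrite mulr_ge0// flat_ge0. Qed.

Lemma bump_gt0 c : 0 < bump_real c c.
Proof.
apply: prodr_gt0 => j _; rewrite mulr_gt0// flat1_gt0//.
  by rewrite mul1r addrC subrK ltr01.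
by rewrite mulN1r addrC addrK ltr01.
Qed.

Lemma bump_supp c x : bump_real c x != 0 -> forall j, `|x 0 j - c 0 j| <= 1.
Proof.
move=> /prodf_neq0 H j; have := H j isT; rewrite mulf_eq0 negb_or => /andP[h1 h2].
rewrite ler_norml; apply/andP; split; rewrite leNgt; apply/negP => h.
  by move: h1; rewrite flat_le0 ?eqxx//; lra.
by move: h2; rewrite flat_le0 ?eqxx//; lra.
Qed.

Lemma compact_box c (r : R) : compact [set x : 'rV[R]_n | forall j, `|x 0 j - c 0 j| <= r].
Proof.
have := @rV_compact R n (fun j => `[c 0 j - r, c 0 j + r]%classic) (fun j => @segment_compact _ _ _).
congr compact; apply/seteqP; split => x /= H j; have := H j; rewrite /= in_itv /= ler_norml.
  by move=> /andP[h1 h2]; apply/andP; split; lra.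
by move=> /andP[h1 h2]; apply/andP; split; lra.
Qed.

Lemma compact_support_box f c (r : R) : (forall x, f x != 0 -> forall j, `|x 0 j - c 0 j| <= r) ->
  compact (closure [set x | f x != 0]).
Proof.
move=> H; have cK := @compact_box c r.
have cb := compact_closed (@norm_hausdorff _ _) cK.
apply: (subclosed_compact (@closed_closure _ _) cK).
by move: cb => /closure_id ->; apply: closureS => x; exact: H.
Qed.

End BumpFunctions.

(** * Test functions, and Schwartz functions as distributions *)

Section TestFunctions.
Context {R : realType} {n : nat}.
Implicit Types (f g s phi : fn R n) (j k : 'I_n) (x y c : 'rV[R]_n).

Definition conj_fn f : fn R n := fun x => ((f x)^* )%C.

Lemma pd_conj j f g : pd j f g -> pd j (conj_fn f) (conj_fn g).
Proof.
move=> fg x; have [d1 d2] := fg x; split.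
  have -> : (fun y => complex.Re (conj_fn f y)) = (fun y => complex.Re (f y)).
    by apply/funext => y; rewrite /conj_fn; case: (f y).
  by rewrite /conj_fn; case: (g x) d1.
have -> : (fun y => complex.Im (conj_fn f y)) = (fun y => - complex.Im (f y)).
  by apply/funext => y; rewrite /conj_fn; case: (f y).
rewrite (_ : complex.Im (conj_fn g x) = - complex.Im (g x)).
  exact: is_deriveN.
by rewrite /conj_fn; case: (g x).
Qed.

Lemma cont_conj f : cont f -> cont (conj_fn f).
Proof.
move=> [c1 c2]; split.
  by rewrite (_ : re_fn _ = re_fn f)//; apply/funext => y; rewrite /re_fn /conj_fn; case: (f y).
rewrite (_ : im_fn _ = (fun x => 0 - im_fn f x)).
  by apply: continuous_sub => //; exact: continuous_cst.
by apply/funext => y; rewrite /im_fn /conj_fn; case: (f y) => a b /=; rewrite sub0r.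
Qed.

Lemma ck_cont_conj m f : ck cont m f -> ck cont m (conj_fn f).
Proof.
elim: m f => [|m IH] f [cf Hf]; split=> //; try exact: cont_conj.
by move=> j; have [g fg /IH] := Hf j; exists (conj_fn g) => //; exact: pd_conj.
Qed.

Lemma schwartz_smooth f : schwartz f -> smooth f.
Proof. by case. Qed.

Lemma test_conj_bump s c : schwartz s -> test_function (pointwise (conj_fn s) (bumpfn c)).
Proof.
move=> /schwartz_smooth/smoothP ss; split.
  apply/smoothP => m; apply: (ckM cont_lin cont_mul); first exact: ck_cont_conj.
  by apply: ck_sub (@ck_bump _ _ c m) => g [].
apply: (@compact_support_box _ _ _ c 1) => x.
rewrite /pointwise mulf_eq0 negb_or => /andP[_].
rewrite /bumpfn eq_complex /= eqxx andbT; exact: bump_supp.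
Qed.

Lemma cont_compact_bdd f (K : set 'rV[R]_n) : compact K -> cont f ->
  (forall x, ~ K x -> f x = 0) -> bdd f.
Proof.
move=> cK [c1 c2] f0.
have B (h : 'rV[R]_n -> R) : continuous h -> exists M, forall x, K x -> `|h x| <= M.
  move=> ch; have /compact_bounded[M [_ HM]] := continuous_compact (continuous_subspaceT ch) cK.
  exists (M + 1) => x Kx; apply: (HM (M + 1)); first by rewrite ltrDl.
  by exists x.
have [M HM] := B _ c1; have [N HN] := B _ c2; exists (`|M| + `|N|) => x.
have [Kx|nKx] := pselect (K x); last by rewrite f0// nrm0 addr_ge0.
apply: (le_trans (nrm_le _)); apply: lerD.
  exact: le_trans (HM x Kx) (ler_norm _).
exact: le_trans (HN x Kx) (ler_norm _).
Qed.

Lemma pd_local j f g (K : set 'rV[R]_n) : closed K -> (forall x, ~ K x -> f x = 0) ->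
  pd j f g -> forall x, ~ K x -> g x = 0.
Proof.
move=> clK f0 fg x nKx.
have nb : \forall y \near x, f y = 0.
  have : nbhs x (~` K) by apply: open_nbhs_nbhs; split => //; exact: closed_openC.
  by apply: filterS => y; exact: f0.
have z : is_cderive x (basis_vec j) f 0.
  have z0 : is_derive x (basis_vec j) (fun=> 0 : R) 0 by exact: is_derive_cst.
  by split; apply: near_eq_is_derive z0; apply: filterS nb => y ->.
exact: is_cderive_unique (fg x) z.
Qed.

(** All derivatives vanish off the compact support, where polynomial multiples are bounded by
    continuity. *)
Lemma test_schwartz phi : test_function phi -> schwartz phi.
Proof.
move=> [/smoothP sp cK]; set K := closure _ in cK.
have clK : closed K by exact: closed_closure.
have f0 x : ~ K x -> phi x = 0.
  move=> nKx; apply/eqP; apply: contrapT => /negP px; apply: nKx.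
  exact: subset_closure.
have cr f : cont f -> (forall x, ~ K x -> f x = 0) -> crapid f.
  move=> cf fK; split=> // l; apply: (cont_compact_bdd cK).
    by elim: l => //= j l; exact: cont_xmul.
  by move=> x nKx; rewrite xmulsE fK ?mulr0.
suff key m f : (forall x, ~ K x -> f x = 0) -> ck cont m f -> ck crapid m f.
  by apply/schwartzP => m; apply: key.
elim: m f => [|m IH] f fK [cf Hf]; split => //; try exact: cr.
move=> j; have [g fg cg] := Hf j; exists g => //.
by apply: IH => //; exact: pd_local clK fK fg.
Qed.

Lemma test_pderiv j phi : test_function phi -> test_function (pderiv j phi).
Proof.
move=> tp; have sp := test_schwartz tp; have [_ cK] := tp.
split; first by apply: schwartz_smooth; exact: schwartz_pderiv.
have clK := @closed_closure _ [set x | phi x != 0].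
apply: (subclosed_compact (@closed_closure _ _) cK).
rewrite [X in _ `<=` X]((closure_id _).1 clK); apply: closureS => x /= px.
apply: contrapT => nKx; move/eqP: px; apply.
apply: (pd_local clK _ (schwartz_pd j sp)) => // y nKy.
apply/eqP; apply: contrapT => /negP py; apply: nKy.
exact: subset_closure.
Qed.

Lemma test_xmul j phi : test_function phi -> test_function (xmul j phi).
Proof.
move=> tp; have sp := test_schwartz tp; have [_ cK] := tp.
split; first by apply: schwartz_smooth; exact: schwartz_xmul.
apply: (subclosed_compact (@closed_closure _ _) cK); apply: closureS => x /=.
by rewrite /xmul mulf_eq0 negb_or => /andP[].
Qed.

Lemma cintegralP (a : R[i]) f g : schwartz f -> schwartz g ->
  cintegral (a *: f + g) = a * cintegral f + cintegral g.
Proof.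
move=> sf sg; have t0 := @two_pi_neq0 R.
rewrite !(cintegralE0 t0)//; last exact: schwartzL.
by rewrite ftP.
Qed.

Lemma cintegral_pderiv j f : schwartz f -> cintegral (pderiv j f) = 0.
Proof.
move=> sf; rewrite (cintegralE0 (@two_pi_neq0 R)); last exact: schwartz_pderiv.
by rewrite ft_pderiv ?two_pi_neq0// -[LHS]/(_ * (_ * _)) mxE mul0r mulr0.
Qed.

(** Equality is asked on test functions only, because the values of a distribution elsewhere are
    arbitrary. *)
Definition represents (u : fn R n -> R[i]^o) f :=
  schwartz f /\ forall phi, test_function phi -> u phi = distribution_of f phi.

Lemma distribution_ofP (a : R[i]) f g phi : schwartz f -> schwartz g -> test_function phi ->
  distribution_of (a *: f + g) phi = a * distribution_of f phi + distribution_of g phi.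
Proof.
move=> sf sg /test_schwartz sp; rewrite /distribution_of.
rewrite -cintegralP; do ?exact: schwartz_pointwise.
congr cintegral; apply/funext => x; rewrite [LHS]/pointwise fn_linE mulrDl.
by rewrite -mulrA.
Qed.

Lemma represents_xmul j u f : represents u f ->
  represents (fun phi => u (xmul j phi)) (xmul j f).
Proof.
move=> [sf uf]; split; first exact: schwartz_xmul.
move=> phi tp; rewrite uf; last exact: test_xmul.
by congr cintegral; apply/funext => x; rewrite /pointwise /xmul mulrA [f x * _]mulrC.
Qed.

(** Integration by parts: the derivative of the product of [f] with a test function integrates to
    zero. *)
Lemma represents_pderiv j u f : represents u f ->
  represents (fun phi => - u (pderiv j phi)) (pderiv j f).
Proof.
move=> [sf uf]; split; first exact: schwartz_pderiv.
move=> phi tp; have sp := test_schwartz tp.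
rewrite uf; last exact: test_pderiv.
have sd := schwartz_pderiv j sf; have sdp := schwartz_pderiv j sp.
have := cintegral_pderiv j (schwartz_pointwise sf sp); rewrite pderiv_pointwise//.
rewrite -[X in cintegral (X + _)]scale1r cintegralP; do ?exact: schwartz_pointwise.
by rewrite mul1r => /eqP; rewrite addr_eq0 => /eqP.
Qed.

Lemma represents_distr_act T u f : represents u f ->
  represents (distr_act T u) (fn_act T f).
Proof.
move=> uf; have it (O : 'I_n -> (fn R n -> R[i]^o) -> (fn R n -> R[i]^o)) O' e w h :
    (forall j w h, represents w h -> represents (O j w) (O' j h)) ->
    represents w h -> represents (iter_ops O e w) (iter_ops O' e h).
  move=> HO wh; rewrite /iter_ops; elim: (enum _) => //= j l IH.
  by elim: (e j) => //= k; exact: HO.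
rewrite /distr_act /fn_act /wact; elim: (mpoly.msupp T) => [|m l IH].
  rewrite !big_nil; split; first exact: schwartz0.
  move=> phi tp; have := distribution_ofP (-1) (schwartz0 (R := R) (n := n)) schwartz0 tp.
  by rewrite scaler0 addr0 mulN1r addNr.
rewrite !big_cons.
have mm : represents (wmon (fun j u phi => u (xmul j phi)) (fun j u phi => - u (pderiv j phi)) m u)
    (wmon xmul pderiv m f).
  by apply: (it) => [j w h|]; [exact: represents_xmul|apply: (it) => // j w h; exact: represents_pderiv].
have [s1 h1] := mm; have [s2 h2] := IH; split; first exact: schwartzL.
by move=> phi tp; rewrite distribution_ofP// -h1// -h2.
Qed.

End TestFunctions.

(** * Positivity and bounds of integrals; the embedding into distributions is injective *)

Section Averages.
Context {R : realType} {n : nat}.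
Implicit Types (f g s phi : fn R n) (j k : 'I_n) (x y c : 'rV[R]_n) (l : seq 'I_n).

Definition zero_on l x : 'rV[R]_n := \row_k (if k \in l then 0 else x 0 k).

Lemma avg_indep l f x y : (forall k, k \notin l -> x 0 k = y 0 k) ->
  foldr avgC f l x = foldr avgC f l y.
Proof.
elim: l x y => [|j l IH] x y H /=; first by congr f; apply/rowP => k; exact: H.
congr intC; apply/funext => t; apply: IH => k kl; rewrite !updE.
by have [//|kj] := eqVneq k j; apply: H; rewrite in_cons negb_or kj.
Qed.

Lemma avg_zero_on l f x : uniq l -> schwartz f ->
  foldr avgC f l x = ftl two_pi l f (zero_on l x).
Proof.
move=> ul sf; rewrite (@avg_indep _ _ _ (zero_on l x)); last first.
  by move=> k kl; rewrite mxE (negbTE kl).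
rewrite -(@avg_ftl _ _ _ _ _ 0)//; last first.
- by move=> j jl; rewrite !mxE jl.
- exact: two_pi_neq0.
congr (foldr _ _ _ _); apply/funext => y.
by rewrite big1 ?mulr0 ?expi0 ?mul1r// => j _; rewrite mxE mulr0.
Qed.

Lemma avg_slice_cdecays l j f x : uniq l -> j \notin l -> schwartz f ->
  cdecays (fun t => foldr avgC f l (upd x j t)).
Proof.
move=> ul jl sf.
have E t : foldr avgC f l (upd x j t) = ftl two_pi l f (upd (zero_on l x) j t).
  rewrite avg_zero_on//; congr (ftl _ _ _ _); apply/rowP => k.
  by rewrite mxE !updE mxE; have [kl|//] := boolP (k \in l); case: eqVneq => // kj; rewrite -kj kl in jl.
under eq_fun do rewrite E.
have := slice_cdecays j (zero_on l x) 0
  (schwartz_crapid (ftl_schwartz l (@two_pi_neq0 R) sf)).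
by congr cdecays; apply/funext => t; rewrite mul0r expi0 mul1r.
Qed.

Lemma intR_gt0 (g : R -> R) a : decays g -> (forall t, 0 <= g t) -> 0 < g a -> 0 < intR g.
Proof.
move=> dg g0 ga; have [cg _] := dg.
have ga2 : g a / 2 < g a by rewrite ltr_pdivrMr// mulr_natr mulr2n ltrDl.
have : nbhs a (g @^-1` [set u | g a / 2 < u]) by apply: cg; exact: lt_nbhsr ga2.
move=> /nbhs_ballP[e /= e0 He].
pose r := a + e / 2; pose b := g a / 2.
have b0 : 0 < b by rewrite divr_gt0.
have He' t : `[a, r]%classic t -> b <= g t.
  rewrite /= in_itv /= => /andP[at_ te]; apply/ltW/He; rewrite /ball /= ltr_norml.
  by apply/andP; split; move: te; rewrite /r; lra.
apply: (@lt_le_trans _ _ (b * (e / 2))); first by rewrite mulr_gt0// divr_gt0.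
have Ig := decays_integrable dg.
rewrite -lee_fin /intR /Rintegral fineK; last exact: integrable_fin_num.
have mI : measurable `[a, r]%classic by exact: measurable_itv.
have mg : measurable_fun setT (fun t => (g t)%:E).
  by apply/measurable_EFinP; exact: continuous_measurable_fun.
apply: (@le_trans _ _ (\int[lebesgue_measure]_(t in `[a, r]) (g t)%:E)%E); last first.
  apply: ge0_subset_integral => //.
  by move=> t _; rewrite lee_fin.
apply: (@le_trans _ _ (\int[lebesgue_measure]_(t in `[a, r]) b%:E)%E).
  rewrite integral_cst//= lebesgue_measure_itv /= lte_fin ltrDl divr_gt0//.
  by rewrite -EFinB -EFinM lee_fin /r addrAC subrr add0r.
apply: ge0_le_integral => //.
- by move=> t _; rewrite lee_fin ltW.
- exact: measurable_funTS.
Qed.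

Lemma avg_ge0 l f : uniq l -> schwartz f -> (forall x, 0 <= complex.Re (f x)) ->
  (forall x, 0 <= complex.Re (foldr avgC f l x)) /\
  (forall x, 0 < complex.Re (f x) -> 0 < complex.Re (foldr avgC f l x)).
Proof.
move=> ul sf f0; elim: l ul => [//|j l IH /= /andP[jl ul]].
have [h1 h2] := IH ul; split => x.
  by apply: Rintegral_ge0 => t _.
move=> fx; have [dec _] := avg_slice_cdecays x ul jl sf.
apply: (intR_gt0 dec (a := x 0 j)) => //.
by rewrite upd_id; exact: h2.
Qed.

Lemma cintegral_gt0 f x : schwartz f -> (forall x, 0 <= complex.Re (f x)) ->
  0 < complex.Re (f x) -> cintegral f != 0.
Proof.
move=> sf f0 fx; have [_ /(_ x fx)] := avg_ge0 (enum_uniq 'I_n) sf f0.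
by rewrite -cintegralE; apply: contraTneq => ->; rewrite ltxx.
Qed.

(** If [s c] is nonzero, pairing [s] with its conjugate times a bump at [c] integrates |s|^2 times
    the bump, which is nonnegative and positive at [c]. *)
Lemma distribution_of_eq0 s : schwartz s ->
  (forall phi, test_function phi -> distribution_of s phi = 0) -> s = 0.
Proof.
move=> ss H; apply/funext => c; apply/eqP; apply: contrapT => /negP sc.
have tp := test_conj_bump c ss; have := H _ tp.
apply/eqP; apply: (@cintegral_gt0 _ c).
- by apply: schwartz_pointwise => //; exact: test_schwartz.
- move=> x; rewrite /pointwise /conj_fn /bumpfn mulrA.
  rewrite cReM /= mulr0 subr0 mulr_ge0 ?bump_ge0//.
  by case: (s x) => a b /=; rewrite mulrN opprK addr_ge0// -expr2 sqr_ge0.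
- rewrite /pointwise /conj_fn /bumpfn mulrA cReM /= mulr0 subr0 mulr_gt0 ?bump_gt0//.
  move: sc; case: (s c) => a b /=; rewrite eq_complex /= negb_and mulrN opprK -!expr2.
  move=> /orP[a0|b0]; first by rewrite ltr_wpDr ?sqr_ge0// exprn_even_gt0.
  by rewrite ltr_wpDl ?sqr_ge0// exprn_even_gt0.
Qed.

(** The transposed action on the distribution of [s] gives the distribution of T s, and a Schwartz
    function is determined by its distribution. From here on distributions are replaced by
    functions. *)
Lemma annihilatorE s : schwartz s -> annihilator (distribution_of s) = [set T | fn_act T s = 0].
Proof.
move=> ss; apply/seteqP; split => T /=.
  move=> HT; apply: distribution_of_eq0; first exact: fn_act_schwartz.
  move=> phi tp; have [_ <-//] := @represents_distr_act _ _ T (distribution_of s) s (conj ss (fun _ _ => erefl)).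
  exact: HT.
move=> HT phi tp.
have [_ ->//] := @represents_distr_act _ _ T (distribution_of s) s (conj ss (fun _ _ => erefl)).
have := distribution_ofP (-1) ss ss tp; rewrite scaleN1r addNr HT => ->.
by rewrite mulN1r addNr.
Qed.

(** Each variable costs the integral pi of 1 / (1 + t^2), once for the real and once for the
    imaginary part. *)
Lemma avg_bound f M : schwartz f -> (forall x, nrm (f x) * \prod_j oneDsqr (x 0 j) <= M) ->
  nrm (cintegral f) <= (2 * pi) ^+ n * M.
Proof.
move=> sf fM; rewrite (cintegralE _ 0).
suff H l x : uniq l -> nrm (foldr avgC f l x) * \prod_(j | j \notin l) oneDsqr (x 0 j) <=
    (2 * pi) ^+ size l * M.
  have := H (enum 'I_n) 0 (enum_uniq 'I_n).
  by rewrite big1 ?mulr1 ?size_enum_ord// => j; rewrite mem_enum.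
elim: l x => [|j l IH] x; first by rewrite mul1r => _; exact: fM.
rewrite cons_uniq => /andP[jl ul].
rewrite -[foldr _ _ _ _]/(intC _) [size _]/=.
set P := \prod_(k | _) _.
have P0 : 0 < P by apply: prodr_gt0 => k _; exact: oneDsqr_gt0.
rewrite -ler_pdivlMr// exprS -[_ * _ * M]mulrA -[_ * (_ * M) / P]mulrA.
apply: (nrm_intC (avg_slice_cdecays x ul jl sf)).
move=> t; rewrite ler_pdivlMr ?oneDsqr_gt0// ler_pdivlMr// -mulrA.
have := IH (upd x j t) ul; congr (_ * _ <= _).
rewrite (bigD1 j) //= upd_eq; congr (_ * _).
apply: eq_big => k; first by rewrite in_cons negb_or andbC.
by move=> /andP[_ kj]; rewrite upd_neq.
Qed.

Lemma schwartz_weighted_bdd s : schwartz s ->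
  exists M, forall x, nrm (s x) * \prod_j oneDsqr (x 0 j) <= M.
Proof.
move=> ss; pose w l : fn R n := foldr (fun j f => f + xmul j (xmul j f)) s l.
have sw l : schwartz (w l).
  by elim: l => //= j l IH; apply: schwartzD => //; do 2 apply: schwartz_xmul.
have [M HM] := rapid_bdd (schwartz_rapid (sw (index_enum 'I_n))); exists M => x.
have E l : w l x = s x * (\prod_(j <- l) oneDsqr (x 0 j))%:C.
  elim: l => [|j l IH]; first by rewrite big_nil mulr1.
  rewrite big_cons /= -[LHS]/(w l x + _ * (_ * w l x)) IH rmorphM /oneDsqr rmorphD rmorph1.
  rewrite expr2 rmorphM /=; move: (s x : R[i]) ((\prod_(i <- l) _)%:C) ((x 0 j)%:C) => u v z; ring.
have := HM x; rewrite E nrmM nrm_real ger0_norm//.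
by apply: prodr_ge0 => j _; exact: ltW (oneDsqr_gt0 _).
Qed.

Lemma distribution_of_is_distribution s : schwartz s -> is_distribution (distribution_of s).
Proof.
move=> ss; split=> [c phi psi /test_schwartz sp /test_schwartz sq|K cK].
  rewrite /distribution_of -cintegralP; do ?exact: schwartz_pointwise.
  congr cintegral; apply/funext => x; rewrite [LHS]/pointwise fn_linE mulrDr.
  by rewrite mulrCA.
have [M HM] := schwartz_weighted_bdd ss; exists 0%N, ((2 * pi) ^+ n * M) => phi B tp _ HB.
have {}HB x : nrm (phi x) <= B by have := HB [::] x isT; rewrite nrmE lecR.
rewrite nrmE lecR -mulrA; apply: avg_bound.
  by apply: schwartz_pointwise => //; exact: test_schwartz.
move=> x; rewrite nrmM mulrAC; apply: ler_pM => //; last exact: nrm_ge0.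
rewrite mulr_ge0 ?nrm_ge0//; apply: prodr_ge0 => j _; exact: ltW (oneDsqr_gt0 _).
Qed.

End Averages.

(** * Dimension estimates through independent families *)

Section LinearIndependence.
Context {C : fieldType} {V : lmodType C}.
Implicit Types (W A B : set V).

Definition indep d (b : 'I_d -> V) :=
  forall c : 'I_d -> C, \sum_i c i *: b i = 0 -> forall i, c i = 0.

Definition has_indep W d := exists2 b : 'I_d -> V, indep b & forall i, W (b i).

(** Bounding the sizes of independent families allows dimension estimates inside
    infinite-dimensional spaces without a dimension function. *)
Definition dim_le W d := forall e, has_indep W e -> (e <= d)%N.

Definition spanned W d :=
  exists2 b : 'I_d -> V, (forall i, W (b i)) & forall w, W w -> exists c, w = \sum_i c i *: b i.

Definition lin_sub W := W 0 /\ forall a u v, W u -> W v -> W (a *: u + v).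

(** With more vectors than generators, the coefficient matrix has a nonzero vector in its left
    kernel, which is a linear relation. *)
Lemma dim_le_span W d (b : 'I_d -> V) :
  (forall w, W w -> exists c, w = \sum_i c i *: b i) -> dim_le W d.
Proof.
move=> H e [a ia Wa]; rewrite leqNgt; apply/negP => de.
have /choice[M HM] : forall k, exists c, a k = \sum_i c i *: b i by move=> k; exact: H.
pose N := \matrix_(k < e, i < d) M k i.
have : \rank (kermx N) != 0%N.
  by rewrite mxrank_ker -lt0n subn_gt0 (leq_ltn_trans (rank_leq_col _)).
rewrite mxrank_eq0 => /rowV0Pn[v /sub_kermxP vN v0].
have v1 : \sum_k v 0 k *: a k = 0.
  under eq_bigr do rewrite HM scaler_sumr; rewrite exchange_big /= big1// => i _.
  under eq_bigr do rewrite scalerA; rewrite -scaler_suml.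
  have := congr1 (fun m : 'rV_d => m 0 i) vN; rewrite !mxE => E.
  rewrite (_ : \sum_k v 0 k * M k i = 0) ?scale0r// -[RHS]E.
  by apply: eq_bigr => k _; rewrite mxE.
by move/eqP: v0; apply; apply/rowP => k; rewrite mxE (ia _ v1).
Qed.

Lemma has_indep0 W : has_indep W 0.
Proof. by exists (fun i : 'I_0 => 0) => [c _ []|[]]. Qed.

(** An independent family of maximal size spans. *)
Lemma dim_le_spanned W d : dim_le W d -> exists2 e, (e <= d)%N & spanned W e.
Proof.
move=> Wd; pose P e := `[< has_indep W e >].
have exP : exists e, P e by exists 0%N; apply/asboolP; exact: has_indep0.
have ub e : P e -> (e <= d)%N by move/asboolP; exact: Wd.
case: (ex_maxnP exP ub) => e /asboolP[b ib Wb] max.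
exists e; first by apply: Wd; exists b.
exists b => // w Ww; apply: contrapT => nspan.
suff /asboolP/max : has_indep W e.+1 by rewrite ltnn.
exists (fun i => if unlift ord0 i is Some j then b j else w); last first.
  by move=> i; case: unliftP.
move=> c; rewrite big_ord_recl unlift_none; under eq_bigr do rewrite liftK.
have [c0|c0] := eqVneq (c ord0) 0; last first.
  move=> E; exfalso; apply: nspan; exists (fun i => - (c ord0)^-1 * c (lift ord0 i)).
  under eq_bigr do rewrite -scalerA; rewrite -scaler_sumr.
  move: E => /eqP; rewrite addrC addr_eq0 => /eqP ->.
  by rewrite scalerN scaleNr opprK scalerA mulVf// scale1r.
rewrite c0 scale0r add0r => /ib H i.
by case: (unliftP ord0 i) => [j|] ->.
Qed.

Lemma lin_sub_sum W I (r : seq I) (c : I -> C) (F : I -> V) : lin_sub W ->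
  (forall i, W (F i)) -> W (\sum_(i <- r) c i *: F i).
Proof.
move=> [W0 Wl] WF; elim: r => [|i r IH]; first by rewrite big_nil.
by rewrite big_cons; exact: Wl.
Qed.

Lemma has_indep_sub A B d : A `<=` B -> has_indep A d -> has_indep B d.
Proof. by move=> AB [b ib Ab]; exists b => // i; exact: AB. Qed.

Lemma dim_le_sub A B d : A `<=` B -> dim_le B d -> dim_le A d.
Proof. by move=> AB Bd e /(has_indep_sub AB); exact: Bd. Qed.

Lemma dim_le_leq W d e : (d <= e)%N -> dim_le W d -> dim_le W e.
Proof. by move=> de Wd k /Wd kd; exact: leq_trans de. Qed.

Lemma has_indep_leq W d e : (d <= e)%N -> has_indep W e -> has_indep W d.
Proof.
move=> de [b ib Wb]; exists (fun i => b (widen_ord de i)) => // c.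
pose c' (k : 'I_e) := if insub (val k) is Some i then c i else 0 : C.
move=> E i; have cw j : c' (widen_ord de j) = c j.
  by rewrite /c' /= insubT//= => ltj; congr c; exact: val_inj.
rewrite -cw; apply: ib; rewrite -[RHS]E.
rewrite (bigID (fun k : 'I_e => (k < d)%N)) /= [X in _ + X]big1 => [|k]; last first.
  by move=> kd; rewrite /c' insubN ?scale0r.
rewrite addr0 (big_ord_narrow de) /=; apply: eq_bigr => j _.
by rewrite cw.
Qed.

End LinearIndependence.

Definition islin (C : fieldType) (V W : lmodType C) (h : V -> W) :=
  forall a u v, h (a *: u + v) = a *: h u + h v.

Section LinearMaps.
Context {C : fieldType} {V W : lmodType C}.

Lemma islin0 (h : V -> W) : islin h -> h 0 = 0.
Proof. by move=> hl; have := hl (-1) 0 0; rewrite scaler0 addr0 scaleN1r addNr. Qed.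

Lemma islin_sum (h : V -> W) I (r : seq I) (c : I -> C) (F : I -> V) : islin h ->
  h (\sum_(i <- r) c i *: F i) = \sum_(i <- r) c i *: h (F i).
Proof.
move=> hl; elim: r => [|i r IH]; first by rewrite !big_nil islin0.
by rewrite !big_cons hl IH.
Qed.

Lemma has_indep_image (h : V -> W) (A : set V) (B : set W) d : islin h ->
  lin_sub A -> (forall u, A u -> h u = 0 -> u = 0) -> (forall u, A u -> B (h u)) ->
  has_indep A d -> has_indep B d.
Proof.
move=> hl Al hinj AB [b ib Ab]; exists (h \o b) => [c|i]; last exact: AB.
rewrite -islin_sum// => /(hinj _ (lin_sub_sum _ _ Al Ab)); exact: ib.
Qed.

Lemma has_indep_preimage (h : V -> W) (A : set V) (B : set W) d : islin h ->
  (forall w, B w -> exists2 u, A u & h u = w) -> has_indep B d -> has_indep A d.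
Proof.
move=> hl BA [b ib Bb].
have /choice[a Ha] : forall i, exists u, A u /\ h u = b i.
  by move=> i; have [u ? ?] := BA _ (Bb i); exists u.
exists a => [c E|i]; last by have [] := Ha i.
apply: ib; have := congr1 h E; rewrite islin_sum// islin0// => E'.
by rewrite -[RHS]E'; apply: eq_bigr => i _; have [_ ->] := Ha i.
Qed.

End LinearMaps.

Section RankNullity.
Context {C : fieldType} {V W : lmodType C}.

(** One half of rank-nullity: [mu] embeds [A] into the kernel of [r] on [B], and lifts of an
    independent family of [D] stay independent modulo that kernel. *)
Lemma has_indep_add (r : V -> W) (mu : V -> V) (A B : set V) (D : set W) p e :
  islin r -> islin mu -> lin_sub A ->
  (forall u, A u -> B (mu u)) -> (forall u, A u -> mu u = 0 -> u = 0) ->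
  (forall u, A u -> r (mu u) = 0) -> (forall w, D w -> exists2 u, B u & r u = w) ->
  has_indep A p -> has_indep D e -> has_indep B (p + e).
Proof.
move=> rl ml Al AB minj rm DB [a ia Aa] [d id Dd].
have /choice[b Hb] : forall i, exists u, B u /\ r u = d i.
  by move=> i; have [u ? ?] := DB _ (Dd i); exists u.
exists (fun i : 'I_(p + e) => match fintype.split i with inl i => mu (a i) | inr i => b i end); last first.
  by move=> i; case: fintype.split => k; [exact: AB|have [] := Hb k].
move=> c; rewrite big_split_ord /=.
under eq_bigr do rewrite (unsplitK (inl _)).
under [X in _ + X]eq_bigr do rewrite (unsplitK (inr _)).
move=> E.
have Er : \sum_i c (rshift p i) *: d i = 0.
  have := congr1 r E; rewrite (islin0 rl) -[\sum_(i < p) _]scale1r rl scale1r !(islin_sum _ _ _ rl).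
  rewrite [X in X + _]big1 ?add0r => [H|i _]; last by rewrite rm ?scaler0.
  by rewrite -[RHS]H; apply: eq_bigr => i _; have [_ ->] := Hb i.
have d0 i : c (rshift p i) = 0 by apply: (id (fun k => c (rshift p k))).
move: E; rewrite [X in _ + X]big1 => [|i _]; last by rewrite d0 scale0r.
rewrite addr0 -islin_sum// => /(minj _ (lin_sub_sum _ _ Al Aa))/ia c0 i.
by case: (split_ordP i) => k ->; [exact: c0|exact: d0].
Qed.

End RankNullity.

(** * The Bernstein filtration of the Weyl algebra *)

Section BernsteinFiltration.
Context {C : fieldType} {n : nat}.
Implicit Types (T U : weyl C n).

(** A monomial of total order d is d applications of generators, each of which costs one step of the
    family [Q]. *)
Lemma bernstein_ind (V : lmodType C) (X D : 'I_n -> V -> V) (Q : nat -> set V) v :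
  Q 0%N v -> (forall k, lin_sub (Q k)) -> (forall k, Q k `<=` Q k.+1) ->
  (forall k j u, Q k u -> Q k.+1 (X j u)) -> (forall k j u, Q k u -> Q k.+1 (D j u)) ->
  forall T k, bernstein k T -> Q k (wact X D T v).
Proof.
move=> Q0 Ql Qup QX QD T k Tk.
have Qle i j u : (i <= j)%N -> Q i u -> Q j u.
  by move=> /subnK <-; elim: (j - i)%N => // m IH /IH; exact: Qup.
have it (f : 'I_n -> V -> V) e u i : (forall k j u, Q k u -> Q k.+1 (f j u)) -> Q i u ->
    Q (\sum_j e j + i)%N (iter_ops f e u).
  move=> Qf Qi; rewrite /iter_ops -[(\sum_j e j)%N]big_enum /=.
  elim: (enum _) => [|j s IH] /=; first by rewrite big_nil.
  rewrite big_cons -addnA; elim: (e j) => //= m IHm.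
  by rewrite addSn; exact: Qf.
rewrite /wact big_seq; elim/big_ind: _ => [|u w Qu Qw|m mT].
- by have [] := Ql k.
- by have := (Ql k).2 1 u w Qu Qw; rewrite scale1r.
have [Qk0 Qkl] := Ql k.
rewrite -[_ *: _]addr0; apply: Qkl => //.
apply: (@Qle (mdeg m)); last first.
  have := it X (fun j => m (lshift n j)) _ _ QX (it D (fun j => m (rshift n j)) v 0%N QD Q0).
  rewrite addn0 /wmon; congr (Q _ _).
  by rewrite mdegE big_split_ord.
by rewrite -ltnS; apply: leq_trans Tk; apply: msize_mdeg_lt.
Qed.

Lemma bernstein_lin k : lin_sub (@bernstein C n k).
Proof.
split; first by rewrite /bernstein /= mmeasure0.
move=> a T U Tk Uk; rewrite /bernstein /=.
apply: leq_trans (mmeasureD_le _ _ _) _; rewrite geq_max Uk andbT.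
by apply: leq_trans (mmeasureZ_le _ _ _) Tk.
Qed.

Lemma bernstein_up k : @bernstein C n k `<=` bernstein k.+1.
Proof. by move=> T; rewrite /bernstein /= => /leqW. Qed.

Lemma msize_XM (i : 'I_(n + n)) (T : mpoly (n + n) C) k : (mmeasure mdeg T <= k)%N ->
  (mmeasure mdeg (mpolyX C (mnm1 i) * T) <= k.+1)%N.
Proof.
move=> Tk; have [->|T0] := eqVneq T 0; first by rewrite mulr0 mmeasure0.
rewrite msizeM//; last first.
  by rewrite -msize_poly_eq0 msizeX.
by rewrite msizeX mdeg1.
Qed.

Lemma msize_mderiv (i : 'I_(n + n)) (T : mpoly (n + n) C) k : (mmeasure mdeg T <= k)%N ->
  (mmeasure mdeg (mderiv i T) <= k.-1)%N.
Proof.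
move=> Tk; rewrite mmeasureE; apply/bigmax_leqP_seq => m.
rewrite mcoeff_msupp mcoeff_mderiv => mT _.
have : mnm_add m (mnm1 i) \in msupp T.
  by rewrite mcoeff_msupp; apply: contraNneq mT => ->; rewrite mul0rn.
move=> /msize_mdeg_lt; rewrite mdegD mdeg1 addn1 => h.
by have := leq_trans h Tk; case: (k).
Qed.

Lemma bernstein_x k j T : bernstein k T -> bernstein k.+1 (wx j * T).
Proof. by rewrite wxE; exact: msize_XM. Qed.

Lemma bernstein_d k j T : bernstein k T -> bernstein k.+1 (wd j * T).
Proof.
rewrite wdE => Tk; rewrite /bernstein /=.
apply: leq_trans (mmeasureD_le _ _ _) _; rewrite geq_max msize_XM// andbT.
by apply: leq_trans (msize_mderiv _ Tk) _; exact: leqW.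
Qed.

End BernsteinFiltration.

(** * Numerical functions that are eventually polynomial *)

Definition eventually_poly (f : nat -> nat) :=
  exists chi : {poly rat}, exists k0, forall k, (k0 <= k)%N -> chi.[k%:R] = (f k)%:R.

Section EventuallyPolynomial.
Implicit Types (f g : nat -> nat).

Lemma eventually_poly_cst c : eventually_poly (fun=> c).
Proof. by exists (c%:R)%:P, 0%N => k _; rewrite hornerC. Qed.

Lemma eventually_poly_eq f g k1 : (forall k, (k1 <= k)%N -> f k = g k) ->
  eventually_poly f -> eventually_poly g.
Proof.
move=> fg [p [k0 H]]; exists p, (maxn k0 k1) => k; rewrite geq_max => /andP[k0k k1k].
by rewrite H// fg.
Qed.

Lemma eventually_polyD f g : eventually_poly f -> eventually_poly g ->
  eventually_poly (fun k => f k + g k)%N.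
Proof.
move=> [p [k0 Hp]] [q [k1 Hq]]; exists (p + q), (maxn k0 k1) => k.
by rewrite geq_max => /andP[k0k k1k]; rewrite hornerD natrD Hp// Hq.
Qed.

Lemma eventually_poly_shift f a : eventually_poly f -> eventually_poly (fun k => f (k - a)%N).
Proof.
move=> [p [k0 Hp]]; exists (p \Po ('X - (a%:R)%:P)), (k0 + a)%N => k ka.
have ak : (a <= k)%N by apply: leq_trans ka; exact: leq_addl.
have k0k : (k0 <= k - a)%N by rewrite -(leq_add2r a) subnK.
by rewrite horner_comp hornerXsubC -natrB// (Hp _ k0k).
Qed.

Lemma eventually_poly_sum (F : nat -> nat -> nat) a :
  (forall i, (i < a)%N -> eventually_poly (F i)) ->
  eventually_poly (fun k => \sum_(i < a) F i k)%N.
Proof.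
elim: a => [|a IH] H.
  by under eq_fun do rewrite big_ord0; exact: eventually_poly_cst.
under eq_fun do rewrite big_ord_recr /=.
by apply: eventually_polyD; [apply: IH => i ia; apply: H; exact: leqW|exact: H].
Qed.

(** Strong induction on the degree: the difference of x^(d+1) is (d+1) x^d plus lower powers, whose
    antidifferences are already known. *)
Lemma poly_antidifference (p : {poly rat}) :
  exists q : {poly rat}, forall x, q.[x + 1] - q.[x] = p.[x].
Proof.
have Xd d : exists q : {poly rat}, forall x, q.[x + 1] - q.[x] = x ^+ d.
  elim/ltn_ind: d => d IH.
  have /choice[q Hq] : forall i : 'I_d, exists q : {poly rat},
      forall x, q.[x + 1] - q.[x] = x ^+ i by move=> i; exact: IH.
  exists ((d.+1%:R)^-1 *: ('X^(d.+1) - \sum_(i < d) ('C(d.+1, i))%:R *: q i)) => x.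
  rewrite !hornerZ -mulrBr; apply: (canLR (mulKf _)); first by rewrite pnatr_eq0.
  have dist (a b c e : rat) : a - b - (c - e) = (a - c) - (b - e) by ring.
  rewrite !hornerD !hornerN !hornerXn !horner_sum dist -sumrB.
  under eq_bigr do rewrite !hornerZ -mulrBr Hq.
  rewrite (addrC x) exprDn !big_ord_recr /= subnn expr0 mul1r binn mulr1n addrK.
  rewrite subSnn expr1n mul1r binSn addrAC mulr_natl.
  under eq_bigr do rewrite expr1n mul1r -mulr_natl.
  by rewrite subrr add0r.
have /choice[q Hq] := Xd; exists (\sum_(i < size p) p`_i *: q i) => x.
rewrite !horner_sum -sumrB horner_coef; apply: eq_bigr => i _.
by rewrite !hornerZ -mulrBr Hq.
Qed.

Lemma eventually_poly_psum f : eventually_poly f ->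
  eventually_poly (fun k => \sum_(i < k.+1) f i)%N.
Proof.
move=> [p [k0 Hp]]; have [q Hq] := poly_antidifference (p \Po ('X + 1%:P)).
exists (q + ((\sum_(i < k0.+1) f i)%N%:R - q.[k0%:R])%:P), k0 => k.
move=> /subnK <-; elim: (k - k0)%N => [|m IH].
  by rewrite add0n hornerD hornerC addrC subrK.
rewrite addSn [in RHS]big_ord_recr /= natrD -IH -Hp; last by rewrite leqW// leq_addl.
rewrite !hornerD !hornerC addrAC; congr (_ + _); apply/eqP.
rewrite addrC -subr_eq -[(_ + _).+1]addn1 natrD Hq horner_comp.
by rewrite hornerD hornerX hornerC.
Qed.

End EventuallyPolynomial.

(** * Dickson's lemma and the count of monomials outside an upward closed set *)

Section Dickson.

Definition leqs (s t : seq nat) := all2 leq s t.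

(** [next] picks an index from [p] on at which [f] is minimal over all indices from [p] on;
    iterating it gives the subsequence. *)
Lemma nondecreasing_subsequence (f : nat -> nat) :
  exists2 g : nat -> nat, {homo g : i j / (i < j)%N} & {homo (f \o g) : i j / (i <= j)%N}.
Proof.
have next p : exists i, (p <= i)%N /\ forall j, (p <= j)%N -> (f i <= f j)%N.
  pose P v := `[< exists2 i, (p <= i)%N & f i = v >].
  have exP : exists v, P v by exists (f p); apply/asboolP; exists p.
  have [v /asboolP[i pi <-] min] := ex_minnP exP.
  by exists i; split => // j pj; apply: min; apply/asboolP; exists j.
have [h /all_and2[hge hmin]] := choice next.
pose g := fix g i := if i is j.+1 then h (g j).+1 else h 0%N.
exists g; first by apply: homo_ltn => [|i /=]; [exact: ltn_trans|exact: hge].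
have gS : {homo g : i j / (i < j)%N}.
  by apply: homo_ltn => [|i /=]; [exact: ltn_trans|exact: hge].
apply: homo_leq => [//|i j k|i /=]; first exact: leq_trans.
case: i => [|i] /=; apply: hmin; first exact: leq0n.
by apply: leq_trans (hge _); rewrite leqW//; exact: hge.
Qed.

(** The induction on [m] needs the stronger claim of a whole nondecreasing subsequence: one for the
    heads, then a further one for the tails. *)
Lemma dickson m (s : nat -> seq nat) : (forall i, size (s i) = m) ->
  exists i j, (i < j)%N /\ leqs (s i) (s j).
Proof.
suff H : forall m (s : nat -> seq nat), (forall i, size (s i) = m) ->
    exists2 g : nat -> nat, {homo g : i j / (i < j)%N} &
      forall i j, (i <= j)%N -> leqs (s (g i)) (s (g j)).
  by move=> /H[g gS gs]; exists (g 0%N), (g 1%N); split; [exact: gS|exact: gs].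
elim=> [|{}m IH] {}s ss; first by exists id => // i j _; rewrite (size0nil (ss i)) (size0nil (ss j)).
have [g gS gs] := nondecreasing_subsequence (fun i => head 0%N (s i)).
have [|h hS hs] := IH (fun i => behead (s (g i))).
  by move=> i; rewrite size_behead ss.
exists (g \o h) => [i j ij|i j ij]; first exact/gS/hS.
have := hs i j ij; have := gs (h i) (h j).
rewrite /=; case: (s (g (h i))) (ss (g (h i))) (s (g (h j))) (ss (g (h j))) => //= a u _.
case=> //= b v _ -> //; rewrite leq_eqVlt in ij; case/predU1P: ij => [->//|/hS/ltnW//].
Qed.

Definition upset m (L : set (seq nat)) :=
  forall s t, size s = m -> leqs s t -> L s -> L t.

(** In a chain that never stabilises, infinitely many stages gain a new element. By Dickson's lemma
    one of these dominates an earlier one, hence was already present. *)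
Lemma upset_acc m (L : nat -> set (seq nat)) : (forall a, upset m (L a)) ->
  (forall a s, size s = m -> L a s -> L a.+1 s) ->
  exists a0, forall a, (a0 <= a)%N -> forall s, size s = m -> L a s -> L a0 s.
Proof.
move=> Lup Linc; apply: contrapT => /forallNP H.
have Lle a b s : (a <= b)%N -> size s = m -> L a s -> L b s.
  by move=> /subnK <- sm Las; elim: (b - a)%N => // i IH; exact: Linc.
have /choice[h Hh] : forall a, exists bs : nat * seq nat,
    [/\ (a <= bs.1)%N, size bs.2 = m, L bs.1 bs.2 & ~ L a bs.2].
  move=> a; apply: contrapT => /forallNP N; apply: (H a) => b ab s sm Lb.
  by apply: contrapT => La; apply: (N (b, s)).
pose g := fix g i := if i is j.+1 then (h (g j)).1 else 0%N.
have gle i j : (i <= j)%N -> (g i <= g j)%N.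
  by apply: (@homo_leq _ g leq) => [//|? ? ?|k /=]; [exact: leq_trans|have [] := Hh (g k)].
have [i|i [j [ij le]]] := @dickson m (fun i => (h (g i)).2); first by have [] := Hh (g i).
have [_ si Li _] := Hh (g i); have [_ _ _] := Hh (g j); apply.
apply: (Lup _ _ _ si le); apply: (Lle (g i.+1)) => //; exact: gle.
Qed.

Fixpoint comps (m k : nat) : seq (seq nat) :=
  if m is m'.+1 then flatten [seq [seq a :: s | s <- comps m' (k - a)%N] | a <- iota 0 k.+1]
  else [:: [::]].

Lemma compsS m k :
  comps m.+1 k = flatten [seq [seq a :: s | s <- comps m (k - a)%N] | a <- iota 0 k.+1].
Proof. by []. Qed.

Lemma mem_comps m k s : (s \in comps m k) = (size s == m) && (sumn s <= k)%N.
Proof.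
elim: m k s => [|m IH] k s.
  by rewrite inE /=; case: s.
rewrite compsS; apply/flatten_mapP/andP => [[a]|[/eqP]].
  rewrite mem_iota add0n ltnS => /= ak /mapP[t].
  rewrite IH => /andP[/eqP ts tk] -> /=; rewrite ts eqxx; split => //.
  by rewrite -leq_subRL.
case: s => // a s [sm] ask; rewrite /= in ask;  have ak : (a <= k)%N by apply: leq_trans ask; exact: leq_addr.
exists a; first by rewrite mem_iota.
by apply/mapP; exists s => //; rewrite IH sm eqxx leq_subRL.
Qed.

Lemma uniq_comps m k : uniq (comps m k).
Proof.
elim: m k => [//|m IH] k.
apply: (@allpairs_uniq_dep _ _ _ (fun a s => a :: s) (iota 0 k.+1) (fun a => comps m (k - a)%N)) => //.
  exact: iota_uniq.
by move=> [a s] [b t] _ _ /= [-> ->].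
Qed.

Definition ncomps m (L : set (seq nat)) k := count (fun s => `[< ~ L s >]) (comps m k).

(** The slices of [L] by the first entry grow with that entry and stabilise from some [a0] on. The
    count is then a finite sum of shifted slice counts plus a partial sum of the stable one. *)
Lemma eventually_poly_ncomps m L : upset m L -> eventually_poly (ncomps m L).
Proof.
elim: m L => [|m IH] L Lup; first exact: (eventually_poly_cst (ncomps 0 L 0)).
pose sl a := [set s | L (a :: s)].
have slup a : upset m (sl a).
  by move=> s t sm st; apply: Lup; rewrite /= ?sm// /leqs /= leqnn.
have slle a b s : (a <= b)%N -> size s = m -> sl a s -> sl b s.
  move=> ab sm; apply: Lup => /=; rewrite ?sm// /leqs /= ab /=.
  by elim: (s) => //= c u ->; rewrite leqnn.
have [|a0 H] := upset_acc slup; first by move=> a s; apply: slle.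
have E k : ncomps m.+1 L k = (\sum_(a < k.+1) ncomps m (sl a) (k - a))%N.
  rewrite /ncomps compsS count_flatten -map_comp sumnE big_map.
  rewrite -[iota 0 k.+1]/(index_iota 0 k.+1) big_mkord; apply: eq_bigr => a _.
  by rewrite /= count_map.
pose f k := (\sum_(a < a0) ncomps m (sl a) (k - a)%N +
  \sum_(i < (k - a0).+1) ncomps m (sl a0) i)%N.
apply: (@eventually_poly_eq f _ a0) => [k a0k|]; last first.
  apply: eventually_polyD.
    apply: (@eventually_poly_sum (fun a k => ncomps m (sl a) (k - a)%N)) => i _.
    exact/(@eventually_poly_shift (ncomps m (sl i)))/IH.
  apply: (@eventually_poly_shift (fun k => \sum_(i < k.+1) ncomps m (sl a0) i)%N).
  exact/eventually_poly_psum/IH.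
rewrite E /f; symmetry; rewrite -(big_mkord xpredT (fun a => ncomps m (sl a) (k - a))).
rewrite (big_cat_nat (n := a0)) //=; last exact: leqW.
rewrite big_mkord; congr addn.
rewrite -{1}(add0n a0) big_addn subSn// big_mkord.
rewrite [RHS](reindex_inj rev_ord_inj) /=; apply: eq_bigr => i _.
rewrite subSS -subnDA addnC; apply: eq_in_count => s; rewrite mem_comps => /andP[/eqP sm _].
apply: asbool_equiv_eq; split; apply: contra_not.
  by apply: slle => //; exact: leq_addr.
by apply: H => //; exact: leq_addr.
Qed.

End Dickson.

(** * Leading monomials of left ideals and the Hilbert polynomial *)

Section LeadingMonomials.
Context {C : fieldType} {n : nat}.
Local Notation N := (n + n)%N.
Implicit Types (T U : weyl C n) (I : set (weyl C n)).

Definition left_ideal I := [/\ lin_sub I, forall j T, I T -> I (wx j * T) &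
  forall j T, I T -> I (wd j * T)].

Definition is_lead I (m : multinom N) := exists T, [/\ I T, T != 0 & mlead T = m].

(** Left multiplication by a generator shifts the leading monomial as in the commutative ring: the
    correction term of d_j is a derivative, of smaller degree, and the monomial order refines the
    degree. *)
Lemma is_leadU I m i : left_ideal I -> is_lead I m -> is_lead I (mnm_add m (mnm1 i)).
Proof.
move=> [_ Ix Id] [T [IT T0 <-]].
have X0 k : mpolyX C (mnm1 k) != 0 :> mpoly N C by rewrite -msize_poly_eq0 msizeX.
case: (split_ordP i) => j ->.
  exists (wx j * T); split; first exact: Ix.
    by rewrite wxE mulf_neq0.
  by rewrite wxE /wmulX mleadM// mleadXm addmC.
have lE : mlead (wd j * T : mpoly N C) = mnm_add (mlead T) (mnm1 (rshift n j)).
  rewrite wdE /wmulD mleadDr; first by rewrite mleadM// mleadXm addmC.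
  rewrite mleadM// mleadXm; apply: lt_mdeg_ltmc; rewrite mdegD mdeg1 add1n.
  have [->|D0] := eqVneq (mderiv (lshift n j) T) 0; first by rewrite mlead0 mdeg0.
  rewrite (mlead_deg T0) (mlead_deg D0).
  by apply: leq_trans (msize_mderiv _ (leqnn _)) _; exact: leq_pred.
exists (wd j * T); split => //; first exact: Id.
apply/negP => /eqP E; move: lE; rewrite E mlead0 => /(congr1 mdeg).
by rewrite mdeg0 mdegD mdeg1 addn1.
Qed.

Lemma is_lead_le I (m m' : multinom N) : left_ideal I -> (forall i, (m i <= m' i)%N) ->
  is_lead I m -> is_lead I m'.
Proof.
move=> Il; move: {2}(mdeg (mnm_sub m' m)) (erefl (mdeg (mnm_sub m' m))) => k.
elim: k m => [|k IH] m /= km mm' Lm.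
  rewrite (_ : m' = m)//; apply/mnmP => i; apply/eqP; rewrite eqn_leq mm' andbT.
  by move: km => /eqP; rewrite mdeg_eq0 => /eqP/mnmP/(_ i); rewrite mnmBE mnm0E => /eqP.
have [i mi] : exists i, (m i < m' i)%N.
  apply: contrapT => /forallNP H.
  suff : mdeg (mnm_sub m' m) == 0%N by rewrite km.
  rewrite mdeg_eq0; apply/eqP/mnmP => i; rewrite mnmBE mnm0E; apply/eqP.
  by rewrite subn_eq0 leqNgt; apply/negP/H.
apply: (IH (mnm_add m (mnm1 i))); last exact: is_leadU.
  apply: succn_inj; rewrite -km -addn1 -[X in (_ + X)%N](mdeg1 i) -mdegD.
  congr mdeg; apply/mnmP => l; rewrite mnmDE !mnmBE mnmDE mnm1E.
  have [<-|_] := eqVneq i l; last by rewrite !addn0.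
  by rewrite subnDA subnK// subn_gt0.
move=> l; rewrite mnmDE mnm1E; have [<-|_] := eqVneq i l; rewrite ?addn1 ?addn0//.
Qed.

Definition mon_of (s : seq nat) : multinom N := Multinom (mktuple (fun i => nth 0%N s i)).

Lemma mon_ofE s i : mon_of s i = nth 0%N s i.
Proof. exact: mnmE. Qed.

Lemma mon_of_inj s t : size s = N -> size t = N -> mon_of s = mon_of t -> s = t.
Proof.
move=> sN tN /mnmP E; apply: (@eq_from_nth _ 0%N) => [|i]; first by rewrite sN tN.
by rewrite sN => iN; have := E (Ordinal iN); rewrite !mon_ofE.
Qed.

Lemma mdeg_mon_of s : size s = N -> mdeg (mon_of s) = sumn s.
Proof.
move=> sN; rewrite mdegE sumnE (big_nth 0%N) sN big_mkord.
by apply: eq_bigr => i _; rewrite mon_ofE.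
Qed.

Lemma mon_of_surj (m : multinom N) : mon_of m = m.
Proof. by apply/mnmP => i; rewrite mon_ofE -tnth_nth. Qed.

Definition lead_set I : set (seq nat) := [set s | is_lead I (mon_of s)].

Lemma upset_lead_set I : left_ideal I -> upset N (lead_set I).
Proof.
move=> Il s t sN st; apply: is_lead_le => // i; rewrite !mon_ofE.
move: st; rewrite /leqs all2E => /andP[/eqP stE /all_nthP-/(_ (0%N, 0%N) i)].
by rewrite nth_zip// size_zip -stE minnn; apply; rewrite sN.
Qed.

(** Macaulay's basis theorem: the monomials of degree at most k that lead no element of [I] form a
    basis of the quotient. A combination of them in [I] would have one of them as leading monomial;
    spanning is by induction on leading monomials. *)
Lemma filtered_dim_ncomps I k : left_ideal I -> filtered_dim I k (ncomps N (lead_set I) k).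
Proof.
move=> Il; have [[I0 Ilin] Ix Id] := Il.
pose ss := [seq s <- comps N k | `[< ~ lead_set I s >]].
have ssE : size ss = ncomps N (lead_set I) k by rewrite size_filter.
have ssN s : s \in ss -> [/\ size s = N, (sumn s <= k)%N & ~ lead_set I s].
  by rewrite mem_filter mem_comps => /and3P[/asboolP ? /eqP].
have uss : uniq ss by rewrite filter_uniq// uniq_comps.
rewrite -ssE; pose b (i : 'I_(size ss)) : weyl C n := mpolyX C (mon_of (nth [::] ss i)).
have bE (c : 'I_(size ss) -> C) (i : 'I_(size ss)) :
    mcoeff (mon_of (nth [::] ss i)) (\sum_j c j *: b j : mpoly N C) = c i.
  rewrite raddf_sum (bigD1 i) //= big1 => [|j ji].
    by rewrite addr0 mcoeffZ mcoeffX eqxx mulr1.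
  rewrite mcoeffZ mcoeffX; case: eqP => [E|]; last by rewrite mulr0.
  exfalso; move/eqP: ji; apply; apply/val_inj/eqP => /=.
  rewrite -(nth_uniq [::] _ _ uss)//; apply/eqP.
  by apply: (mon_of_inj _ _ E);
    [have [] := ssN _ (mem_nth [::] (ltn_ord j))|have [] := ssN _ (mem_nth [::] (ltn_ord i))].
have bsupp (c : 'I_(size ss) -> C) m :
    mcoeff m (\sum_i c i *: b i : mpoly N C) != 0 -> exists i : 'I_(size ss), m = mon_of (nth [::] ss i).
  rewrite raddf_sum; apply: contra_neqP => /forallNP H.
  apply: big1 => i _ /=; rewrite mcoeffZ mcoeffX.
  by case: eqP => [E|]; [case: (H i)|rewrite mulr0].
exists b; split=> [i|c Ic i|].
- have [sN sk _] := ssN _ (mem_nth [::] (ltn_ord i)).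
  by rewrite /bernstein /= msizeX mdeg_mon_of.
- set T := \sum_i _ in Ic; have [T0|T0] := eqVneq (T : mpoly N C) 0.
    by rewrite -bE -/T T0 mcoeff0.
  have [|j jE] := bsupp c (mlead T); first by rewrite -/T mleadc_eq0.
  have [_ _ []] := ssN _ (mem_nth [::] (ltn_ord j)).
  by exists T.
pose Sp T := exists c : 'I_(size ss) -> C, I (T - \sum_i c i *: b i).
have Sp_I T : I T -> Sp T.
  by move=> IT; exists (fun=> 0); rewrite big1 ?subr0// => i _; rewrite scale0r.
have Sp_lin a T U : Sp T -> Sp U -> Sp (a *: T + U).
  move=> [c Tc] [d Ud]; exists (fun i => a * c i + d i).
  under eq_bigr do rewrite scalerDl -scalerA.
  by rewrite big_split/= -scaler_sumr opprD addrACA -scalerBr; exact: Ilin.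
elim/mleadrect => T IH Tk; rewrite -/(Sp T).
have [->|T0] := eqVneq (T : mpoly N C) 0; first exact: Sp_I.
have Tdeg : (mdeg (mlead T) <= k)%N by rewrite -ltnS (mlead_deg T0).
(* A multiple of [G] cancels the leading term of [T]. If that monomial leads some element of [I],
   this element is [G]; otherwise the monomial itself is. *)
suff [G [SpG G0 GT]] : exists G, [/\ Sp G, G != 0 & mlead G = mlead T].
  pose a := mcoeff (mlead T) T / mcoeff (mlead T) G.
  have T'0 : mcoeff (mlead T) (T - a *: G : mpoly N C) = 0.
    by rewrite mcoeffB mcoeffZ -mulrA mulVf ?mulr1 ?subrr// -GT mleadc_eq0.
  rewrite -[T](subrK (a *: G)) addrC; apply: Sp_lin => //.
  have [->|nz] := eqVneq (T - a *: G : mpoly N C) 0; first exact: Sp_I.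
  have lt : (mlead (T - a *: G : mpoly N C) < mlead T)%O.
    rewrite lt_neqAle; apply/andP; split.
      by apply: contra_neq nz => E; apply/eqP; rewrite -mleadc_eq0 E T'0.
    apply: le_trans (mleadB_le _ _) _; rewrite leUx lexx /=.
    by apply: le_trans (mleadZ_le _ _) _; rewrite GT.
  apply: IH => //; rewrite /bernstein /= -(mlead_deg nz).
  exact: leq_ltn_trans (lemc_mdeg (ltW lt)) _.
have [[G [IG G0 GT]]|nl] := pselect (is_lead I (mlead T)); first by exists G; split => //; exact: Sp_I.
exists (mpolyX C (mlead T)); split.
- have s_in : (mlead T : seq nat) \in ss.
    rewrite mem_filter mem_comps size_tuple eqxx /= -mdeg_mon_of ?size_tuple// mon_of_surj Tdeg.
    by rewrite andbT; apply/asboolP; rewrite /lead_set /= mon_of_surj.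
  have si : (index (mlead T : seq nat) ss < size ss)%N by rewrite index_mem.
  exists (fun i => (i == Ordinal si)%:R); rewrite (bigD1 (Ordinal si)) //= big1 => [|i /negbTE ->].
    by rewrite eqxx scale1r addr0 /b /= nth_index// mon_of_surj subrr.
  by rewrite scale0r.
- by rewrite -msize_poly_eq0 msizeX.
- by rewrite mleadXm.
Qed.

Lemma hilbert_polynomial_exists I : left_ideal I -> exists chi, hilbert_polynomial I chi.
Proof.
move=> Il; have [chi [k0 H]] := eventually_poly_ncomps (upset_lead_set Il).
exists chi; exists k0 => // k /= /H chiE; exists (ncomps N (lead_set I) k) => //.
exact: filtered_dim_ncomps.
Qed.

End LeadingMonomials.

(** * The degree of a polynomial read off its growth *)

Section PolynomialGrowth.
Implicit Types (chi : {poly rat}) (f : nat -> nat).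

Lemma leq_expn m k e : (m <= k)%N -> (m ^ e <= k ^ e)%N.
Proof. by case: e => // e; rewrite leq_exp2r. Qed.

(** The factor k on the left allows the exponent [s] on the right instead of its predecessor. *)
Lemma horner_growth chi s : (size chi <= s)%N ->
  exists B : nat, forall k, (0 < k)%N -> `|chi.[k%:R]| * k%:R <= B%:R * k%:R ^+ s.
Proof.
move=> sz; pose b := \sum_(i < s) `|chi`_i|.
have b0 : 0 <= b by apply: sumr_ge0.
exists (Num.bound b) => k k0; have k1 : 1 <= k%:R :> rat by rewrite ler1n.
have kge0 : 0 <= k%:R :> rat by exact: ler0n.
apply: (@le_trans _ _ (b * k%:R ^+ s)); last first.
  by rewrite ler_wpM2r ?exprn_ge0// ltW// archi_boundP.
rewrite (horner_coef_wide _ sz) /b mulr_suml.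
apply: le_trans (ler_wpM2r kge0 (ler_norm_sum _ _ _)) _; rewrite mulr_suml.
apply: ler_sum => i _; rewrite normrM normrX (ger0_norm kge0) -mulrA -exprSr.
by rewrite ler_wpM2l// ler_weXn2l.
Qed.

Lemma size_poly_growth_le chi f k0 c n :
  (forall k, (k0 <= k)%N -> chi.[k%:R] = (f k)%:R) ->
  (forall k, (f k <= c * k.+1 ^ n)%N) -> (size chi <= n.+1)%N.
Proof.
move=> chiE fle; rewrite leqNgt; apply/negP => ns.
pose t := (size chi).-1; have tE : size chi = t.+1 by rewrite prednK// (leq_ltn_trans _ ns).
have nt : (n < t)%N by rewrite -ltnS -tE.
pose l := lead_coef chi; have l0 : l != 0 by rewrite lead_coef_eq0 -size_poly_eq0 tE.
have sr : (size (chi - l *: 'X^t)%R <= t)%N.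
  apply/leq_sizeP => j; rewrite leq_eqVlt => /predU1P[<-|tj].
    by rewrite coefB coefZ coefXn eqxx mulr1 /l lead_coefE subrr.
  by rewrite coefB coefZ coefXn gtn_eqF// mulr0 subr0 nth_default// tE.
have [B HB] := horner_growth sr.
(* If the degree t exceeds n, then k f(k) <= c (2k)^n k <= c 2^n k^t, and [B] bounds the lower
   terms; so |l| k <= M, against the choice of k. *)
pose M := (c * 2 ^ n + B)%N.
pose k := maxn k0 (Num.bound (M%:R / `|l|)).+1.
have k_gt0 : (0 < k)%N by rewrite leq_max orbT.
have : `|l| * k%:R <= M%:R.
  have kt : 0 < k%:R ^+ t :> rat by rewrite exprn_gt0// ltr0n.
  rewrite -(ler_pM2r kt) [leLHS](_ : _ = `|l * k%:R ^+ t| * k%:R); last first.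
    by rewrite normrM (ger0_norm (ltW kt)) mulrAC.
  rewrite (_ : l * _ = chi.[k%:R] - (chi - l *: 'X^t).[k%:R]); last first.
    by rewrite hornerD hornerN hornerZ hornerXn opprD opprK addrA subrr add0r.
  apply: le_trans (ler_wpM2r (ler0n _ _) (ler_normB _ _)) _.
  rewrite mulrDl natrD mulrDl; apply: lerD (HB _ k_gt0).
  rewrite chiE ?leq_max ?leqnn// normr_nat -natrX -!natrM ler_nat.
  apply: leq_trans (leq_mul (fle k) (leqnn k)) _.
  rewrite -!mulnA leq_mul2l; apply/orP; right; 
  apply: (@leq_trans ((2 * k) ^ n * k)); last first.
    by rewrite expnMn -mulnA leq_mul2l -expnSr leq_pexp2l ?orbT.
  by rewrite leq_mul2r leq_expn ?orbT// mul2n -addnn -add1n leq_add2r.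
apply/negP; rewrite -ltNge -ltr_pdivrMl ?normr_gt0// mulrC.
apply: lt_le_trans (archi_boundP _) _; first by rewrite divr_ge0.
by rewrite ler_nat leq_max leqnSn orbT.
Qed.

Lemma size_poly_growth_ge chi f k0 n :
  (forall k, (k0 <= k)%N -> chi.[k%:R] = (f k)%:R) ->
  (forall m k, (n * m <= k)%N -> (m.+1 ^ n <= f k)%N) -> (n < size chi)%N.
Proof.
move=> chiE fge; rewrite ltnNge; apply/negP => /horner_growth[B HB].
(* [m] exceeds B (n+1)^n, which contradicts m (m+1)^n <= k f(k) <= B k^n. The factor n + 1 rather
   than n keeps k positive for n = 0. *)
pose m := (k0 + B * n.+1 ^ n).+1; pose k := (n.+1 * m)%N.
have k_gt0 : (0 < k)%N by [].
have mk : (m <= k)%N by rewrite /k leq_pmull.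
have := HB k k_gt0; rewrite chiE; last by rewrite (leq_trans _ mk)// /m leqW// leq_addr.
rewrite normr_nat -natrX -!natrM ler_nat; apply/negP; rewrite -ltnNge.
apply: (@leq_trans (m.+1 ^ n * m)); last first.
  by apply: leq_mul mk; apply: fge; rewrite leq_mul2r leqnSn orbT.
rewrite /k expnMn mulnA mulnC; apply: (@leq_ltn_trans (m.+1 ^ n * (B * n.+1 ^ n))).
  by rewrite leq_mul2r leq_expn ?orbT.
by rewrite ltn_pmul2l ?expn_gt0// /m ltnS leq_addl.
Qed.

End PolynomialGrowth.

(** * Growth of cyclic modules and holonomicity *)

Section DimensionExtras.
Context {C : fieldType} {V : lmodType C}.

Lemma spanned_dim_le (W : set V) d : spanned W d -> dim_le W d.
Proof. by move=> [b _ H]; exact: dim_le_span H. Qed.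

Lemma dim_le_sum (A B S : set V) p e : dim_le A p -> dim_le B e ->
  (forall w, S w -> exists u v, [/\ A u, B v & w = u + v]) -> dim_le S (p + e).
Proof.
move=> /dim_le_spanned[p' pp [a _ sa]] /dim_le_spanned[e' ee [b _ sb]] H.
apply: (dim_le_leq (leq_add pp ee)).
apply: (@dim_le_span _ _ _ _ (fun i => match fintype.split i with inl i => a i | inr i => b i end)).
move=> w /H[u [v [/sa[c ->] /sb[d ->] ->]]].
exists (fun i => match fintype.split i with inl i => c i | inr i => d i end).
rewrite big_split_ord; congr (_ + _); apply: eq_bigr => i _.
  by rewrite (unsplitK (inl _)).
by rewrite (unsplitK (inr _)).
Qed.

Lemma has_indep_size (T : finType) (W : set V) (b : T -> V) : (forall i, W (b i)) ->
  (forall c : T -> C, \sum_i c i *: b i = 0 -> forall i, c i = 0) -> has_indep W #|T|.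
Proof.
move=> Wb ib; exists (b \o enum_val) => [c E i|i]; last exact: Wb.
rewrite -(enum_valK i); apply: (ib (c \o enum_rank)).
rewrite (reindex (@enum_val T predT)) /=; last first.
  by exists enum_rank => j _; [rewrite enum_valK|rewrite enum_rankK].
by rewrite -[RHS]E; apply: eq_bigr => j _; rewrite enum_valK.
Qed.

End DimensionExtras.

Section CyclicModules.
Context {C : fieldType} {n : nat} {V : lmodType C} (X D : 'I_n -> V -> V).
Context (XD : weyl_rep X D).
Implicit Types (T U : weyl C n) (u v w : V).

Definition ann v : set (weyl C n) := [set T | wact X D T v = 0].

(** The Bernstein filtration of the cyclic module A_n v. *)
Definition Gam v k : set V := [set wact X D T v | T in bernstein k].

Definition grows v := exists c, forall k, dim_le (Gam v k) (c * k.+1 ^ n).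

Lemma bernstein_le k l : (k <= l)%N -> @bernstein C n k `<=` bernstein l.
Proof. by move=> kl T; rewrite /bernstein /= => /leq_trans; apply. Qed.

Lemma bernstein1 : bernstein 0 (1 : weyl C n).
Proof. by rewrite /bernstein /= msize1. Qed.

Lemma bernsteinM k l T U : bernstein k T -> bernstein l U -> bernstein (k + l) (T * U).
Proof.
move=> Tk Ul.
apply: (@bernstein_ind _ _ (weyl C n) _ _ (fun k => bernstein (k + l))) Tk => //.
- by move=> i; exact: bernstein_lin.
- by move=> i; rewrite addSn; exact: bernstein_up.
- by move=> i j W; rewrite addSn -wxE; exact: bernstein_x.
- by move=> i j W; rewrite addSn -wdE; exact: bernstein_d.
Qed.

Lemma wact_ringM T U v : wact X D (T * U) v = wact X D T (wact X D U v).
Proof. exact: wact_wmul. Qed.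

Lemma Gam_lin v k : lin_sub (Gam v k).
Proof.
split=> [|a _ _ [T Tk <-] [U Uk <-]]; first by exists 0; rewrite ?wact0//; case: (bernstein_lin (C := C) (n := n) k).
by exists (a *: T + U); rewrite ?wactP//; case: (bernstein_lin (C := C) (n := n) k) => _; apply.
Qed.

Lemma Gam_le v k l : (k <= l)%N -> Gam v k `<=` Gam v l.
Proof. by move=> kl _ [T Tk <-]; exists T => //; exact: bernstein_le Tk. Qed.

Lemma Gam_self v : Gam v 0 v.
Proof. by exists 1; [exact: bernstein1|rewrite wact1]. Qed.

Lemma GamX v k j u : Gam v k u -> Gam v k.+1 (X j u).
Proof.
by move=> [T Tk <-]; exists (wx j * T); [exact: bernstein_x|rewrite wact_ringM wactx].
Qed.

Lemma GamD v k j u : Gam v k u -> Gam v k.+1 (D j u).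
Proof.
by move=> [T Tk <-]; exists (wd j * T); [exact: bernstein_d|rewrite wact_ringM wactd].
Qed.

Lemma Gam_ind v (Q : nat -> set V) :
  Q 0%N v -> (forall k, lin_sub (Q k)) -> (forall k, Q k `<=` Q k.+1) ->
  (forall k j u, Q k u -> Q k.+1 (X j u)) -> (forall k j u, Q k u -> Q k.+1 (D j u)) ->
  forall k, Gam v k `<=` Q k.
Proof. by move=> Q0 Ql Qup QX QD k _ [T Tk <-]; exact: bernstein_ind. Qed.

Lemma wact_lin T a u v : wact X D T (a *: u + v) = a *: wact X D T u + wact X D T v.
Proof.
have [Xl Dl _ _ _] := XD.
have iP f e : (forall j, islin (f j)) -> islin (iter_ops f e : V -> V).
  move=> fl b w w'; rewrite /iter_ops; elim: (enum _) => //= i s ->.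
  by elim: (e i) => //= k ->; rewrite fl.
rewrite /wact scaler_sumr -big_split /=; apply: eq_bigr => m _.
by rewrite !scalerA mulrC -scalerA -scalerDr /wmon !iP.
Qed.

Lemma grows_lin a u v : grows u -> grows v -> grows (a *: u + v).
Proof.
move=> [c Hc] [d Hd]; exists (c + d)%N => k; rewrite mulnDl.
apply: dim_le_sum (Hc k) (Hd k) _ => _ [T Tk <-].
exists (a *: wact X D T u), (wact X D T v); split; last exact: wact_lin.
  have [G0 Gl] := Gam_lin u k; rewrite -[_ *: _]addr0; apply: Gl => //.
  by exists T.
by exists T.
Qed.

Lemma grows0 : grows 0.
Proof.
exists 0%N => k; apply: (@dim_le_span _ _ _ _ (fun=> 0)) => _ [T _ <-].
by exists (fun=> 0); rewrite (islin0 (wact_lin T)) big1// => i _; rewrite scaler0.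
Qed.

Lemma grows_act T v : grows v -> grows (wact X D T v).
Proof.
move=> [c Hc]; pose l := msize (T : mpoly (n + n) C).
exists (c * l.+1 ^ n)%N => k; apply: (@dim_le_leq _ _ _ (c * (k + l).+1 ^ n)).
  rewrite -mulnA leq_mul2l -expnMn leq_expn ?orbT// mulSn -addSn leq_add2l.
  by rewrite leq_pmulr.
apply: (dim_le_sub _ (Hc (k + l)%N)) => _ [U Uk <-].
by exists (U * T); [apply: bernsteinM => //; rewrite /bernstein/= leqW|rewrite wact_ringM].
Qed.

(** Equivariance of [h] is not asked for: once the generators map the image of step k into the image
    of step k + 1, the filtration of [h v] lies in the image of that of [v]. *)
Lemma grows_map (h : V -> V) v : islin h ->
  (forall k j u, Gam v k u -> exists2 u', Gam v k.+1 u' & X j (h u) = h u') ->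
  (forall k j u, Gam v k u -> exists2 u', Gam v k.+1 u' & D j (h u) = h u') ->
  grows v -> grows (h v).
Proof.
move=> hl hX hD [c Hc]; exists c => k e /(has_indep_preimage (A := Gam v k) hl) H.
apply: (Hc k); apply: H => {e}.
apply: (Gam_ind (Q := fun k => [set w | exists2 u, Gam v k u & h u = w])) => {k}.
- by exists v => //; exact: Gam_self.
- move=> k; have [G0 Gl] := Gam_lin v k; split; first by exists 0; rewrite ?islin0.
  by move=> a _ _ [u Gu <-] [w Gw <-]; exists (a *: u + w); [exact: Gl|exact: hl].
- by move=> k _ [u Gu <-]; exists u => //; exact: Gam_le Gu.
- by move=> k j _ [u /(hX _ j)[u' Gu' E] <-]; exists u'.
- by move=> k j _ [u /(hD _ j)[u' Gu' E] <-]; exists u'.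
Qed.

Lemma left_ideal_ann v : left_ideal (ann v).
Proof.
split; first split=> [|a T U]; rewrite /ann /= ?wact0//.
- by rewrite wactP => -> ->; rewrite scaler0 addr0.
- by move=> j T; rewrite /ann /= wact_ringM => ->; rewrite (islin0 (wact_lin _)).
- by move=> j T; rewrite /ann /= wact_ringM => ->; rewrite (islin0 (wact_lin _)).
Qed.

Lemma filtered_dim_ann v k d : filtered_dim (ann v) k d ->
  dim_le (Gam v k) d /\ has_indep (Gam v k) d.
Proof.
have sumE (e : nat) (c : 'I_e -> C) (b : 'I_e -> weyl C n) :
    wact X D (\sum_i c i *: b i) v = \sum_i c i *: wact X D (b i) v.
  have Wl : islin (fun T => wact X D T v) by move=> a T U; exact: wactP.
  by rewrite (islin_sum _ _ _ Wl).
move=> [b [bk ib sb]]; split.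
  apply: (@dim_le_span _ _ _ _ (fun i => wact X D (b i) v)) => _ [T /sb[c Tc] <-].
  exists c; apply/eqP; rewrite -sumE -subr_eq0 -scaleN1r addrC -wactP scaleN1r addrC.
  exact/eqP.
exists (fun i => wact X D (b i) v) => [c|i]; last by exists (b i).
by rewrite -sumE => /ib.
Qed.

(** The filtration of A_n modulo the annihilator is that of A_n v. Growth of order n bounds the
    degree of the Hilbert polynomial from above, the independent families of the hypothesis bound it
    from below. The improper ideal corresponds to v = 0. *)
Lemma holonomic_annP v :
  (v != 0 -> forall m k, (n * m <= k)%N -> has_indep (Gam v k) (m.+1 ^ n)) ->
  holonomic_quotient (ann v) <-> grows v.
Proof.
move=> vind; split.
  move=> [annT|[chi [k0 _ H] sz]].
    suff -> : v = 0 by exact: grows0.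
    have : ann v 1 by rewrite annT.
    by rewrite /ann /= wact1.
  have [B HB] : exists B, forall k, (0 < k)%N -> `|chi.[k%:R]| * k%:R <= B%:R * k%:R ^+ n.+1.
    by apply: horner_growth; rewrite sz.
  (* The polynomial describes the dimension from [k0] on only; smaller steps are contained in the
     step [k1]. *)
  pose k1 := maxn k0 1.
  have Hk k : (k1 <= k)%N -> dim_le (Gam v k) (B * k ^ n).
    rewrite geq_max => /andP[k0k k_gt0]; have [d /filtered_dim_ann[dk _] dE] := H k k0k.
    apply: dim_le_leq dk; have := HB k k_gt0.
    by rewrite dE normr_nat -natrX -!natrM ler_nat expnSr mulnA leq_pmul2r.
  exists (B * k1.+1 ^ n)%N => k; have [k1k|kk1] := leqP k1 k.
    apply: (dim_le_leq _ (Hk k k1k)); rewrite -mulnA leq_mul2l -expnMn leq_expn ?orbT//.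
    by apply: (@leq_trans k.+1) => //; rewrite leq_pmull.
  apply: (dim_le_sub (Gam_le (ltnW kk1))); apply: (dim_le_leq _ (Hk k1 (leqnn _))).
  rewrite -mulnA leq_mul2l -expnMn leq_expn ?orbT//.
  by apply: (@leq_trans k1.+1) => //; rewrite leq_pmulr.
have [->|v0] := eqVneq v 0.
  by move=> _; left; apply/seteqP; split=> // T _; rewrite /ann /= (islin0 (wact_lin T)).
move=> [c Hc]; right; have Il := left_ideal_ann v.
pose f := ncomps (n + n) (lead_set (ann v)).
have fd k : filtered_dim (ann v) k (f k) by exact: filtered_dim_ncomps.
have [chi [k0 chiE]] := eventually_poly_ncomps (upset_lead_set Il).
exists chi; first by exists k0 => // k /= /chiE; exists (f k).
apply/eqP; rewrite eqn_leq; apply/andP; split.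
  apply: (size_poly_growth_le chiE) => k.
  by have [_ /Hc] := filtered_dim_ann (fd k); apply.
apply: (size_poly_growth_ge chiE) => m k mk.
by have [+ _] := filtered_dim_ann (fd k); apply; exact: vind.
Qed.

End CyclicModules.

(** * The lower bound: polynomial multiples of a nonzero Schwartz function *)

Section MultiplicationOperators.
Context {R : realType} {n : nat}.
Local Notation S := (schwartz_space R n).
Implicit Types (s u : fn R n) (T : weyl R[i] n).

(** In normal order the derivatives stand on the right, so the commutative product with the variable
    of d_j is right multiplication by d_j. *)
Lemma wact_mulDr (C : comNzRingType) (V : lmodType C) (X D : 'I_n -> V -> V) j
    (T : mpoly (n + n) C) (v : V) : weyl_rep X D ->
  wact X D (mpolyX C (mnm1 (rshift n j)) * T) v = wact X D T (D j v).
Proof.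
move=> [Xl Dl _ DC _]; elim/mpolyind: T => [|c m T _ _ IH]; first by rewrite mulr0 !wact0.
rewrite mulrDr -scalerAr !wactP IH -mpolyXD !wactX; congr (_ *: _ + _).
rewrite /wmon -(iter_ops_comm (g := D j))//.
rewrite -(iter_ops_S (e' := fun i => mnm_add (mnm1 (rshift n j)) m (rshift n i)))//; last first.
  by move=> i; rewrite mnmDE mnm1E (inj_eq (@rshift_inj _ _)) addnC.
by apply: eq_iter_ops => i; rewrite mnmDE mnm1E eq_rlshift.
Qed.

Definition xonly T := forall m : multinom (n + n), m \in msupp T -> forall j, m (rshift n j) = 0%N.

Lemma fn_act_xonly T u x : xonly T -> fn_act T u x = fn_act T (fun=> 1) x * u x.
Proof.
move=> Tx; rewrite /fn_act /wact !fct_sumE mulr_suml !big_seq.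
apply: eq_bigr => m /Tx mx; rewrite -[LHS]/(_ * _) -[X in _ = X * _]/(_ * _) -mulrA; congr (_ * _).
have D0 v : iter_ops pderiv (fun j => m (rshift n j)) v = v.
  by rewrite /iter_ops; elim: (enum _) => //= j r ->; rewrite mx.
rewrite /wmon !D0 /iter_ops; elim: (enum _) x => [|j r IH] x /=; first by rewrite mul1r.
elim: (m _) => [|k IHk] /=; first exact: IH.
by rewrite /xmul -mulrA -IHk.
Qed.

Lemma mderiv_xonly T j : xonly T -> xonly (mderiv (lshift n j) T).
Proof.
move=> Tx m; rewrite mcoeff_msupp mcoeff_mderiv => mT i.
have /Tx/(_ i) : mnm_add m (mnm1 (lshift n j)) \in msupp T.
  by rewrite mcoeff_msupp; apply: contraNneq mT => ->; rewrite mul0rn.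
by rewrite mnmDE mnm1E eq_lrshift addn0.
Qed.

(* Differentiating [q s = 0] gives [q' s + q s' = 0]; multiplied by [s] it is [q' s^2 = 0]. *)
Lemma mderiv_xonly_act T s j : schwartz s -> xonly T -> fn_act T s = 0 ->
  fn_act (mderiv (lshift n j) T) s = 0.
Proof.
move=> ss Tx Ts; have Tx' := mderiv_xonly (j := j) Tx.
have E : fn_act (mderiv (lshift n j) T) s = - fn_act T (pderiv j s).
  have /(congr1 val) : wact (@xS R n) (@dS R n) (wd j * T) (mkS ss) =
      dS j (wact (@xS R n) (@dS R n) T (mkS ss)).
    by rewrite wdE wact_wmulD//; exact: weyl_repS.
  rewrite wdE /wmulD wactD wact_mulDr; last exact: weyl_repS.
  rewrite /= -[X in X + _]/(val _) -[X in _ + X]/(val _) !val_wactS /= Ts.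
  rewrite (_ : pderiv j 0 = 0) => [/eqP|]; first by rewrite addr_eq0 => /eqP.
  by rewrite -[X in pderiv j X](scale0r s) pderivZ// scale0r.
apply/funext => x; have := congr1 (fun g => g x * s x) E.
have H (F : fieldType) (a b c d : F) : a * c * c = - (b * d * c) -> b * c = 0 -> a * c = 0.
  move=> + bc; rewrite (mulrAC b) bc mul0r oppr0 => /eqP; rewrite mulf_eq0 => /orP[/eqP//|/eqP ->].
  by rewrite mulr0.
rewrite (fn_act_xonly _ _ Tx') -[(- _) x]/(- (_ x)) (fn_act_xonly _ _ Tx) mulNr => /H; apply.
by rewrite -(fn_act_xonly s x Tx) Ts.
Qed.

(** The partial derivatives of the polynomial kill [s] as well, so they vanish by induction on the
    degree. The polynomial is then a constant, and a constant that kills a nonzero function is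
    zero. *)
Lemma xonly_faithful s T : schwartz s -> s <> 0 -> xonly T -> fn_act T s = 0 -> T = 0.
Proof.
move=> ss s0; have [k] := ubnP (msize (T : mpoly (n + n) R[i])).
elim: k T => // k IH T; rewrite ltnS => Tk Tx Ts.
have dT j : mderiv (lshift n j) T = 0.
  have [->|T0] := eqVneq (T : mpoly (n + n) R[i]) 0; first exact: mderiv0.
  apply: IH; [|exact: mderiv_xonly|exact: mderiv_xonly_act].
  apply: leq_ltn_trans (msize_mderiv _ (leqnn _)) _; apply: leq_trans Tk.
  by rewrite prednK// lt0n msize_poly_eq0.
have Tc : T = mcoeff mnm0 T *: 1.
  apply/mpolyP => m; rewrite mcoeffZ mcoeff1; have [->|m0] := eqVneq m mnm0; first by rewrite mulr1.
  rewrite mulr0; apply/eqP; rewrite mcoeff_eq0; apply: contra_neqN m0 => mT; apply/mnmP => i.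
  rewrite mnm0E; case: (split_ordP i) => j ->; last exact: Tx.
  apply/eqP; apply: contraTT mT => mj; rewrite -mcoeff_eq0.
  have := congr1 (mcoeff (mnm_sub m (mnm1 (lshift n j)))) (dT j).
  rewrite mcoeff_mderiv submK ?lep1mP// mcoeff0 => /eqP.
  by rewrite mulrn_eq0.
move: Ts; rewrite Tc fn_actZ fn_act1 => /eqP; rewrite scaler_eq0 => /orP[/eqP->|/eqP//].
by rewrite scale0r.
Qed.

(** Bernstein's inequality in this setting: the monomials in x with all exponents at most m have
    degree at most n m, and their products with [v] are independent by [xonly_faithful]. *)
Lemma Gam_schwartz_lower (v : S) m k : v != 0 -> (n * m <= k)%N ->
  has_indep (Gam (@xS R n) (@dS R n) v k) (m.+1 ^ n).
Proof.
move=> v0 mk.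
pose mo (f : {ffun 'I_n -> 'I_m.+1}) : multinom (n + n) :=
  Multinom (mktuple (fun i => match fintype.split i with inl j => (f j : nat) | inr _ => 0%N end)).
have mol f j : mo f (lshift n j) = f j by rewrite mnmE (unsplitK (inl _)).
have mor f j : mo f (rshift n j) = 0%N by rewrite mnmE (unsplitK (inr _)).
have mo_inj : injective mo.
  by move=> f g /mnmP E; apply/ffunP => j; apply/val_inj; rewrite /= -!mol E.
have := @has_indep_size R[i] S {ffun 'I_n -> 'I_m.+1} (Gam (@xS R n) (@dS R n) v k)
  (fun f => wact (@xS R n) (@dS R n) (mpolyX R[i] (mo f)) v).
rewrite card_ffun !card_ord; apply.
  move=> f; exists (mpolyX R[i] (mo f)) => //.
  rewrite /bernstein /= msizeX ltnS mdegE big_split_ord /=.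
  rewrite [X in (_ + X)%N]big1 ?addn0; last by move=> j _; rewrite mor.
  apply: leq_trans mk; rewrite -[X in (X * m)%N](card_ord n) -sum_nat_const.
  by apply: leq_sum => j _; rewrite mol -ltnS.
move=> c E; pose T : weyl R[i] n := \sum_f c f *: mpolyX R[i] (mo f).
have Tm g : mcoeff (mo g) (T : mpoly (n + n) R[i]) = c g.
  rewrite raddf_sum (bigD1 g) //= big1 => [|f fg].
    by rewrite addr0 mcoeffZ mcoeffX eqxx mulr1.
  by rewrite mcoeffZ mcoeffX (inj_eq mo_inj) (negbTE fg) mulr0.
suff T0 : T = 0 by move=> g; rewrite -Tm T0 mcoeff0.
apply: (@xonly_faithful (val v)) => //.
- exact: sval_schwartz.
- by move=> vv0; move/eqP: v0; apply; exact: val_inj.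
- move=> l; rewrite mcoeff_msupp raddf_sum => lT j.
  have [f ->] : exists f, l = mo f; last exact: mor.
  apply: contrapT => /forallNP N; move/eqP: lT; apply; apply: big1 => f _ /=.
  by rewrite mcoeffZ mcoeffX; case: eqP => [e|]; [case: (N f)|rewrite mulr0].
rewrite -val_wactS (_ : wact _ _ _ _ = 0)//.
have Wl : islin (fun T => wact (@xS R n) (@dS R n) T v) by move=> a U W; exact: wactP.
by rewrite (islin_sum _ _ _ Wl).
Qed.

End MultiplicationOperators.

(** * Growth of a pointwise product, by restriction to the diagonal *)

Section ProductGrowth.
Context {R : realType} {n : nat}.
Local Notation S := (schwartz_space R n).
Local Notation V2 := ('rV[R]_n -> fn R n).
Local Notation X := (@xS R n).
Local Notation D := (@dS R n).
Implicit Types (F G H : V2) (x y : 'rV[R]_n) (i : 'I_n) (j k : nat).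

Definition X1 (i : 'I_n) F : V2 := fun x y => (x 0 i)%:C * F x y.
Definition X2 (i : 'I_n) F : V2 := fun x y => (y 0 i)%:C * F x y.
Definition D1 (i : 'I_n) F : V2 := fun x y => pderiv i (fun x' => F x' y) x.
Definition D2 (i : 'I_n) F : V2 := fun x y => pderiv i (F x) y.

Context (u v : S).

(** The tensor product of step k for [u] with step k for [v], as finite sums of products. Its
    elements are Schwartz in each argument, which makes [D1] and [D2] linear on them. *)
Inductive tens k : V2 -> Prop :=
| tens0 : tens k 0
| tensS (p q : S) F of Gam X D u k p & Gam X D v k q & tens k F :
    tens k (fun x y => val p x * val q y + F x y).

Lemma tens1_schwartz k F y : tens k F -> schwartz (fun x => F x y).
Proof.
elim=> [|p q G _ _ _ IH]; first exact: schwartz0.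
have := schwartzL (val q y) (sval_schwartz p) IH; congr schwartz.
by apply/funext => x; rewrite mulrC.
Qed.

Lemma tens2_schwartz k F x : tens k F -> schwartz (F x).
Proof.
elim=> [|p q G _ _ _ IH]; first exact: schwartz0.
exact: (schwartzL (val p x) (sval_schwartz q) IH).
Qed.

Lemma tens_lin k : lin_sub (tens k).
Proof.
split=> [|a F G tF tG]; first exact: tens0.
elim: tF => [|p q F' up vq _ IH]; first by rewrite scaler0 add0r.
have [G0 Gl] := Gam_lin X D u k.
have := tensS (Gl a p 0 up G0) vq IH; congr (tens k _).
by apply/funext => x; apply/funext => y; rewrite addr0 -[RHS]/(a * (val p x * val q y + F' x y) + G x y) mulrDr mulrA -addrA.
Qed.

Lemma tens_up k F : tens k F -> tens k.+1 F.
Proof.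
elim=> [|p q G up vq _ IH]; first exact: tens0.
by apply: tensS IH; apply: Gam_le (leqnSn k) _ _.
Qed.

Lemma tens_X1 k i F : tens k F -> tens k.+1 (X1 i F).
Proof.
elim=> [|p q G up vq _ IH].
  rewrite (_ : X1 i 0 = 0); first exact: tens0.
  by apply/funext => x; apply/funext => y; rewrite /X1 mulr0.
have := tensS (GamX (@weyl_repS R n) i up) (Gam_le (leqnSn k) vq) IH; congr (tens _ _).
by apply/funext => x; apply/funext => y; rewrite /X1 /= /xmul mulrDr mulrA.
Qed.

Lemma tens_X2 k i F : tens k F -> tens k.+1 (X2 i F).
Proof.
elim=> [|p q G up vq _ IH].
  rewrite (_ : X2 i 0 = 0); first exact: tens0.
  by apply/funext => x; apply/funext => y; rewrite /X2 mulr0.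
have := tensS (Gam_le (leqnSn k) up) (GamX (@weyl_repS R n) i vq) IH; congr (tens _ _).
by apply/funext => x; apply/funext => y; rewrite /X2 /= /xmul mulrDr mulrCA.
Qed.

Lemma D1_tens i (p q : S) k G : tens k G ->
  D1 i (fun x y => val p x * val q y + G x y) = (fun x y => val (dS i p) x * val q y + D1 i G x y).
Proof.
move=> tG; apply/funext => x; apply/funext => y; rewrite /D1.
rewrite (_ : (fun x' => _) = val q y *: val p + (fun x' => G x' y)); last first.
  by apply/funext => z; rewrite mulrC.
rewrite pderivP; [|exact: sval_schwartz|exact: tens1_schwartz tG].
by rewrite mulrC.
Qed.

Lemma D2_tens i (p q : S) k G : tens k G ->
  D2 i (fun x y => val p x * val q y + G x y) = (fun x y => val p x * val (dS i q) y + D2 i G x y).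
Proof.
move=> tG; apply/funext => x; apply/funext => y; rewrite /D2.
rewrite (_ : (fun y' => _) = val p x *: val q + G x)//.
by rewrite pderivP; [|exact: sval_schwartz|exact: tens2_schwartz tG].
Qed.

Lemma D1_0 i : D1 i 0 = 0.
Proof.
apply/funext => x; apply/funext => y; rewrite /D1.
rewrite (_ : (fun x' => _) = 0 *: (0 : fn R n)); last by rewrite scale0r.
by rewrite pderivZ ?scale0r//; exact: schwartz0.
Qed.

Lemma D2_0 i : D2 i 0 = 0.
Proof.
apply/funext => x; rewrite /D2.
rewrite (_ : (0 : V2) x = 0 *: (0 : fn R n)); last by rewrite scale0r.
by rewrite pderivZ ?scale0r//; exact: schwartz0.
Qed.

Lemma tens_D1 k i F : tens k F -> tens k.+1 (D1 i F).
Proof.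
elim=> [|p q G up vq tG IH]; first by rewrite D1_0; exact: tens0.
rewrite (D1_tens _ _ _ tG); apply: tensS IH; last exact: Gam_le vq.
exact: (GamD (@weyl_repS R n)).
Qed.

Lemma tens_D2 k i F : tens k F -> tens k.+1 (D2 i F).
Proof.
elim=> [|p q G up vq tG IH]; first by rewrite D2_0; exact: tens0.
rewrite (D2_tens _ _ _ tG); apply: tensS IH; first exact: Gam_le up.
exact: (GamD (@weyl_repS R n)).
Qed.

(** Words of length at most k, applied to u(x)v(y), in operators that respect the subspace y_i = x_i
    for i < j. For such i only the total derivative [D1 i F + D2 i F] is tangent to it, and there
    [X2 i] would agree with [X1 i]; the other coordinates keep all their operators. *)
Inductive words j : nat -> V2 -> Prop :=
| words_base : words j 0 (fun x y => val u x * val v y)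
| words_zero k : words j k 0
| words_lin k a F G of words j k F & words j k G : words j k (a *: F + G)
| words_up k F of words j k F : words j k.+1 F
| words_X1 k i F of words j k F : words j k.+1 (X1 i F)
| words_X2 k (i : 'I_n) F of (j <= i)%N & words j k F : words j k.+1 (X2 i F)
| words_D k (i : 'I_n) F of (i < j)%N & words j k F : words j k.+1 (D1 i F + D2 i F)
| words_D1 k (i : 'I_n) F of (j <= i)%N & words j k F : words j k.+1 (D1 i F)
| words_D2 k (i : 'I_n) F of (j <= i)%N & words j k F : words j k.+1 (D2 i F).

Lemma words_tens j k F : words j k F -> tens k F.
Proof.
elim=> {k F}.
- have := tensS (Gam_self X D u) (Gam_self X D v) (tens0 0); congr (tens _ _).
  by apply/funext => x; apply/funext => y; rewrite addr0.
- by move=> k; exact: tens0.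
- by move=> k a F G _ tF _ tG; exact: (tens_lin k).2.
- by move=> k F _; exact: tens_up.
- by move=> k i F _; exact: tens_X1.
- by move=> k i F _ _; exact: tens_X2.
- move=> k i F _ _ tF; rewrite -[D1 i F]scale1r.
  by apply: (tens_lin k.+1).2; [exact: tens_D1|exact: tens_D2].
- by move=> k i F _ _; exact: tens_D1.
- by move=> k i F _ _; exact: tens_D2.
Qed.

Lemma wordsS j k F : words j.+1 k F -> words j k F.
Proof.
elim=> {k F}.
- exact: words_base.
- exact: words_zero.
- by move=> k a F G _ wF _; exact: words_lin.
- by move=> k F _; exact: words_up.
- by move=> k i F _; exact: words_X1.
- by move=> k i F ji _; apply: words_X2; exact: ltnW.
- move=> k i F; rewrite ltnS leq_eqVlt => /predU1P[ij|ij] _ wF; last exact: words_D.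
  rewrite -[D1 i F]scale1r; apply: words_lin; first by apply: words_D1 => //; rewrite ij.
  by apply: words_D2 => //; rewrite ij.
- by move=> k i F ji _; apply: words_D1; exact: ltnW.
- by move=> k i F ji _; apply: words_D2; exact: ltnW.
Qed.

Definition mix j x y : 'rV[R]_n := \row_i (if (i < j)%N then x 0 i else y 0 i).

(** Restrictions of the words to y_i = x_i for i < j, still written as functions of two points so
    that all stages lie in one space. Stage 0 is unrestricted, stage n is the diagonal. *)
Definition Gmix j k : set V2 := [set (fun x y => F x (mix j x y)) | F in words j k].

Lemma Gmix_lin j k : lin_sub (Gmix j k).
Proof.
split; first by exists 0 => //; exact: words_zero.
by move=> a _ _ [F wF <-] [G wG <-]; exists (a *: F + G) => //; exact: words_lin.
Qed.

Lemma Gmix_le j k l : (k <= l)%N -> Gmix j k `<=` Gmix j l.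
Proof.
move=> /subnK <- _ [F wF <-]; exists F => //.
by elim: (l - k)%N => // m IH; exact: words_up.
Qed.

Lemma mix_upd j (jn : (j < n)%N) x y :
  mix j x (upd y (Ordinal jn) (x 0 (Ordinal jn))) = mix j.+1 x y.
Proof.
apply/rowP => i; rewrite [LHS]mxE [RHS]mxE updE [in RHS]ltnS [in RHS]leq_eqVlt -val_eqE /=.
have [ij|//] := eqVneq (i : nat) j; rewrite ij ltnn.
by have -> : i = Ordinal jn by exact: val_inj.
Qed.

Lemma continuous_off_point (h : R -> R) a :
  continuous h -> (forall t, t != a -> h t = 0) -> h a = 0.
Proof.
move=> ch h0; apply/eqP; rewrite -normr_le0 leNgt; apply/negP => ha.
have /cvgrPdist_lt/(_ _ ha)[d /= d0 Hd] := ch a.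
have ad : ball_ Num.Def.normr a d (a + d / 2).
  by rewrite /ball_ /= opprD addrA subrr add0r normrN gtr0_norm ?divr_gt0// ltr_pdivrMr// ltr_pMr// ltr1n.
have ada : a + d / 2 != a by rewrite gt_eqF// ltrDl divr_gt0.
by have := Hd _ ad; rewrite (h0 _ ada) subr0 ltxx.
Qed.

Definition diag_at (o : 'I_n) H : V2 := fun x y => H x (upd y o (x 0 o)).

Definition diff_at (o : 'I_n) H : V2 := fun x y => (x 0 o - y 0 o)%:C * H x y.

Lemma islin_diag_at o : @islin R[i] V2 V2 (diag_at o).
Proof. by []. Qed.

Lemma islin_diff_at o : @islin R[i] V2 V2 (diff_at o).
Proof.
move=> a G H; apply/funext => x; apply/funext => y.
by rewrite /diff_at -[LHS]/(_ * (a * G x y + H x y)) mulrDr mulrCA.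
Qed.

Lemma Gmix_diff j k (jn : (j < n)%N) H :
  Gmix j k H -> Gmix j k.+1 (diff_at (Ordinal jn) H).
Proof.
move=> [F wF <-]; exists (X1 (Ordinal jn) F - X2 (Ordinal jn) F).
  rewrite addrC -scaleN1r; apply: words_lin; last exact: words_X1.
  by apply: words_X2.
apply/funext => x; apply/funext => y; set o := Ordinal jn.
rewrite -[LHS]/((x 0 o)%:C * F x (mix j x y) - (mix j x y 0 o)%:C * F x (mix j x y)).
by rewrite mxE ltnn -mulrBl -rmorphB.
Qed.

(** A function killed by x_j - y_j vanishes where y_j differs from x_j, hence everywhere by
    continuity in y_j. *)
Lemma diff_at_injective j k (jn : (j < n)%N) H :
  Gmix j k H -> diff_at (Ordinal jn) H = 0 -> H = 0.
Proof.
move=> [F wF <-] E; apply/funext => x; apply/funext => y; set w := mix j x y; set o := Ordinal jn.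
have [c1 c2] := @slice_cont R n (F x) o w (schwartz_crapid (tens2_schwartz x (words_tens wF))).1.
have z t : t != x 0 o -> F x (upd w o t) = 0.
  move=> tx; have := congr1 (fun H => H x (upd y o t)) E.
  have mu : mix j x (upd y o t) = upd w o t.
    apply/rowP => i; rewrite [LHS]mxE !updE mxE; have [->|//] := eqVneq i o.
    by rewrite ltnn.
  rewrite /diff_at mu updE eqxx => /eqP; rewrite mulf_eq0 => /orP[|/eqP//].
  by rewrite (inj_eq (@complexI R)) subr_eq0 eq_sym (negbTE tx).
rewrite -(upd_id w o).
have [->|/z//] := eqVneq (w 0 o) (x 0 o).
by apply: complexP; [apply: (continuous_off_point c1)|apply: (continuous_off_point c2)] => t /z;
  rewrite /re_fn /im_fn => ->.
Qed.

Lemma diag_at_diff o H : diag_at o (diff_at o H) = 0.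
Proof.
by apply/funext => x; apply/funext => y; rewrite /diag_at /diff_at updE eqxx subrr mul0r.
Qed.

Lemma Gmix_diag j k (jn : (j < n)%N) H : Gmix j.+1 k H ->
  exists2 G, Gmix j k G & diag_at (Ordinal jn) G = H.
Proof.
move=> [F wF <-]; exists (fun x y => F x (mix j x y)).
  by exists F => //; exact: wordsS.
by apply/funext => x; apply/funext => y; rewrite /diag_at mix_upd.
Qed.

(* Multiplication by [x_j - y_j] maps the first family into the kernel of the restriction to
   [y_j = x_j], which maps onto the second one. *)
Lemma Gmix_step j k p e (jn : (j < n)%N) :
  has_indep (Gmix j k) p -> has_indep (Gmix j.+1 k.+1) e -> has_indep (Gmix j k.+1) (p + e).
Proof.
apply: (has_indep_add (islin_diag_at (Ordinal jn)) (islin_diff_at (Ordinal jn)) (Gmix_lin j k)).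
- by move=> H; exact: Gmix_diff.
- by move=> H; exact: diff_at_injective.
- by move=> H _; exact: diag_at_diff.
- by move=> H; exact: Gmix_diag.
Qed.

(** Each of the [m] steps beyond [K] adds at least the dimension of stage j + 1 at [K], by
    [Gmix_step]. *)
Lemma Gmix_iter j K e m (jn : (j < n)%N) :
  has_indep (Gmix j.+1 K) e -> has_indep (Gmix j (K + m)) (m * e).
Proof.
move=> He; elim: m => [|m IH]; first exact: has_indep0.
rewrite addnS mulSnr; apply: Gmix_step => //.
apply: has_indep_sub He; apply: Gmix_le; exact: leqW (leq_addr _ _).
Qed.

Lemma tens_dim k p q : dim_le (Gam X D u k) p -> dim_le (Gam X D v k) q -> dim_le (tens k) (p * q).
Proof.
move=> /dim_le_spanned[p' pp [a ua sa]] /dim_le_spanned[q' qq [b vb sb]].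
apply: (dim_le_leq (leq_mul pp qq)).
pose ab (ij : 'I_p' * 'I_q') : V2 := fun x y => val (a ij.1) x * val (b ij.2) y.
rewrite -[p']card_ord -[q']card_ord -card_prod.
apply: (@dim_le_span _ V2 _ _ (fun l => ab (enum_val l))) => F tF.
suff [c ->] : exists c : 'I_p' * 'I_q' -> R[i], F = \sum_ij c ij *: ab ij.
  by exists (fun l => c (enum_val l)); rewrite (reindex (@enum_val _ predT)) //=;
    exists enum_rank => l _; [rewrite enum_valK|rewrite enum_rankK].
elim: tF => [|g h G /sa[c gE] /sb[d hE] _ [c' ->]].
  by exists (fun=> 0); rewrite big1// => ij _; rewrite scale0r.
exists (fun ij => c ij.1 * d ij.2 + c' ij).
apply/funext => x; apply/funext => y.
rewrite [X in _ = X x y](eq_bigr (fun ij => (c ij.1 * d ij.2) *: ab ij + c' ij *: ab ij)); last first.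
  by move=> ij _; exact: scalerDl.
rewrite big_split /= -[RHS]/(_ + _); congr (_ + _).
have evS z : islin (fun w : S => (val w z : R[i]^o)) by [].
have evV : islin (fun F : V2 => (F x y : R[i]^o)) by [].
rewrite gE hE (islin_sum _ _ _ (evS x)) (islin_sum _ _ _ (evS y)) (islin_sum _ _ _ evV).
rewrite mulr_suml -(pair_bigA _ (fun l m => (c l * d m) *: (ab (l, m) x y : R[i]^o))) /=.
apply: eq_bigr => l _; rewrite mulr_sumr; apply: eq_bigr => m _.
by rewrite -[LHS]/(c l * val (a l) x * (d m * val (b m) y)) mulrACA.
Qed.

(** Stage 0 lies in the tensor product, of growth 2n. Taking m = k + 1 in [Gmix_iter], k + 1 times
    the dimension of stage j + 1 at k is at most that of stage j at 2k + 1, so dividing by k + 1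
    lowers the exponent by one. *)
Lemma Gmix_bound j : (j <= n)%N -> grows X D u -> grows X D v ->
  exists c, forall k, dim_le (Gmix j k) (c * k.+1 ^ (n + n - j)).
Proof.
move=> + [cu Hu] [cv Hv]; elim: j => [|j IH] jn.
  exists (cu * cv)%N => k; apply: (dim_le_sub (B := tens k)); last first.
    by rewrite subn0 expnD mulnACA; apply: tens_dim.
  move=> _ [F wF <-]; rewrite (_ : (fun x y => _) = F); first exact: words_tens wF.
  by apply/funext => x; apply/funext => y; congr (F x _); apply/rowP => i; rewrite mxE.
have [c Hc] := IH (ltnW jn); set l := (n + n - j.+1)%N.
have lE : (n + n - j = l.+1)%N by rewrite /l subnSK// (leq_trans jn)// leq_addr.
exists (c * 2 ^ l.+1)%N => k e /(@Gmix_iter _ _ _ k.+1 jn)/Hc.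
rewrite lE (_ : (k + k.+1).+1 = 2 * k.+1)%N; last by rewrite -addSn addnn mul2n.
rewrite expnMn (expnS k.+1) => h; rewrite -(leq_pmul2l (ltn0Sn k)); apply: leq_trans h _.
by rewrite mulnA [leqLHS]mulnCA.
Qed.

Lemma diag_Gmix k (H : V2) : words n k H -> exists2 G, Gmix n k G & (fun x => G x x) = (fun x => H x x).
Proof.
move=> wH; exists (fun x y => H x (mix n x y)); first by exists H.
by apply/funext => x; congr (H x _); apply/rowP => i; rewrite mxE ltn_ord.
Qed.

(** The Leibniz rule, summand by summand. *)
Lemma tens_diag k F i : tens k F ->
  schwartz (fun x => F x x) /\
  pderiv i (fun x => F x x) = (fun x => (D1 i F + D2 i F) x x).
Proof.
elim=> [|p q G _ _ tG [sG dG]].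
  rewrite D1_0 D2_0 addr0; split; first exact: schwartz0.
  rewrite -[LHS]/(pderiv i (0 : fn R n)) -[X in pderiv i X](scale0r (0 : fn R n)).
  by rewrite pderivZ ?scale0r//; exact: schwartz0.
have [sp sq] := (sval_schwartz p, sval_schwartz q).
have spq := schwartz_pointwise sp sq.
have E : (fun x => val p x * val q x + G x x) = 1 *: pointwise (val p) (val q) + (fun x => G x x).
  by rewrite scale1r.
rewrite E; split; first exact: schwartzL.
rewrite pderivP// scale1r pderiv_pointwise// dG (D1_tens _ _ _ tG) (D2_tens _ _ _ tG).
apply/funext => x.
rewrite -[RHS]/((val (dS i p) x * val q x + D1 i G x x) + (val p x * val (dS i q) x + D2 i G x x)).
by rewrite addrACA.
Qed.

(** On the diagonal, x_i and d_i act on the product as [X1 i] and as [D1 i] plus [D2 i]. So step k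
    for the product consists of diagonal values of stage n, whose growth is 2n - n = n. *)
Lemma grows_pointwise (w : S) : val w = pointwise (val u) (val v) ->
  grows X D u -> grows X D v -> grows X D w.
Proof.
move=> wE gu gv; have [c] := Gmix_bound (leqnn n) gu gv; rewrite addnK => Hc.
exists c => k e [b ib Wb]; apply: (Hc k e).
pose Qs m : set S := [set w' : S | exists2 H, words n m H & val w' = (fun x => H x x)].
have Q m : Gam X D w m `<=` Qs m.
  apply: (@Gam_ind R[i] n S X D w Qs).
  - by exists (fun x y => val u x * val v y) => //; exact: words_base.
  - move=> l; split; first by exists 0 => //; exact: words_zero.
    move=> a w1 w2 [H1 wH1 E1] [H2 wH2 E2]; exists (a *: H1 + H2); first exact: words_lin.
    by rewrite /= E1 E2.
  - by move=> l w1 [H wH E]; exists H => //; exact: words_up.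
  - by move=> l i w1 [H wH E]; exists (X1 i H); [exact: words_X1|rewrite /= E].
  - move=> l i w1 [H wH E]; exists (D1 i H + D2 i H); first exact: words_D.
    by rewrite /= E; have [_ ->] := tens_diag i (words_tens wH).
have /choice[G HG] : forall l, exists G, Gmix n k G /\ (fun x => G x x) = val (b l).
  by move=> l; have [H /diag_Gmix[G GG E] ->] := Q _ _ (Wb l); exists G.
exists G => [d E|i]; last by have [] := HG i.
apply: ib; apply: val_inj; apply/funext => x; have := congr1 (fun F : V2 => F x x) E.
have evS : islin (fun w : S => (val w x : R[i]^o)) by [].
have evV : islin (fun F : V2 => (F x x : R[i]^o)) by [].
rewrite (islin_sum _ _ _ evS) (islin_sum _ _ _ evV) => E'.
rewrite -[RHS]/((0 : V2) x x) -E'; apply: eq_bigr => i _.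
by have [_ /(congr1 (fun f => f x))] := HG i; rewrite /= => ->.
Qed.

End ProductGrowth.

(** * Closure properties of the holonomic Schwartz class *)

Section HolonomicSchwartz.
Context {R : realType} {n : nat}.
Local Notation S := (schwartz_space R n).
Local Notation X := (@xS R n).
Local Notation D := (@dS R n).
Implicit Types (s t : fn R n) (u v : S).

(** Turns holonomicity into a growth bound; all closure properties below go through it. *)
Lemma holonomic_schwartzP u : holonomic_schwartz (val u) <-> grows X D u.
Proof.
have su := sval_schwartz u.
have annE : annihilator (distribution_of (val u)) = ann X D u.
  rewrite annihilatorE//; apply/seteqP; split=> T; rewrite /ann /= -val_wactS => H.
    exact: val_inj.
  by rewrite H.
have hP := holonomic_annP (@weyl_repS R n) (fun nz m k => @Gam_schwartz_lower R n u m k nz).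
split=> [[_ [_]]|/hP hu]; first by rewrite annE => /hP.
split=> //; split; first exact: distribution_of_is_distribution.
by rewrite annE.
Qed.

Lemma holonomic_sub : @holonomic_schwartz R n `<=` schwartz.
Proof. by move=> s []. Qed.

Lemma hol_grows s : holonomic_schwartz s -> exists2 u, val u = s & grows X D u.
Proof.
move=> hs; have ss := holonomic_sub hs; exists (mkS ss) => //.
exact/holonomic_schwartzP.
Qed.

(** Covers translation, modulation and both Fourier transforms: pulled back along [h], each
    generator becomes a combination of 1, x_j and d_j, of order at most one. *)
Lemma hol_map (h : fn R n -> fn R n) s :
  (forall s, schwartz s -> schwartz (h s)) ->
  (forall (a : R[i]) s t, schwartz s -> schwartz t -> h (a *: s + t) = a *: h s + h t) ->
  (forall j u, exists a b c : R[i],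
    xmul j (h (val u)) = h (val (a *: u + (b *: X j u + c *: D j u)))) ->
  (forall j u, exists a b c : R[i],
    pderiv j (h (val u)) = h (val (a *: u + (b *: X j u + c *: D j u)))) ->
  holonomic_schwartz s -> holonomic_schwartz (h s).
Proof.
move=> hs hl hx hd /hol_grows[u <- gu].
pose hS v : S := mkS (hs _ (sval_schwartz v)).
apply/(holonomic_schwartzP (hS u)).
have G k j v a b c : Gam X D u k v -> Gam X D u k.+1 (a *: v + (b *: X j v + c *: D j v)).
  move=> Gv; have [_ Gl] := Gam_lin X D u k.+1; have [G0 _] := Gam_lin X D u k.+1.
  apply: (Gl); first exact: Gam_le Gv.
  apply: (Gl); first exact: GamX (@weyl_repS R n) _ _ _ _ Gv.
  by rewrite -[c *: _]addr0; apply: (Gl) => //; exact: GamD (@weyl_repS R n) _ _ _ _ Gv.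
apply: grows_map gu.
- by move=> a v w; apply: val_inj; apply: hl; exact: sval_schwartz.
- move=> k j v Gv; have [a [b [c E]]] := hx j v; exists (a *: v + (b *: X j v + c *: D j v)).
    exact: G.
  exact: val_inj.
- move=> k j v Gv; have [a [b [c E]]] := hd j v; exists (a *: v + (b *: X j v + c *: D j v)).
    exact: G.
  exact: val_inj.
Qed.

Lemma hol_lin : linear_subspace (@holonomic_schwartz R n).
Proof.
split; first by apply/(holonomic_schwartzP 0); exact: grows0 (@weyl_repS R n).
move=> c _ _ /hol_grows[u <- gu] /hol_grows[v <- gv].
rewrite -valSP; apply/holonomic_schwartzP; exact: (grows_lin (@weyl_repS R n) _ gu gv).
Qed.

Lemma hol_act T s : holonomic_schwartz s -> holonomic_schwartz (fn_act T s).
Proof.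
move=> /hol_grows[u <- gu]; rewrite -val_wactS; apply/holonomic_schwartzP.
exact: grows_act (@weyl_repS R n) _ _ gu.
Qed.

Lemma hol_translate x s : holonomic_schwartz s -> holonomic_schwartz (translate x s).
Proof.
apply: hol_map => [t|a t t' st st'||].
- exact: translate_schwartz.
- by [].
- move=> j u; exists (x 0 j)%:C, 1, 0; rewrite xmul_translate.
  by rewrite !scale0r scale1r addr0 addrC.
- move=> j u; exists 0, 0, 1; rewrite pderiv_translate; last exact: sval_schwartz.
  by rewrite !scale0r scale1r !add0r.
Qed.

Lemma hol_modulate xi s : holonomic_schwartz s -> holonomic_schwartz (modulate xi s).
Proof.
apply: hol_map => [t|a t t' st st'||].
- exact: modulate_schwartz.
- by apply/funext => y; rewrite /modulate -[RHS]/(a * (_ * t y) + _ * t' y) mulrCA -mulrDr.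
- move=> j u; exists 0, 1, 0; rewrite xmul_modulate.
  by rewrite !scale0r scale1r addr0 add0r.
- move=> j u; exists (itau * (xi 0 j)%:C), 0, 1; rewrite pderiv_modulate; last exact: sval_schwartz.
  rewrite scale0r scale1r add0r -modulateZ.
  by apply/funext => y; rewrite /modulate -mulrDr.
Qed.

Lemma hol_fourier s : holonomic_schwartz s -> holonomic_schwartz (fourier s).
Proof.
have t0 := @itau_neq0 R.
apply: hol_map => [t|a t t' st st'|j u|j u].
- exact: fourier_schwartz.
- by rewrite !fourierE//; [apply: ftP => //; exact: two_pi_neq0|exact: schwartzL].
- have su := sval_schwartz u; exists 0, 0, ((- itau)^-1); rewrite !scale0r !add0r.
  rewrite -[X in _ = fourier X]/((- itau)^-1 *: pderiv j (val u)) fourierZ; last exact: schwartz_pderiv.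
  by rewrite fourier_pderiv// scalerA mulVf ?scale1r// oppr_eq0.
- have su := sval_schwartz u; exists 0, itau, 0; rewrite !scale0r addr0 add0r.
  rewrite -[X in _ = fourier X]/(itau *: xmul j (val u)) fourierZ; last exact: schwartz_xmul.
  by rewrite fourier_xmul// scalerA mulfV ?scale1r.
Qed.

Lemma hol_ifourier s : holonomic_schwartz s -> holonomic_schwartz (ifourier s).
Proof.
have t0 := @itau_neq0 R.
apply: hol_map => [t|a t t' st st'|j u|j u].
- exact: ifourier_schwartz.
- by apply: ftP => //; exact: two_piN_neq0.
- have su := sval_schwartz u; exists 0, 0, (itau^-1); rewrite !scale0r !add0r.
  rewrite -[X in _ = ifourier X]/(itau^-1 *: pderiv j (val u)) ifourierZ; last exact: schwartz_pderiv.
  by rewrite xmul_ifourier.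
- have su := sval_schwartz u; exists 0, (- itau), 0; rewrite !scale0r addr0 add0r.
  rewrite -[X in _ = ifourier X]/(- itau *: xmul j (val u)) ifourierZ; last exact: schwartz_xmul.
  by rewrite pderiv_ifourier.
Qed.

Lemma hol_pointwise s t :
  holonomic_schwartz s -> holonomic_schwartz t -> holonomic_schwartz (pointwise s t).
Proof.
move=> /hol_grows[u <- gu] /hol_grows[v <- gv].
pose w : S := mkS (schwartz_pointwise (sval_schwartz u) (sval_schwartz v)).
by apply/(holonomic_schwartzP w); exact: (@grows_pointwise _ _ u v).
Qed.

Lemma hol_convolution s t :
  holonomic_schwartz s -> holonomic_schwartz t -> holonomic_schwartz (convolution s t).
Proof.
move=> hs ht; rewrite convolutionE; [|exact: holonomic_sub|exact: holonomic_sub].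
by apply: hol_ifourier; apply: hol_pointwise; exact: hol_fourier.
Qed.

End HolonomicSchwartz.

Theorem proposition78 (R : realType) (n : nat) :
  [/\ regular_twain_subsinglet (@holonomic_schwartz R n),
      compatible_weyl_action (@schwartz R n) fn_act &
      compatible_weyl_action (@holonomic_schwartz R n) fn_act].
Proof.
have hs := @holonomic_sub R n; have hl := @hol_lin R n.
have bijh : set_bij (@holonomic_schwartz R n) (@holonomic_schwartz R n) fourier.
  by apply: (set_bij_fourier hs) => s; [exact: hol_fourier|exact: hol_ifourier].
have bijs : set_bij (@schwartz R n) (@schwartz R n) fourier.
  apply: set_bij_fourier => s; [by []|exact: fourier_schwartz|exact: ifourier_schwartz].
have lins : linear_subspace (@schwartz R n).
  by split=> [|c s t]; [exact: schwartz0|exact: schwartzL].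
split.
- split; last exact: bijh.
  split; [exact: hs|exact: hl| | |exact: hol_fourier].
    by split=> s t; [exact: hol_pointwise|exact: hol_convolution].
  move=> s h; split=> [c _|x|xi]; [|exact: hol_translate|exact: hol_modulate].
  by rewrite -[c *: s]addr0; apply: hl.2; [exact: h|exact: hl.1].
- by apply: compatible_fn_act => [s|||]; [| exact: lins|move=> T s; exact: fn_act_schwartz|exact: bijs].
- by apply: compatible_fn_act; [exact: hs|exact: hl|move=> T s; exact: hol_act|exact: bijh].
Qed.
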